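(* Let $G=U(2,1)(L/K)$ be the unramified unitary group in three variables and let $\mathcal{H}$ be its pro-$p$ Iwahori--Hecke algebra over $R$ (here $\mathcal{H}=\mathcal{H}^{\mathrm{aff}}$), with $S^{\mathrm{aff}}=\{s_1,s_2\}$ numbered as in the context. Let $\chi=\zeta\otimes\eta$ be a character of $Z_k$. (1) If $\chi$ is trivial (of trivial-Iwahori type), then for $i,j\in\{1,2\}$ the dimension of $\operatorname{Ext}^1_{\mathcal{H}}(\xi_{\chi,\{s_i\}},\xi_{\chi,\{s_j\}})$ is $1$ if $i\neq j$ and $0$ if $i=j$. (2) If $\chi$ is hybrid, then the dimension of $\operatorname{Ext}^1_{\mathcal{H}}(\xi_{\chi,I_1},\xi_{\chi,I_2})$ is $1$ for all $I_1,I_2\subseteq\{s_2\}$. (3) If $\chi$ is regular, then for a character $\chi'$ of $Z_k$ the dimension of $\operatorname{Ext}^1_{\mathcal{H}}(\xi_{\chi,\emptyset},\xi_{\chi',\emptyset})$ is $2$ if $\chi'=\chi^{s_1}$ and $0$ otherwise.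
   Context: $K$ is a non-discrete non-Archimedean local field with residue field $k$ of cardinality $q$, a power of the prime $p$; $R$ is an algebraically closed field of characteristic $p$. $L/K$ is the unramified quadratic extension with residue field $k_L$; $x\mapsto\bar x$ is the nontrivial element of $\mathrm{Gal}(k_L/k)$. $(W,h)$ is a $3$-dimensional $L$-vector space with non-degenerate hermitian form, and $\mathbf{G}$ is its isometry group over $K$, $G=\mathbf{G}(K)=U(2,1)(L/K)$. General notation. Let $\mathbf{T}\simeq\mathbb{G}_m$ be a maximal $K$-split torus, with centraliser $\mathbf{Z}$ and normaliser $\mathbf{N}$; $Z=\mathbf{Z}(K)$, $N=\mathbf{N}(K)$, $Z_0$ the parahoric subgroup of $Z$, $Z_1$ its maximal pro-$p$ subgroup, $Z_k=Z_0/Z_1$, and $W(1)=N/Z_1$, $N/Z_0$ the extended affine Weyl group. Fix a chamber $C$ in the apartment of $\mathbf{T}$ in the Bruhat--Tits building; $I_C$ is the maximal pro-$p$ subgroup of the Iwahori subgroup $P_C$. $S^{\mathrm{aff}}=\{s_1,s_2\}$ is the set of affine reflections in the two walls of $C$; $s_1s_2$ has infinite order. For $s\in S^{\mathrm{aff}}$ fixing the face $F$, let $P_F$ be the parahoric subgroup, $I_F$ its pro-$p$ radical, $G_{F,k}=P_F/I_F$, $U_{F,k},\overline U_{F,k}$ the unipotent radicals of the two opposite Borel subgroups of $G_{F,k}$ containing the image of $Z_0$, and $Z_{k,s}=Z_k\cap\langle U_{F,k},\overline U_{F,k}\rangle$. An admissible lift of $s$ is the image $\tilde s\in W(1)$ of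 an element of $N\cap P_F$ lifting $s$ whose image in $G_{F,k}$ lies in $\langle U_{F,k},\overline U_{F,k}\rangle$; fix one for each $s$ and write $T_s=T_{\tilde s}$. $\mathcal{H}=\operatorname{End}_G(\operatorname{ind}_{I_C}^G1)$ has basis $T_w$ $(w\in W(1))$, the characteristic functions of $I_CwI_C$, with $T_wT_{w'}=T_{ww'}$ when lengths add and $T_s^2=-c_sT_s$, $c_s=|Z_{k,s}|^{-1}\sum_{z\in Z_{k,s}}T_z$. $\mathcal{H}^{\mathrm{aff}}$ is the subalgebra generated by all $T_t$ ($t\in Z_k$) and $T_s$ ($s\in S^{\mathrm{aff}}$); here $\mathcal{H}=\mathcal{H}^{\mathrm{aff}}$. For a character $\chi:Z_k\to R^\times$, $S_\chi=\{s\in S^{\mathrm{aff}}:\chi(c_s)\ne0\}$ (i.e. $\chi$ trivial on $Z_{k,s}$), and for $I\subseteq S_\chi$, $\xi_{\chi,I}:\mathcal{H}\to R$ is the character with $\xi_{\chi,I}(T_t)=\chi(t)$ for $t\in Z_k$, $\xi_{\chi,I}(T_s)=-1$ for $s\in I$, $\xi_{\chi,I}(T_s)=0$ for $s\notin I$. $\operatorname{Ext}^1_{\mathcal{H}}(\xi,\xi')$ denotes the space of equivalence classes of extensions $0\to\xi\to E\to\xi'\to0$ of $\mathcal{H}$-modules. Specific to $U(2,1)$. $Z_k\simeq k_L^\times\times U(1)(k_L/k)$, the determinant being the second projection. The reflections are numbered so that the reductive quotient over $k$ at the face fixed by $s_1$ is $U(2,1)(k_L/k)$ and at the face fixed by $s_2$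 is $U(1,1)(k_L/k)\times U(1)(k_L/k)$; then $Z_{k,s_1}$ is the first factor $k_L^\times$ of $Z_k$ and $Z_{k,s_2}$ is $k^\times$ embedded in the first factor. A character of $Z_k$ has the form $\chi=\zeta\otimes\eta$ with $\zeta:k_L^\times\to R^\times$, $\eta:U(1)(k_L/k)\to R^\times$ characters; $W(1)$ acts on $Z_k$ through a quotient of order two generated by the image of $s_1$, and $\chi^{s_1}=\overline\zeta\otimes\eta$ with $\overline\zeta(x)=\zeta(\bar x^{-1})$. $\chi$ is called trivial (trivial-Iwahori) if $\zeta=1$ (then $S_\chi=S^{\mathrm{aff}}$); hybrid if $\zeta\neq1$ and $\zeta^{q+1}=1$ (then $S_\chi=\{s_2\}$); regular if $\chi$ is non-trivial on both $Z_{k,s_1}$ and $Z_{k,s_2}$, i.e. $\zeta^{q+1}\neq1$ (then $S_\chi=\emptyset$). *)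

(* Defs.v *)
From HB Require Import structures.
From mathcomp Require Import all_boot all_order all_algebra all_field.
From mathcomp Require Import boolp classical_sets functions.

Set Implicit Arguments.
Unset Strict Implicit.
Unset Printing Implicit Defensive.

Import Order.TTheory GRing.Theory Num.Theory.
Local Open Scope ring_scope.

(* [Ext^1_A(M, N)] is the set of the classes, modulo [ext_eq], of the extensions
   [0 -> M -> E -> N -> 0], with the Baer sum as addition. *)

Section YonedaExt.
Variables (R : comNzRingType) (A : algType R) (M N : lmodType A).

Record ext := Ext {
  ext_mod :> lmodType A;
  ext_in : {linear M -> ext_mod};
  ext_out : {linear ext_mod -> N};
  ext_in_inj : injective ext_in;
  ext_out_surj : forall y, exists x, ext_out x = y;
  ext_exact : forall x, ext_out x = 0 <-> exists m, x = ext_in m }.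

(* Such an [f] is automatically bijective. *)
Definition ext_eq (X Y : ext) : Prop :=
  exists f : {linear X -> Y},
    (forall m, f (ext_in X m) = ext_in Y m) /\
    (forall x, ext_out Y (f x) = ext_out X x).

(* [Z] represents the Baer sum of the classes of [X] and [Y]: there is an
   [A]-linear map, from the fibre product of [X] and [Y] over [N] to [Z], which
   induces the identity of [N] and the addition [M * M -> M].  The values of
   [f] outside of the fibre product are irrelevant. *)
Definition ext_sum (X Y Z : ext) : Prop :=
  exists f : X * Y -> Z,
    [/\ forall a (u v : X * Y),
          ext_out X u.1 = ext_out Y u.2 -> ext_out X v.1 = ext_out Y v.2 ->
          f (a *: u + v) = a *: f u + f v,
        forall m m', f (ext_in X m, ext_in Y m') = ext_in Z (m + m') &
        forall u : X * Y,
          ext_out X u.1 = ext_out Y u.2 -> ext_out Z (f u) = ext_out X u.1].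

(* [Y] represents [c] times the class of [X], that is, the push-out of [X]
   along the multiplication by [c] on [M]. *)
Definition ext_scale (c : R) (X Y : ext) : Prop :=
  exists f : {linear X -> Y},
    (forall m, f (ext_in X m) = ext_in Y (c%:A *: m)) /\
    (forall x, ext_out Y (f x) = ext_out X x).

(* [Ext^1(M, N)] is isomorphic to [R^d], through a linear bijection whose value
   at [v] is the class of [E v]. *)
Definition Ext1_dim (d : nat) : Prop :=
  exists E : 'rV[R]_d -> ext,
    [/\ forall X, exists v, ext_eq X (E v),
        forall u v, ext_eq (E u) (E v) -> u = v,
        forall u v, ext_sum (E u) (E v) (E (u + v)) &
        forall c v, ext_scale c (E v) (E (c *: v))].

End YonedaExt.

Definition char_mod (R : comNzRingType) (A : algType R)
  (xi : {lrmorphism A -> R^o}) : Type := R.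

Section CharMod.
Variables (R : comNzRingType) (A : algType R) (xi : {lrmorphism A -> R^o}).

HB.instance Definition _ := GRing.Zmodule.on (char_mod xi).

Definition char_mod_scale (a : A) (m : char_mod xi) : char_mod xi :=
  (xi a : R) * (m : R).

Fact char_mod_scaleA a b m :
  char_mod_scale a (char_mod_scale b m) = char_mod_scale (a * b) m.
Proof. by rewrite /char_mod_scale rmorphM mulrA. Qed.

Fact char_mod_scale1 : left_id 1 char_mod_scale.
Proof. by move=> m; rewrite /char_mod_scale rmorph1 mul1r. Qed.

Fact char_mod_scaleDr : right_distributive char_mod_scale +%R.
Proof. by move=> a m m'; rewrite /char_mod_scale mulrDr. Qed.

Fact char_mod_scaleDl m : {morph char_mod_scale^~ m : a b / a + b}.
Proof. by move=> a b; rewrite /char_mod_scale rmorphD mulrDl. Qed.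

HB.instance Definition _ := GRing.Zmodule_isLmodule.Build A (char_mod xi)
  char_mod_scaleA char_mod_scale1 char_mod_scaleDr char_mod_scaleDl.

End CharMod.

Section Hecke.
Variables (R : comNzRingType) (G : groupType) (I : groupClosed G).

(* Left [I]-invariant functions whose support is a finite union of cosets
   [I g]. *)
Definition in_ind : {pred G -> R^o} := fun f =>
  `[< (forall u g, u \in I -> f (u * g)%g = f g) /\
      (exists s : seq G, forall g, f g != 0 ->
         exists2 x, x \in s & (g * x^-1)%g \in I) >].

Fact in_ind_submod_closed : subsemimod_closed in_ind.
Proof.
split; first split.
- by apply/asboolP; split=> //; exists [::] => g; rewrite eqxx.
- move=> f g /asboolP[fI [s fs]] /asboolP[gI [t gt]]; apply/asboolP; split.
    by move=> u x uI; rewrite /GRing.add/= fI ?gI.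
  exists (s ++ t) => x; rewrite /GRing.add/=.
  have [f0 | /fs[y ys yI] _] := eqVneq (f x) 0.
    rewrite f0 add0r => /gt[y yt yI].
    by exists y => //; rewrite mem_cat yt orbT.
  by exists y => //; rewrite mem_cat ys.
- move=> a f /asboolP[fI [s fs]]; apply/asboolP; split.
    by move=> u x uI; rewrite /GRing.scale/= fI.
  exists s => x; rewrite /GRing.scale/= => afx; apply: fs.
  by apply: contraNneq afx => ->; rewrite scaler0.
Qed.

HB.instance Definition _ :=
  GRing.isSubmodClosed.Build R (G -> R^o) in_ind in_ind_submod_closed.

Record ind := Ind { ind_val :> G -> R^o; ind_valP : ind_val \in in_ind }.
HB.instance Definition _ := [isSub for ind_val].
HB.instance Definition _ := [Choice of ind by <:].
HB.instance Definition _ := [SubChoice_isSubLmodule of ind by <:].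

Fact ind1_subproof : (fun g => (g \in I)%:R) \in in_ind.
Proof.
apply/asboolP; split=> [u g uI|]; first by rewrite gpredMl.
exists [:: 1%g] => g; case gI: (g \in I); rewrite ?eqxx // => _.
by exists 1%g; rewrite ?mem_head // invg1 mulg1.
Qed.

Definition ind1 : ind := Ind ind1_subproof.

Fact ind_act_subproof (g : G) (f : ind) : (fun x => f (x * g)%g) \in in_ind.
Proof.
have /asboolP[fI [s fs]] := ind_valP f; apply/asboolP; split.
  by move=> u x uI /=; rewrite -mulgA [LHS]fI.
exists [seq (x * g^-1)%g | x <- s] => x /fs[y ys yI].
exists (y * g^-1)%g; first exact: map_f.
by rewrite invgM invgK mulgA.
Qed.

Definition ind_act (g : G) (f : ind) : ind := Ind (ind_act_subproof g f).

Definition in_hecke : {pred ind -> ind} := fun phi =>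
  `[< (forall a f f', phi (a *: f + f') = a *: phi f + phi f') /\
      (forall g f, phi (ind_act g f) = ind_act g (phi f)) >].

Fact ind_act_is_linear g a f f' :
  ind_act g (a *: f + f') = a *: ind_act g f + ind_act g f'.
Proof. exact/val_inj. Qed.

Fact in_hecke_submod_closed : subsemimod_closed in_hecke.
Proof.
split; first split.
- apply/asboolP; split=> [a f f'|g f]; rewrite /GRing.zero/=.
    by rewrite scaler0 addr0.
  by apply: val_inj.
- move=> p p' /asboolP[pL pG] /asboolP[p'L p'G]; apply/asboolP.
  split=> [a f f'|g f]; rewrite [LHS]/GRing.add/=.
    by rewrite pL p'L scalerDr addrACA.
  by rewrite pG p'G; apply: val_inj.
- move=> c p /asboolP[pL pG]; apply/asboolP.
  split=> [a f f'|g f]; rewrite [LHS]/GRing.scale/=.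
    by rewrite pL scalerDr !scalerA mulrC.
  by rewrite pG; apply: val_inj.
Qed.

HB.instance Definition _ :=
  GRing.isSubmodClosed.Build R (ind -> ind) in_hecke in_hecke_submod_closed.

(* [End_G(ind_I^G 1)], with the composition as product. *)
Record hecke :=
  Hecke { hecke_val :> ind -> ind; hecke_valP : hecke_val \in in_hecke }.
HB.instance Definition _ := [isSub for hecke_val].
HB.instance Definition _ := [Choice of hecke by <:].
HB.instance Definition _ := [SubChoice_isSubLmodule of hecke by <:].

Fact hecke_one_subproof : id \in in_hecke.
Proof. exact/asboolP. Qed.

Definition hecke_one := Hecke hecke_one_subproof.

Fact hecke_mul_subproof (p p' : hecke) : p \o p' \in in_hecke.
Proof.
have /asboolP[pL pG] := hecke_valP p; have /asboolP[p'L p'G] := hecke_valP p'.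
by apply/asboolP; split=> [a f f'|g f]; rewrite /= ?p'L ?pL ?p'G ?pG.
Qed.

Definition hecke_mul p p' := Hecke (hecke_mul_subproof p p').

Fact hecke_mulA : associative hecke_mul.
Proof. by move=> p p' p''; apply: val_inj. Qed.

Fact hecke_mul1 : left_id hecke_one hecke_mul.
Proof. by move=> p; apply: val_inj. Qed.

Fact hecke_mulr1 : right_id hecke_one hecke_mul.
Proof. by move=> p; apply: val_inj. Qed.

Fact hecke_mulDl : left_distributive hecke_mul +%R.
Proof. by move=> p p' p''; apply: val_inj. Qed.

Fact hecke_mulDr : right_distributive hecke_mul +%R.
Proof.
move=> p p' p''; apply: val_inj; have /asboolP[pL _] := hecke_valP p.
by apply/funext => f; have := pL 1 (p' f) (p'' f); rewrite !scale1r.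
Qed.

Fact hecke_one_neq0 : hecke_one != 0.
Proof.
apply/eqP => /(congr1 (fun p : hecke => (p ind1 : ind) 1%g)) /eqP.
by rewrite /= gpred1 oner_eq0.
Qed.

HB.instance Definition _ := GRing.Zmodule_isNzRing.Build hecke
  hecke_mulA hecke_mul1 hecke_mulr1 hecke_mulDl hecke_mulDr hecke_one_neq0.

Fact hecke_scaleAl (a : R) (p p' : hecke) : a *: (p * p') = (a *: p) * p'.
Proof. exact/val_inj. Qed.

HB.instance Definition _ :=
  GRing.Lmodule_isLalgebra.Build R hecke hecke_scaleAl.

Fact hecke_scaleAr (a : R) (p p' : hecke) : a *: (p * p') = p * (a *: p').
Proof.
apply/val_inj/funext => f; have /asboolP[pL _] := hecke_valP p.
have p0 : p 0 = 0 by have := pL (-1) 0 0; rewrite scaler0 addr0 scaleN1r addNr.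
by have := pL a (p' f) 0; rewrite p0 !addr0.
Qed.

HB.instance Definition _ :=
  GRing.Lalgebra_isAlgebra.Build R hecke hecke_scaleAr.

(* As the indicator function [ind1] of [I] generates [ind], this says that
   [p] is the operator [T_g] which corresponds, by Frobenius reciprocity, to
   the indicator function of [I g I]. *)
Definition is_heckeT (g : G) (p : hecke) : Prop :=
  forall x, p ind1 x =
    `[< exists u v, [/\ u \in I, v \in I & x = (u * g * v)%g] >]%:R.

End Hecke.

(* [v] is only meaningful on nonzero elements. *)
Definition val_ge (F : fieldType) (v : F -> int) (m : int) (x : F) : bool :=
  (x == 0) || (m <= v x).

(* A complete discretely valued field [F], with its normalised valuation, and
   a model [k] of its finite residue field.  The value of [lf_red] on
   non-integral elements is irrelevant. *)
Record local_field (F : fieldType) (k : finFieldType) := LocalField {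
  lf_val : F -> int;
  lf_red : F -> k;
  lf_valM : forall x y, x != 0 -> y != 0 ->
    lf_val (x * y) = lf_val x + lf_val y;
  lf_valD : forall m x y,
    val_ge lf_val m x -> val_ge lf_val m y -> val_ge lf_val m (x + y);
  lf_val_unif : exists2 x, x != 0 & lf_val x = 1;
  lf_complete : forall u : nat -> F,
    (forall m : int, exists n0, forall i j, (n0 <= i)%N -> (n0 <= j)%N ->
       val_ge lf_val m (u i - u j)) ->
    exists l, forall m : int, exists n0, forall i, (n0 <= i)%N ->
       val_ge lf_val m (u i - l);
  lf_redD : forall x y, val_ge lf_val 0 x -> val_ge lf_val 0 y ->
    lf_red (x + y) = lf_red x + lf_red y;
  lf_redM : forall x y, val_ge lf_val 0 x -> val_ge lf_val 0 y ->
    lf_red (x * y) = lf_red x * lf_red y;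
  lf_red1 : lf_red 1 = 1;
  lf_red_ker : forall x, val_ge lf_val 0 x ->
    lf_red x = 0 <-> val_ge lf_val 1 x;
  lf_red_surj : forall a, exists2 x, val_ge lf_val 0 x & lf_red x = a }.

Section LocalFieldFacts.
Variables (F : fieldType) (k : finFieldType) (E : local_field F k).
Local Notation integral := (val_ge (lf_val E)).

Fact val_ge0 m : integral m 0.
Proof. by rewrite /val_ge eqxx. Qed.

Fact val_geM m n x y :
  integral m x -> integral n y -> integral (m + n) (x * y).
Proof.
rewrite /val_ge mulf_eq0; have [-> //|x0] := eqVneq x 0.
have [-> //|y0] := eqVneq y 0; rewrite ?orbT //= => mx ny.
by rewrite lf_valM // lerD.
Qed.

Fact val_ge_sum m (J : finType) (f : J -> F) :
  (forall j, integral m (f j)) -> integral m (\sum_j f j).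
Proof. by move=> fJ; elim/big_ind: _ => //; [apply: val_ge0 | apply: lf_valD]. Qed.

Fact lf_red0 : lf_red E 0 = 0.
Proof. by apply/lf_red_ker; apply: val_ge0. Qed.

Fact lf_red_sum (J : finType) (f : J -> F) :
  (forall j, integral 0 (f j)) -> lf_red E (\sum_j f j) = \sum_j lf_red E (f j).
Proof.
move=> fJ; suff [] : integral 0 (\sum_j f j) /\
  lf_red E (\sum_j f j) = \sum_j lf_red E (f j) by [].
elim/big_ind2: _ => [|x a y b [x0 <-] [y0 <-]|j _].
- by rewrite lf_red0; split=> //; apply: val_ge0.
- by rewrite lf_redD //; split=> //; apply: lf_valD.
- by split.
Qed.

Fact val_ge1 : integral 0 1.
Proof.
have := lf_valM E (oner_neq0 F) (oner_neq0 F).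
rewrite mulr1 => /(congr1 (fun z => z - lf_val E 1)).
by rewrite addrK subrr /val_ge => <-; rewrite lexx orbT.
Qed.

End LocalFieldFacts.

(* [uq_conj] generates [Gal(L/K)] and [uq_bar] generates [Gal(kL/k)]. *)
Record unramified_quadratic (K : fieldType) (L : fieldExtType K)
    (k kL : finFieldType) := UnramifiedQuadratic {
  uq_base : local_field K k;
  uq_ext : local_field L kL;
  uq_dim : (\dim {:L} = 2)%N;
  uq_val : forall x : K, x != 0 -> lf_val uq_ext x%:A = lf_val uq_base x;
  uq_res : #|kL| = (#|k| ^ 2)%N;
  uq_conj : {lrmorphism L -> L};
  uq_conj_neq : exists x, uq_conj x != x;
  uq_bar : {rmorphism kL -> kL};
  uq_bar_fix : forall x : K, val_ge (lf_val uq_base) 0 x ->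
    uq_bar (lf_red uq_ext x%:A) = lf_red uq_ext x%:A;
  uq_bar_neq : exists x, uq_bar x != x }.

Section Unitary.
Variables (K : fieldType) (L : fieldExtType K) (k kL : finFieldType).
Variable E : unramified_quadratic L k kL.

Local Notation integral := (val_ge (lf_val (uq_ext E))).
Local Notation red := (lf_red (uq_ext E)).

Definition adjmx m n (A : 'M[L]_(m, n)) : 'M[L]_(n, m) :=
  (map_mx (uq_conj E) A)^T.

(* [W] is identified with the column vectors through the choice of a basis,
   and [h(x, y) = x^* H y], where [H] is the Gram matrix. *)
Record hermitian_space := HermitianSpace {
  gram : 'M[L]_3;
  gram_hermitian : adjmx gram = gram;
  gram_nondegenerate : gram \in unitmx }.

Variable V : hermitian_space.

Definition is_isometry (g : 'M[L]_3) := adjmx g *m gram V *m g == gram V.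

Record unitary := Unitary { uval :> 'M[L]_3; uvalP : is_isometry uval }.
HB.instance Definition _ := [isSub for uval].
HB.instance Definition _ := [Choice of unitary by <:].

Fact adjmxM m n p (A : 'M[L]_(m, n)) (B : 'M[L]_(n, p)) :
  adjmx (A *m B) = adjmx B *m adjmx A.
Proof. by rewrite /adjmx map_mxM trmx_mul. Qed.

Fact adjmx1 n : adjmx (1%:M : 'M[L]_n) = 1%:M.
Proof. by rewrite /adjmx map_mx1 trmx1. Qed.

Fact unitary_unitmx (g : unitary) : uval g \in unitmx.
Proof.
have /eqP gP := uvalP g; have := gram_nondegenerate V.
by rewrite -{1}gP !unitmx_mul => /andP[].
Qed.

Fact unitary_one_subproof : is_isometry 1%:M.
Proof. by rewrite /is_isometry adjmx1 mul1mx mulmx1. Qed.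

Definition unitary_one := Unitary unitary_one_subproof.

Fact unitary_mul_subproof (g g' : unitary) : is_isometry (uval g *m uval g').
Proof.
have := uvalP g'; rewrite /is_isometry -{1}(eqP (uvalP g)) adjmxM.
by rewrite !mulmxA.
Qed.

Definition unitary_mul g g' := Unitary (unitary_mul_subproof g g').

Fact unitary_inv_subproof (g : unitary) : is_isometry (invmx (uval g)).
Proof.
have gU := unitary_unitmx g; rewrite /is_isometry -{1}(eqP (uvalP g)).
by rewrite !mulmxA -adjmxM mulmxV // adjmx1 mul1mx -mulmxA mulmxV ?mulmx1.
Qed.

Definition unitary_inv g := Unitary (unitary_inv_subproof g).

Fact unitary_mulA : associative unitary_mul.
Proof. by move=> g g' g''; apply: val_inj; rewrite /= mulmxA. Qed.

Fact unitary_mul1 : left_id unitary_one unitary_mul.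
Proof. by move=> g; apply: val_inj; rewrite /= mul1mx. Qed.

Fact unitary_mulr1 : right_id unitary_one unitary_mul.
Proof. by move=> g; apply: val_inj; rewrite /= mulmx1. Qed.

Fact unitary_mulV : left_inverse unitary_one unitary_inv unitary_mul.
Proof.
by move=> g; apply: val_inj; rewrite /= mulVmx // unitary_unitmx.
Qed.

Fact unitary_mulrV : right_inverse unitary_one unitary_inv unitary_mul.
Proof.
by move=> g; apply: val_inj; rewrite /= mulmxV // unitary_unitmx.
Qed.

HB.instance Definition _ := isGroup.Build unitary
  unitary_mulA unitary_mul1 unitary_mulr1 unitary_mulV unitary_mulrV.

(* A basis [e_1, e_0, e_{-1}] of [W] (the columns of [frame]) in which [h] is a
   multiple of the antidiagonal form.  It amounts to the choice of the torus
   [T] and of the chamber [C]: [T] stabilises the lines spanned by [e_1] and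
   [e_{-1}] and fixes [e_0]; the vertices of [C] are given by the lattices
   [O e_1 + O e_0 + O e_{-1}] and [O e_1 + O e_0 + m e_{-1}] and their
   duals, where [O] is the ring of integers of [L] and [m] its maximal ideal. *)
Record chamber := Chamber {
  frame : 'M[L]_3;
  frame_scale : L;
  frame_unit : frame \in unitmx;
  frame_scale_neq0 : frame_scale != 0;
  frame_gram : adjmx frame *m gram V *m frame =
    frame_scale *: \matrix_(i, j) (j == rev_ord i)%:R }.

Variable C : chamber.

Definition coordmx (g : unitary) : 'M[L]_3 :=
  invmx (frame C) *m uval g *m frame C.

(* [A] stabilises the lattice [m^(d 0) e_1 + m^(d 1) e_0 + m^(d 2) e_{-1}]. *)
Definition stab_lattice (d : 'I_3 -> int) (A : 'M[L]_3) : bool :=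
  [forall i, forall j, integral (d i - d j) (A i j)].

Definition s1 : 'I_2 := ord0.
Definition s2 : 'I_2 := ord_max.

Definition vertex_exp (s : 'I_2) (i : 'I_3) : int :=
  ((s == s2) && (i == ord_max))%:R.

(* The parahoric subgroup at the vertex of [C] fixed by [s].  As [L/K] is
   unramified, the stabilisers of these lattices are connected; since [g] is an
   isometry it also stabilises the dual lattice.  The reductive quotients are
   [U(2,1)(kL/k)] for [s1] and [U(1,1)(kL/k) * U(1)(kL/k)] for [s2]. *)
Definition parahoric (s : 'I_2) : {pred unitary} := fun g =>
  stab_lattice (vertex_exp s) (coordmx g) &&
  stab_lattice (vertex_exp s) (coordmx g^-1%g).

Definition redmx (g : unitary) : 'M[kL]_3 := map_mx red (coordmx g).

(* The maximal pro-p subgroup [I_C] of the Iwahori subgroup: the matrices in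
   [GL_3(O)] whose reduction is upper unitriangular. *)
Definition proIwahori : {pred unitary} := fun g =>
  (g \in parahoric s1) &&
  [forall i : 'I_3, forall j : 'I_3,
     (j <= i)%N ==> (redmx g i j == (i == j)%:R)].

Fact coordmxM g g' : coordmx (g * g')%g = coordmx g *m coordmx g'.
Proof. by rewrite /coordmx !mulmxA mulmxK ?frame_unit. Qed.

Fact coordmx1 : coordmx 1%g = 1%:M.
Proof. by rewrite /coordmx mulmx1 mulVmx ?frame_unit. Qed.

Fact stab_latticeM d A B :
  stab_lattice d A -> stab_lattice d B -> stab_lattice d (A *m B).
Proof.
move=> /forallP dA /forallP dB; apply/forallP => i; apply/forallP => j.
rewrite mxE; apply: val_ge_sum => l.
have -> : d i - d j = (d i - d l) + (d l - d j) by rewrite addrA subrK.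
by apply: val_geM; [have /forallP := dA i | have /forallP := dB l].
Qed.

Fact stab_lattice1 d : stab_lattice d 1%:M.
Proof.
apply/forallP => i; apply/forallP => j; rewrite mxE.
by case: eqVneq => [->|_] /=; rewrite ?val_ge0 // subrr val_ge1.
Qed.

Fact parahoric1 s : 1%g \in parahoric s.
Proof. by apply/andP; rewrite invg1 coordmx1 stab_lattice1. Qed.

Fact parahoricM s g g' :
  g \in parahoric s -> g' \in parahoric s -> (g * g')%g \in parahoric s.
Proof.
move=> /andP[g1 g2] /andP[g'1 g'2]; apply/andP.
by rewrite invgM !coordmxM; split; apply: stab_latticeM.
Qed.

Fact parahoricV s g : g \in parahoric s -> g^-1%g \in parahoric s.
Proof. by move=> /andP[g1 g2]; apply/andP; rewrite invgK. Qed.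

Fact parahoric_s1_integral g i j :
  g \in parahoric s1 -> integral 0 (coordmx g i j).
Proof. by move=> /andP[/forallP/(_ i)/forallP/(_ j)]. Qed.

Fact redmxE g i j : redmx g i j = red (coordmx g i j).
Proof. by rewrite mxE. Qed.

Fact redmxM g g' : g \in parahoric s1 -> g' \in parahoric s1 ->
  redmx (g * g')%g = redmx g *m redmx g'.
Proof.
move=> gP g'P; apply/matrixP => i j; rewrite redmxE coordmxM [in LHS]mxE [in RHS]mxE.
rewrite lf_red_sum => [|l]; last first.
  by apply: (@val_geM _ _ _ 0 0); apply: parahoric_s1_integral.
apply: eq_bigr => l _; rewrite !redmxE.
by rewrite lf_redM //; apply: parahoric_s1_integral.
Qed.

Fact redmx1 : redmx 1%g = 1%:M.
Proof.
apply/matrixP => i j; rewrite redmxE coordmx1 !mxE.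
by case: (i == j); rewrite ?lf_red1 ?lf_red0.
Qed.

Fact proIwahoriP g : reflect
  [/\ g \in parahoric s1 & forall i j : 'I_3, (j <= i)%N ->
     redmx g i j = (i == j)%:R] (g \in proIwahori).
Proof.
apply: (iffP andP) => -[gP gU]; split=> //.
  by move=> i j ji; apply/eqP/(implyP (forallP (forallP gU i) j)).
apply/forallP => i; apply/forallP => j; apply/implyP => ji.
by rewrite gU.
Qed.

Fact proIwahori1 : 1%g \in proIwahori.
Proof.
by apply/proIwahoriP; split=> [|i j _]; rewrite ?parahoric1 // redmx1 mxE.
Qed.

Fact proIwahoriM : mulg_closed proIwahori.
Proof.
move=> g g' /proIwahoriP[gP gU] /proIwahoriP[g'P g'U]; apply/proIwahoriP.
split=> [|i j ji]; rewrite ?parahoricM // redmxM // mxE.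
rewrite (bigD1 i) //= gU // eqxx mul1r g'U // big1 ?addr0 // => l li.
case: (ltngtP l i) => [ll|ll|/val_inj le]; last by rewrite le eqxx in li.
  by rewrite gU 1?ltnW // eq_sym (negPf li) mul0r.
rewrite g'U; last exact: leq_trans ji (ltnW ll).
by rewrite -(inj_eq val_inj) gtn_eqF ?mulr0 // (leq_ltn_trans ji).
Qed.

Fact proIwahoriV : invg_closed proIwahori.
Proof.
move=> g /proIwahoriP[gP gU]; have gVP := parahoricV gP.
apply/proIwahoriP; split=> //.
have gE i j : \sum_l redmx g i l * redmx g^-1%g l j = (i == j)%:R.
  by have := redmx1; rewrite -(mulgV g) redmxM // => /matrixP/(_ i j); rewrite !mxE.
have gT (i l : 'I_3) : (l < i)%N -> redmx g i l = 0.
  by move=> li; rewrite gU 1?ltnW // -(inj_eq val_inj) gtn_eqF.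
suff H n : forall i : 'I_3, (3 - i <= n)%N -> forall j : 'I_3, (j <= i)%N ->
    redmx g^-1%g i j = (i == j)%:R.
  by move=> i j; apply: (H 3); rewrite leq_subr.
elim: n => [|n IHn] i; first by rewrite leqn0 subn_eq0 leqNgt ltn_ord.
move=> ni j ji; have := gE i j; rewrite (bigD1 i) //= gU // eqxx mul1r.
rewrite big1 ?addr0 // => l li.
case: (ltngtP l i) => [ll|ll|/val_inj le]; last by rewrite le eqxx in li.
  by rewrite gT ?mul0r.
rewrite IHn.
- by rewrite -(inj_eq val_inj) gtn_eqF ?mulr0 // (leq_ltn_trans ji).
- by rewrite -ltnS (leq_trans _ ni) // ltn_sub2l.
- exact: leq_trans ji (ltnW ll).
Qed.

HB.instance Definition _ := isInvClosed.Build unitary proIwahori proIwahoriV.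
HB.instance Definition _ := isMulClosed.Build unitary proIwahori proIwahoriM.
HB.instance Definition _ := isMul1Closed.Build unitary proIwahori proIwahori1.

Definition split_torus (g : unitary) : Prop :=
  exists2 a : K, a != 0 &
    coordmx g = diag_mx (\row_(j < 3) [:: a%:A; 1; (a^-1)%:A]`_j).

Definition torus_centraliser (g : unitary) : Prop :=
  forall t, split_torus t -> (g * t = t * g)%g.

Definition torus_normaliser (g : unitary) : Prop :=
  forall t, split_torus t <-> split_torus (g * t * g^-1)%g.

(* As the centraliser is an unramified torus, its parahoric subgroup [Z_0] is
   its maximal bounded subgroup. *)
Definition torus_parahoric (z : unitary) : Prop :=
  torus_centraliser z /\ z \in parahoric s1.

(* [n] represents an admissible lift of the reflection [s].  The element [n]
   exchanges the two chambers of the apartment which contain the face [F] fixed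
   by [s].  Both [I_C] and [n I_C n^-1] contain the pro-p radical [I_F] of
   [parahoric s], and their images in the reductive quotient are the unipotent
   radicals of the two opposite Borel subgroups.  Hence the last condition says
   that the image of [n] lies in the subgroup which these radicals generate. *)
Definition admissible_lift (s : 'I_2) (n : unitary) : Prop :=
  [/\ torus_normaliser n, ~ torus_centraliser n, n \in parahoric s &
      forall S : groupClosed unitary,
        (forall u, u \in proIwahori -> u \in S /\ (n * u * n^-1)%g \in S) ->
        n \in S].

End Unitary.

Section Characters.
Variables (K : fieldType) (L : fieldExtType K) (k kL : finFieldType).
Variable E : unramified_quadratic L k kL.
Variable R : closedFieldType.

(* A character [zeta * eta] of [Z_k], identified with the product of the groups
   [kL^*] and [U(1)(kL/k) = {y | y * bar y = 1}].  The values of [zeta] and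
   [eta] outside of these groups are irrelevant. *)
Record Zk_char := ZkChar {
  zeta : kL -> R;
  eta : kL -> R;
  zeta1 : zeta 1 = 1;
  zetaM : forall x y, x != 0 -> y != 0 -> zeta (x * y) = zeta x * zeta y;
  eta1 : eta 1 = 1;
  etaM : forall x y, x * uq_bar E x = 1 -> y * uq_bar E y = 1 ->
    eta (x * y) = eta x * eta y }.

Implicit Types chi : Zk_char.

Definition trivial_Iwahori chi : Prop := forall x, x != 0 -> zeta chi x = 1.

Definition hybrid chi : Prop :=
  (exists2 x, x != 0 & zeta chi x != 1) /\
  (forall x, x != 0 -> zeta chi x ^+ #|k|.+1 = 1).

Definition regular chi : Prop :=
  exists2 x, x != 0 & zeta chi x ^+ #|k|.+1 != 1.

Definition s1_conjugate chi chi' : Prop :=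
  (forall x, x != 0 -> zeta chi' x = zeta chi ((uq_bar E x)^-1)) /\
  (forall y, y * uq_bar E y = 1 -> eta chi' y = eta chi y).

Variables (V : hermitian_space E) (C : chamber V).

(* The isomorphism of [Z_k] with [kL^* * U(1)(kL/k)] is induced by
   [diag(a, b, (conj a)^-1) |-> (a, det)], where [det = a * b / conj a]. *)
Definition Zk_char_eval chi (z : unitary V) : R :=
  zeta chi (redmx C z ord0 ord0) * eta chi (\det (redmx C z)).

Definition proIwahori_hecke : algType R := hecke R (proIwahori C).

(* [xi] is the character [xi_{chi, I}] of the Hecke algebra, where [n s] is the
   representative of the admissible lift which defines [T_s]. *)
Definition is_xi (n : 'I_2 -> unitary V) chi (I : {set 'I_2})
    (xi : {lrmorphism proIwahori_hecke -> R^o}) : Prop :=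
  (forall z, torus_parahoric C z ->
     forall T, is_heckeT z T -> xi T = Zk_char_eval chi z) /\
  (forall s T, is_heckeT (n s) T -> xi T = if s \in I then -1 else 0).

End Characters.

(* Main.v *)
(* An extension of [xi'] by [xi] is a map [d] on [H] with
[d (a b) = xi a * d b + d a * xi' b], taken modulo multiples of [xi - xi'].
Averaging over [Z_k], whose order is prime to [p], one may assume that [d]
vanishes on the [T_z] (a multiple of [xi - xi'] remains when the two characters
agree on [Z_k]).  Then [d] is determined by its two values on [T_(n_1)] and
[T_(n_2)], and the Iwahori-Matsumoto relations say that [d (T_s)] vanishes unless
[xi'] is conjugate to [xi] under [s] on [Z_k], and that
[(xi T_s + xi' T_s) * d T_s = - chi c_s * d T_s].  Conversely all such values occur.
The Hecke algebra is not given by its presentation, so the relations are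
obtained from the group: [G] is the union of the [I w I] with [w] an alternating
word in [n_1], [n_2] times an element of the torus, and the effect of convolving
with [T_s] is read off from the rank one identities [u = u' n u''], the
coset counts being taken modulo [p]. *)

From HB Require Import structures.
Require Import Defs.
From mathcomp Require Import all_boot all_order all_algebra all_field.
From mathcomp Require Import boolp.
From mathcomp Require Import ring zify.

Set Implicit Arguments.
Unset Strict Implicit.
Unset Printing Implicit Defensive.

Import Order.TTheory GRing.Theory Num.Theory.
Local Open Scope ring_scope.

(** * Extensions of characters and derivations *)

(** Existence of derivations is the delicate side. A derivation with prescribed values on the
    [T_(n s)] is the corner of a representation by upper triangular matrices of size two, so an
    algebra map has to be built from matrices that satisfy the Iwahori-Matsumoto relations. Its
    values are imposed on the basis of double cosets, and compatibility is first proved for left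
    multiplication by generators only, an operator [p] being handled as the function [p ind1] on the
    group.

    Two counts modulo [p] produce the relations. When [n_s] lengthens, all cosets in [I n_s I]
    contribute equally, and their number [q^3] or [q] vanishes in [R]. Otherwise the nontrivial
    cosets contribute torus elements; for [s_1] there are [q^3 - 1] cosets over only [q^2 - 1] torus
    elements, with multiplicities [1] and [q + 1], both equal to [1] in [R]. As the order of
    [Z_{k,s}] is [-1] in [R], the plain sum of its [T_t] is [- c_s]. *)

Section Characters.
Variables (R : comNzRingType) (A : algType R) (xi : {lrmorphism A -> R^o}).

Lemma charM a b : xi (a * b) = (xi a : R) * (xi b : R) :> R.
Proof. exact: rmorphM. Qed.

Lemma charD a b : xi (a + b) = (xi a : R) + (xi b : R) :> R.
Proof. exact: rmorphD. Qed.

Lemma charZ (c : R) a : xi (c *: a) = c * (xi a : R) :> R.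
Proof. by rewrite linearZ. Qed.

Lemma char1 : xi 1 = 1 :> R.
Proof. exact: rmorph1. Qed.

End Characters.

Record tderiv (R : comNzRingType) (A : algType R)
  (xi xi' : {lrmorphism A -> R^o}) := TDeriv {
  dval :> A -> R;
  dval_linear : forall (c : R) a b, dval (c *: a + b) = c * dval a + dval b;
  dvalM : forall a b, dval (a * b) = (xi a : R) * dval b + dval a * (xi' b : R) }.

Section DerivExt.
Variables (R : comNzRingType) (A : algType R) (xi xi' : {lrmorphism A -> R^o}).
Implicit Type d : tderiv xi xi'.

Lemma dvalD d a b : d (a + b) = d a + d b.
Proof. by have := dval_linear d 1 a b; rewrite scale1r mul1r. Qed.

Lemma dval1 d : d 1 = 0.
Proof.
have := dvalM d 1 1; rewrite !char1 mulr1 mul1r mulr1.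
by move/eqP; rewrite -subr_eq subrr => /eqP.
Qed.

Lemma dval0 d : d 0 = 0.
Proof. by have := dvalD d 0 0; rewrite addr0 => /eqP; rewrite -subr_eq subrr => /eqP. Qed.

Lemma dvalZ d (c : R) a : d (c *: a) = c * d a.
Proof. by rewrite -[c *: a]addr0 dval_linear dval0 addr0. Qed.

Lemma dvalA d (c : R) : d c%:A = 0.
Proof. by rewrite dvalZ dval1 mulr0. Qed.

Fact tderiv_comb_linear (c : R) d d' (k : R) a b :
  c * d (k *: a + b) + d' (k *: a + b) = k * (c * d a + d' a) + (c * d b + d' b).
Proof. by rewrite !dval_linear; ring. Qed.

Fact tderiv_combM (c : R) d d' a b : c * d (a * b) + d' (a * b) =
  (xi a : R) * (c * d b + d' b) + (c * d a + d' a) * (xi' b : R).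
Proof. by rewrite !dvalM; ring. Qed.

Definition tderiv_comb (c : R) d d' : tderiv xi xi' :=
  TDeriv (tderiv_comb_linear c d d') (tderiv_combM c d d').

Fact tderiv_cob_linear (k : R) a b :
  (xi (k *: a + b) : R) - (xi' (k *: a + b) : R) =
  k * ((xi a : R) - (xi' a : R)) + ((xi b : R) - (xi' b : R)).
Proof. by rewrite !charD !charZ; ring. Qed.

Fact tderiv_cobM a b : (xi (a * b) : R) - (xi' (a * b) : R) =
  (xi a : R) * ((xi b : R) - (xi' b : R)) + ((xi a : R) - (xi' a : R)) * (xi' b : R).
Proof. by rewrite !charM; ring. Qed.

Definition tderiv_cob : tderiv xi xi' := TDeriv tderiv_cob_linear tderiv_cobM.

(** [R * R] with [a] acting by the upper triangular matrix with diagonal [xi a], [xi' a] and corner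
    [d a]. The argument [d] is a tag: it lets every derivation put its own module structure on the
    same group. *)
Definition deriv_mod d : Type := (R * R)%type.

Section DerivMod.
Variable d : tderiv xi xi'.

HB.instance Definition _ := GRing.Zmodule.on (deriv_mod d).

Definition deriv_mod_scale (a : A) (m : deriv_mod d) : deriv_mod d :=
  ((xi a : R) * m.1 + d a * m.2, (xi' a : R) * m.2).

Fact deriv_mod_scaleA a b m :
  deriv_mod_scale a (deriv_mod_scale b m) = deriv_mod_scale (a * b) m.
Proof.
by rewrite /deriv_mod_scale /= !charM dvalM; congr pair; ring.
Qed.

Fact deriv_mod_scale1 : left_id 1 deriv_mod_scale.
Proof.
by case=> m m'; rewrite /deriv_mod_scale !char1 dval1 !mul1r mul0r addr0.
Qed.

Fact deriv_mod_scaleDr : right_distributive deriv_mod_scale +%R.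
Proof.
by move=> a m m'; rewrite /deriv_mod_scale /=; congr pair => /=; ring.
Qed.

Fact deriv_mod_scaleDl m : {morph deriv_mod_scale^~ m : a b / a + b}.
Proof.
move=> a b; rewrite /deriv_mod_scale !charD dvalD.
by congr pair => /=; ring.
Qed.

HB.instance Definition _ := GRing.Zmodule_isLmodule.Build A (deriv_mod d)
  deriv_mod_scaleA deriv_mod_scale1 deriv_mod_scaleDr deriv_mod_scaleDl.

End DerivMod.

Section DerivIn.
Variable d : tderiv xi xi'.

Definition deriv_in (m : char_mod xi) : deriv_mod d := (m : R, 0 : R).
Definition deriv_out (x : deriv_mod d) : char_mod xi' := x.2.

Fact deriv_in_linear : linear deriv_in.
Proof.
move=> a m m'; rewrite /deriv_in; congr pair => /=.
  by rewrite mulr0 addr0.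
by rewrite /= mulr0 addr0.
Qed.

Fact deriv_out_linear : linear deriv_out.
Proof. by []. Qed.

HB.instance Definition _ :=
  GRing.isLinear.Build A (char_mod xi) (deriv_mod d) _ deriv_in deriv_in_linear.
HB.instance Definition _ :=
  GRing.isLinear.Build A (deriv_mod d) (char_mod xi') _ deriv_out deriv_out_linear.

Fact deriv_in_inj : injective deriv_in.
Proof. by move=> m m' []. Qed.

Fact deriv_out_surj (y : char_mod xi') : exists x, deriv_out x = y.
Proof. by exists (0 : R, y : R). Qed.

Fact deriv_exact x : deriv_out x = 0 <-> exists m, x = deriv_in m.
Proof.
split=> [|[m ->]] //; case: x => x y; rewrite /deriv_out /= => ->.
by exists (x : R).
Qed.

Definition deriv_ext : ext (char_mod xi) (char_mod xi') :=
  Ext deriv_in_inj deriv_out_surj deriv_exact.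

End DerivIn.

Lemma deriv_algZ d (c : R) (x : deriv_mod d) :
  c%:A *: x = (c * x.1, c * x.2) :> deriv_mod d.
Proof.
by congr pair; rewrite /= !charZ !char1 !mulr1 ?dvalA ?mul0r ?addr0.
Qed.

(** An equivalence is the identity on the sub and on the quotient, so it has the form
    [(x, y) |-> (x + y m, y)]; linearity over [A] at the vector above [1] is the identity stated. *)
Lemma deriv_ext_eqP d d' : ext_eq (deriv_ext d) (deriv_ext d') <->
  exists m : R, forall a, d a = d' a + m * ((xi a : R) - (xi' a : R)).
Proof.
split=> [[f [fin fout]]|[m dd']].
  pose e : deriv_mod d := (0, 1); pose m := (f e : deriv_mod d').1.
  have feE : f e = (m, 1) :> deriv_mod d'.
    by rewrite [LHS]surjective_pairing; congr pair; apply: (fout e).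
  have fE (x : deriv_mod d) : f x = (x.1 + x.2 * m, x.2) :> deriv_mod d'.
    have {1}-> : x = deriv_in d x.1 + (x.2)%:A *: e.
      rewrite deriv_algZ; case: x => x y; congr pair => /=; first by ring.
      by rewrite mulr1 add0r.
    transitivity (deriv_in d' x.1 + (x.2)%:A *: ((m, 1) : deriv_mod d')).
      by rewrite linearD linearZ [f e]feE [f _](fin x.1).
    rewrite deriv_algZ.
    by congr pair => /=; rewrite ?mulr1 ?add0r.
  exists m => a; have : f (a *: e) = a *: f e :> deriv_mod d' by rewrite linearZ.
  rewrite fE [f e]feE => /(congr1 fst) /=.
  by rewrite !mulr1 mulr0 add0r => /eqP; rewrite eq_sym -subr_eq => /eqP <-; ring.
pose f (x : deriv_mod d) : deriv_mod d' := (x.1 + m * x.2, x.2).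
have fL : linear f.
  move=> a x y; rewrite /f; congr pair => /=.
  by rewrite dd'; ring.
pose F : {linear deriv_mod d -> deriv_mod d'} :=
  HB.pack f (GRing.isLinear.Build _ _ _ _ f fL).
by exists F; split=> // x; congr pair => /=; rewrite mulr0 addr0.
Qed.

(* Extensions are split over [R], and the choice of a vector above [1] turns
   one into a derivation. *)
Lemma ext_deriv (X : ext (char_mod xi) (char_mod xi')) :
  exists d : tderiv xi xi', ext_eq X (deriv_ext d).
Proof.
have [e eE] := ext_out_surj X (1 : R).
have outZ (a : A) (x : X) : ext_out X (a *: x) = (xi' a : R) * (ext_out X x : R) :> R.
  by rewrite linearZ.
have inZ (a : A) (m : R) : a *: ext_in X m = ext_in X ((xi a : R) * m : R).
  by rewrite -linearZ.
have [g gE] : {g : X -> R &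
    forall x, x = ext_in X (g x) + (ext_out X x : R)%:A *: e}.
  apply: (@boolp.choice _ _ (fun x m => x = ext_in X m + (ext_out X x : R)%:A *: e)) => x.
  have [|m me] := (ext_exact (x - (ext_out X x : R)%:A *: e)).1.
    by rewrite linearB [X in _ - X]outZ eE charZ char1 !mulr1 subrr.
  by exists m; rewrite -me subrK.
(* Uniqueness of the coordinate [g x]: the properties of [d] below are obtained by exhibiting a
   decomposition along [ext_in] and [e]. *)
have gP x (m c : R) : x = ext_in X m + c%:A *: e -> g x = m.
  move=> xE; have cE : ext_out X x = c :> R.
    rewrite xE linearD [X in _ + X]outZ eE charZ char1 !mulr1.
    by rewrite (ext_exact _).2 ?add0r //; exists m.
  by apply/(@ext_in_inj _ _ _ _ X)/(addIr (c%:A *: e)); rewrite -xE [RHS]gE cE.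
pose d a : R := g (a *: e).
have dE a : a *: e = ext_in X (d a) + (xi' a : R)%:A *: e.
  by rewrite [LHS]gE [X in X%:A]outZ eE mulr1.
have algC (c : R) (a : A) (x : X) : a *: (c%:A *: x) = c%:A *: (a *: x).
  by rewrite !scalerA mulr_algr mulr_algl.
have inC (c m : R) : c%:A *: ext_in X m = ext_in X (c * m : R).
  by rewrite inZ charZ char1 mulr1.
have mulCZ (c m : R) (x : X) : c%:A *: (m%:A *: x) = (c * m)%:A *: x.
  by rewrite [LHS]scalerA mulr_algl scalerA.
have addCZ (c m : R) : c%:A *: e + m%:A *: e = (c + m)%:A *: e.
  by rewrite [(c + m)%:A]scalerDl [RHS]scalerDl.
have dL (c : R) a b : d (c *: a + b) = c * d a + d b.
  apply: (gP _ _ (c * (xi' a : R) + (xi' b : R))).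
  have abE : (c *: a + b) *: e = c%:A *: (a *: e) + b *: e.
    by rewrite (scalerDl (s := X) e (c *: a) b) (scalerA c%:A a e) mulr_algl.
  rewrite abE (dE a) (dE b).
  rewrite [_%:A *: (_ + _)]scalerDr inC mulCZ addrACA -linearD.
  by rewrite addCZ.
have dM a b : d (a * b) = (xi a : R) * d b + d a * (xi' b : R).
  apply: (gP _ _ ((xi' b : R) * (xi' a : R))).
  rewrite -[LHS](scalerA a b e) dE [LHS]scalerDr inZ algC dE.
  rewrite [_%:A *: (_ + _)]scalerDr inC mulCZ addrA -linearD.
  by rewrite [(xi' b : R) * d a]mulrC.
exists (TDeriv dL dM).
pose f (x : X) : deriv_mod (TDeriv dL dM) := (g x, ext_out X x : R).
have fL : linear f.
  move=> a x y; rewrite /f; congr pair; last by rewrite linearD linearZ.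
  apply: (gP _ _ ((xi' a : R) * (ext_out X x : R) + (ext_out X y : R))).
  rewrite {1}[x]gE {1}[y]gE [a *: (_ + _)]scalerDr inZ algC dE.
  rewrite [_%:A *: (_ + _)]scalerDr inC mulCZ -!addrA.
  rewrite [X in _ + (_ + X)]addrCA addCZ !addrA -!linearD.
  by rewrite [(ext_out X x : R) * d a]mulrC [(ext_out X x : R) * _]mulrC.
pose F : {linear X -> deriv_mod (TDeriv dL dM)} :=
  HB.pack f (GRing.isLinear.Build _ _ _ _ f fL).
exists F; split=> // m; congr pair => /=.
  by apply: (gP _ _ 0); rewrite scale0r scale0r addr0.
by rewrite (ext_exact _).2 //; exists m.
Qed.

Lemma ext_eq_trans (M N : lmodType A) : forall X Y Z : ext M N,
  ext_eq X Y -> ext_eq Y Z -> ext_eq X Z.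
Proof.
move=> X Y Z [f [fin fout]] [g [gin gout]].
exists (g \o f : {linear X -> Z}); split=> x /=; first by rewrite fin gin.
by rewrite gout fout.
Qed.

(** The hypotheses say that [D] is linear and induces a bijection from [R^n] onto derivations modulo
    coboundaries; the rest translates sums and multiples of derivations into Baer sums and
    push-outs. *)
Lemma deriv_Ext1_dim n (D : 'rV[R]_n -> tderiv xi xi') :
  (forall (c : R) u v a, D (c *: u + v) a = c * D u a + D v a) ->
  (forall d : tderiv xi xi', exists v (m : R),
     forall a, d a = D v a + m * ((xi a : R) - (xi' a : R))) ->
  (forall v (m : R), (forall a, D v a = m * ((xi a : R) - (xi' a : R))) -> v = 0) ->
  Ext1_dim (char_mod xi) (char_mod xi') n.
Proof.
move=> DL Dsurj Dinj.
have D0 a : D 0 a = 0.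
  have := DL 1 0 0 a; rewrite scaler0 addr0 mul1r.
  by move/eqP; rewrite eq_sym -subr_eq0 addrK => /eqP.
have DD u v a : D (u + v) a = D u a + D v a.
  by have := DL 1 u v a; rewrite scale1r mul1r.
have DZ c v a : D (c *: v) a = c * D v a.
  by have := DL c v 0 a; rewrite addr0 D0 addr0.
exists (fun v => deriv_ext (D v)); split.
- move=> X; have [d Xd] := ext_deriv X; have [v [m dE]] := Dsurj d.
  by exists v; apply: ext_eq_trans Xd _; apply/deriv_ext_eqP; exists m.
- move=> u v /deriv_ext_eqP[m uv]; apply/eqP; rewrite -subr_eq0; apply/eqP.
  apply: (Dinj _ m) => a; have := uv a; have -> : D u a = D (u - v) a + D v a.
    by rewrite -DD subrK.
  by rewrite [X in _ = X]addrC => /addIr.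
(* On the fibre product the second coordinates agree, so adding the first ones and keeping the
   common second one is linear. *)
- move=> u v; exists (fun x : deriv_mod (D u) * deriv_mod (D v) =>
    (x.1.1 + x.2.1, x.1.2) : deriv_mod (D (u + v))); split.
  + move=> a x y /= xE _; congr pair => /=.
    by rewrite DD; move: xE; rewrite /deriv_out => ->; ring.
  + by move=> m m'; congr pair.
  + by [].
- move=> c v; pose f (x : deriv_mod (D v)) : deriv_mod (D (c *: v)) :=
    (c * x.1, x.2).
  have fL : linear f.
    by move=> a x y; congr pair => /=; rewrite DZ; ring.
  exists (HB.pack f (GRing.isLinear.Build _ _ _ _ f fL)
    : {linear deriv_mod (D v) -> deriv_mod (D (c *: v))}); split=> //= m.
  by congr pair; rewrite /= /(_ *: _) /= /char_mod_scale charZ char1 mulr1.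
Qed.

End DerivExt.

(** * Operators attached to double cosets *)

Ltac gsimp := rewrite ?(mulgA, invgM, invgK, mulgK, mulgVK, mulgV, mulVg, mul1g, mulg1, invg1).

Section HeckeFun.
Variables (R : comNzRingType) (G : groupType) (I : groupClosed G).
Implicit Types (f : ind R I) (p : hecke R I) (g x y u v : G).

Lemma memM u v : u \in I -> v \in I -> (u * v)%g \in I.
Proof. exact: gpredM. Qed.

Lemma memV u : u \in I -> u^-1%g \in I.
Proof. by rewrite gpredV. Qed.

Lemma indI f u g : u \in I -> f (u * g)%g = f g.
Proof. by have /asboolP[fI _] := ind_valP f; apply: fI. Qed.

Lemma ind_supp f : exists s : seq G,
  forall g, f g != 0 -> exists2 x, x \in s & (g * x^-1)%g \in I.
Proof. by have /asboolP[_] := ind_valP f. Qed.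

Lemma heckeL p (a : R) f f' : p (a *: f + f') = a *: p f + p f'.
Proof. by have /asboolP[pL _] := hecke_valP p. Qed.

Lemma heckeG p g f : p (ind_act g f) = ind_act g (p f).
Proof. by have /asboolP[_ ->] := hecke_valP p. Qed.

Lemma ind_eq f f' : f =1 f' -> f = f'.
Proof. by move=> ff; apply/val_inj/funext. Qed.

(** Induction over a list of cosets [I y] that cover the support: subtracting [f y] times the
    translate of [ind1] supported on [I y] removes one coset. *)
Lemma ind_ext (P : ind R I -> Prop) : P 0 ->
  (forall (a : R) g f, P f -> P (a *: ind_act g (ind1 R I) + f)) ->
  forall f, P f.
Proof.
move=> P0 PS f; have [s] := ind_supp f.
elim: s f => [|y s IHs] f fs.
  suff -> : f = 0 by [].
  by apply: ind_eq => x; apply/eqP; apply: contraPT (erefl true) => /fs[].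
pose e := ind_act y^-1%g (ind1 R I).
have eE x : e x = (x * y^-1 \in I)%g%:R by [].
rewrite -[f](subrK ((f y : R) *: e)) addrC; apply/PS/IHs => x.
have fE : (f - (f y : R) *: e) x = (f x : R) - (f y : R) * (x * y^-1 \in I)%g%:R by [].
rewrite fE; case xy: (_ \in I).
  by rewrite mulr1 -{1}(mulgVK y x) indI ?subrr ?eqxx.
rewrite mulr0 subr0 => /fs[z]; rewrite inE => /orP[/eqP->|]; last by exists z.
by rewrite xy.
Qed.

Lemma hecke0 p : p 0 = 0.
Proof. by have := heckeL p (-1) 0 0; rewrite scaler0 addr0 scaleN1r addNr. Qed.

(** Frobenius reciprocity: as [ind1] generates, an operator is determined by this function, which is
    invariant under [I] on both sides. *)
Definition hfun p x : R := p (ind1 R I) x.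

Lemma hfun_inj p p' : hfun p =1 hfun p' -> p = p'.
Proof.
move=> pp; apply/val_inj/funext => f; rewrite -[LHS]/(p f) -[RHS]/(p' f).
elim/ind_ext: f => [|a g f IHf]; first by rewrite !hecke0.
have {}pp : p (ind1 R I) = p' (ind1 R I) by apply: ind_eq.
by rewrite !heckeL !heckeG IHf pp.
Qed.

Lemma hfunIl p u x : u \in I -> hfun p (u * x)%g = hfun p x.
Proof. exact: indI. Qed.

Lemma hfunIr p u x : u \in I -> hfun p (x * u)%g = hfun p x.
Proof.
move=> uI; rewrite /hfun -[RHS]/(p _ x).
have {2}-> : ind1 R I = ind_act u (ind1 R I).
  by apply: ind_eq => y /=; rewrite gpredMr.
by rewrite heckeG.
Qed.

Lemma hfunD p p' x : hfun (p + p') x = hfun p x + hfun p' x.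
Proof. by []. Qed.

Lemma hfunZ (a : R) p x : hfun (a *: p) x = a * hfun p x.
Proof. by []. Qed.

Lemma hfun1 x : hfun 1 x = (x \in I)%:R.
Proof. by []. Qed.

Lemma hfunM p p' x : hfun (p * p') x = p (p' (ind1 R I)) x.
Proof. by []. Qed.

Lemma hfun_supp p : exists s : seq G,
  forall g, hfun p g != 0 -> exists2 x, x \in s & (g * x^-1)%g \in I.
Proof. exact: ind_supp. Qed.

Lemma heckeT_hfun g p : is_heckeT g p -> forall x,
  hfun p x = `[< exists u v, [/\ u \in I, v \in I & x = (u * g * v)%g] >]%:R.
Proof. by []. Qed.

Lemma heckeT_uniq g p p' : is_heckeT g p -> is_heckeT g p' -> p = p'.
Proof. by move=> gp gp'; apply: hfun_inj => x; rewrite (heckeT_hfun gp) (heckeT_hfun gp'). Qed.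

Lemma heckeT_inI g p : g \in I -> is_heckeT g p -> p = 1.
Proof.
move=> gI gp; apply: hfun_inj => x; rewrite (heckeT_hfun gp) hfun1; congr (nat_of_bool _)%:R.
apply/asboolP/idP => [[u [v [uI vI ->]]]|xI]; first by rewrite !gpredM.
by exists x, g^-1%g; split; rewrite ?gpredV ?mulgK.
Qed.

(* [I g I] is the disjoint union of the cosets [(U j)^-1 g I]. *)
Definition coset_reps (J : finType) (g : G) (U : J -> G) : Prop :=
  [/\ forall j, U j \in I,
      forall h, h \in I -> exists j, (g^-1 * (h * (U j)^-1) * g)%g \in I &
      forall i j, (g^-1 * (U i * (U j)^-1) * g)%g \in I -> i = j].

Section Operator.
Variables (J : finType) (g : G) (U : J -> G).
Hypothesis gU : coset_reps g U.
Hypothesis g2 : forall u, u \in I -> (g * g * u * (g * g)^-1)%g \in I.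

Let op f x : R^o := \sum_j f (g^-1 * U j * x)%g.

Lemma conjIV h : (g^-1 * h * g)%g \in I -> (g^-1 * h^-1 * g)%g \in I.
Proof. by move=> hI; rewrite -gpredV; gsimp; rewrite -mulgA mulgA. Qed.

Lemma conjIM h h' : (g^-1 * h * g)%g \in I -> (g^-1 * h' * g)%g \in I ->
  (g^-1 * (h * h') * g)%g \in I.
Proof. by move=> hI h'I; have := memM hI h'I; gsimp. Qed.

Fact op_ind f : op f \in @in_ind R G I.
Proof.
have [UI Uex Uuniq] := gU.
apply/asboolP; split=> [u x uI|].
  (* Right translation by [u] permutes the cosets; [s] is the induced map of indices, bijective
     because [J] is finite. *)
  have /boolp.choice[s sP] : forall j, exists i,
      (g^-1 * (U j * u * (U i)^-1) * g)%g \in I.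
    by move=> j; apply: Uex; rewrite gpredM.
  have s_inj : injective s.
    move=> i j ij; apply: Uuniq; have := conjIM (sP i) (conjIV (sP j)).
    by rewrite ij; gsimp.
  rewrite /op [RHS](reindex_inj s_inj); apply: eq_bigr => j _.
  by rewrite -[RHS](indI _ _ (sP j)); congr (f _); gsimp.
have [s fs] := ind_supp f.
exists [seq (g * U j * y)%g | j <- enum J, y <- s] => x fx.
have [j /fs[y ys yI]] : exists j, f (g^-1 * U j * x)%g != 0.
  apply/existsP; apply: contra_neqT fx => /existsPn f0.
  by apply: big1 => j _; apply/eqP; have := f0 j; rewrite negbK.
(* Here [x = (U j)^-1 g h y] with [h] in [I], and [h = (g i' g^-1) U i] with [i'] in [I]. As
   conjugation by [g * g] preserves [I], moving [i'] across it puts [x] in [I g U i y]. *)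
have [i iI] := Uex _ yI.
exists (g * U i * y)%g; first by apply/allpairsP; exists (i, y); rewrite mem_enum.
have := memM (memV (UI j)) (g2 iI).
by gsimp.
Qed.

Definition hop f : ind R I := Ind (op_ind f).

Fact hop_hecke : hop \in @in_hecke R G I.
Proof.
apply/asboolP; split=> [a f f'|h f]; apply: ind_eq => x.
  transitivity (\sum_j (a * (f (g^-1 * U j * x)%g : R) + (f' (g^-1 * U j * x)%g : R))) => //.
  by rewrite big_split -mulr_sumr.
by apply: eq_bigr => j _ /=; gsimp.
Qed.

(** At [ind1] the sum counts the [j] with [x] in [(U j)^-1 g I], hence is the indicator of [I g I],
    these cosets being disjoint. *)
Lemma heckeT_ex : exists p : hecke R I, is_heckeT g p /\
  forall f x, p f x = \sum_j (f (g^-1 * U j * x)%g : R).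
Proof.
have [UI Uex Uuniq] := gU.
exists (Hecke hop_hecke); split=> [x|//].
transitivity (\sum_j ((g^-1 * U j * x)%g \in I)%:R : R) => //.
case: asboolP => [[u [v [uI vI ->]]]|xN]; last first.
  apply: big1 => j _; case xI: (_ \in I) => //; case: xN.
  exists (U j)^-1%g, (g^-1 * U j * x)%g; rewrite xI gpredV UI; split=> //.
  by gsimp.
have [i iI] := Uex _ (memV uI).
rewrite (bigD1 i) //= big1 ?addr0 => [|j ji].
  suff -> : (g^-1 * U i * (u * g * v))%g \in I by [].
  have := memM (conjIV iI) vI; gsimp => //.
case jI: (_ \in I) => //; move/eqP: ji => [].
apply: Uuniq; have := memM jI (memV vI) => {}jI.
have := conjIM (h := U j * u) (h' := u^-1 * (U i)^-1) _ iI; gsimp; apply.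
by move: jI; gsimp.
Qed.

End Operator.

Lemma heckeT_normal g : (forall u, u \in I -> (g * u * g^-1)%g \in I) ->
  (forall u, u \in I -> (g^-1 * u * g)%g \in I) ->
  exists p : hecke R I, is_heckeT g p /\
    forall f x, p f x = f (g^-1 * x)%g.
Proof.
move=> gI gVI; pose U (_ : unit) : G := 1%g.
have gU : coset_reps g U.
  split=> [j|h hI|[] []//]; first exact: gpred1.
  by exists tt; rewrite invg1 mulg1; apply: gVI.
have [|p [gp pE]] := heckeT_ex gU.
  by move=> u uI; have := gI _ (gI _ uI); gsimp.
exists p; split=> // f x; rewrite pE (bigD1 tt) //= big1 ?addr0; last by case.
by gsimp.
Qed.

End HeckeFun.

(** * Hecke algebras of affine rank one *)

Lemma sum_I2 (V : nmodType) (s : 'I_2) (F : 'I_2 -> V) :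
  \sum_s' F s' = F s + F (rev_ord s).
Proof.
have revE : rev_ord s != s by case: s => [[|[|//]] ?].
rewrite (bigD1 s) //= (bigD1 (rev_ord s)) //= big1 ?addr0 // => s' /andP[].
by case: s s' {revE} => [[|[|//]] ?] [[|[|//]] ?].
Qed.

Lemma rev_ord_neq (s : 'I_2) : rev_ord s <> s.
Proof. by case: s => [[|[|//]] ?]. Qed.

Lemma rev_ordP (s s' : 'I_2) : s' = s \/ s' = rev_ord s.
Proof.
by case: s s' => [[|[|//]] ?] [[|[|//]] ?];
  [left | right | right | left]; apply: val_inj.
Qed.

Section Words.
Variables (G : groupType) (n : 'I_2 -> G).

(** Since [s_1 s_2] has infinite order, alternating words represent each element of the affine Weyl
    group once, except that the empty word belongs to both [s]. *)
Fixpoint wd s l : G := if l is l'.+1 then (n s * wd (rev_ord s) l')%g else 1%g.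

End Words.

Definition biinv (T : Type) (G : groupType) (I : groupClosed G) (f : G -> T) :=
  forall u x, u \in I -> f (u * x)%g = f x /\ f (x * u)%g = f x.

(* The part of the structure of a rank one group with a pro-p Iwahori subgroup
   [I] on which the Hecke algebra depends.  The fields [aff_long] and
   [aff_short] compute [T_s f] on [N] according to whether the left
   multiplication by [n s] increases the length. *)
Record affine_datum (R : comNzRingType) (G : groupType) (I : groupClosed G)
    (n : 'I_2 -> G) (Z : {pred G}) := AffineDatum {
  aff_1 : 1%g \in Z;
  aff_M : forall z z', z \in Z -> z' \in Z -> (z * z')%g \in Z;
  aff_V : forall z, z \in Z -> z^-1%g \in Z;
  aff_I : forall z u, z \in Z -> u \in I -> (z * u * z^-1)%g \in I;
  aff_nZ : forall s z, z \in Z -> (n s * z * (n s)^-1)%g \in Z;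
  aff_nn : forall s, (n s * n s)%g \in Z;
  aff_X : finType;
  aff_rep : aff_X -> G;
  aff_repZ : forall x, aff_rep x \in Z;
  aff_rep_ex : forall z, z \in Z -> exists x, ((aff_rep x)^-1 * z)%g \in I;
  aff_rep_uniq : forall x y, ((aff_rep x)^-1 * aff_rep y)%g \in I -> x = y;
  aff_bruhat : forall g, exists s l z u v,
    [/\ z \in Z, u \in I, v \in I & g = (u * (wd n s l * z) * v)%g];
  aff_disjoint : forall s l z s' l' z' u v, z \in Z -> z' \in Z ->
    u \in I -> v \in I -> (wd n s l * z = u * (wd n s' l' * z') * v)%g ->
    [/\ l = l', s = s' \/ l = 0%N & (z'^-1 * z)%g \in I];
  aff_J : 'I_2 -> finType;
  aff_U : forall s, aff_J s -> G;
  aff_reps : forall s, coset_reps I (n s) (@aff_U s);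
  aff_T : 'I_2 -> finType;
  aff_t : forall s, aff_T s -> G;
  aff_tZ : forall s t, @aff_t s t \in Z;
  aff_long : forall (f : G -> R) s l z, biinv I f -> z \in Z ->
    \sum_j f ((n s)^-1 * @aff_U s j * (wd n (rev_ord s) l * z))%g = 0;
  aff_short : forall (f : G -> R) s l z, biinv I f -> z \in Z ->
    \sum_j f ((n s)^-1 * @aff_U s j * (wd n s l.+1 * z))%g =
    f (wd n (rev_ord s) l * z)%g +
    \sum_t f ((@aff_t s t)^-1 * (wd n s l.+1 * z))%g }.

Arguments aff_U {R G I n Z} a s j.
Arguments aff_t {R G I n Z} a s t.
Arguments aff_rep {R G I n Z} a x.

(** * Upper triangular matrices of size two *)

Section UpperTriangular2.
Variable R : comNzRingType.

Definition utmx (a b c : R) : 'M[R]_2 :=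
  \matrix_(i, j) if i == j then (if i == ord0 then a else c)
                 else (if i == ord0 then b else 0).

Lemma utmxM a b c a' b' c' :
  utmx a b c * utmx a' b' c' = utmx (a * a') (a * b' + b * c') (c * c').
Proof.
apply/matrixP => i j; rewrite !mxE big_ord_recl big_ord1 !mxE.
by case: i j => [[|[|//]] ?] [[|[|//]] ?] /=; ring.
Qed.

Lemma utmxL k a b c a' b' c' :
  k *: utmx a b c + utmx a' b' c' = utmx (k * a + a') (k * b + b') (k * c + c').
Proof.
apply/matrixP => i j; rewrite !mxE.
by case: i j => [[|[|//]] ?] [[|[|//]] ?] /=; ring.
Qed.

Lemma utmx1 : utmx 1 0 1 = 1.
Proof.
by apply/matrixP => i j; rewrite !mxE; case: i j => [[|[|//]] ?] [[|[|//]] ?].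
Qed.

Lemma utmx_sum (J : finType) (a b c : J -> R) :
  \sum_j utmx (a j) (b j) (c j) = utmx (\sum_j a j) (\sum_j b j) (\sum_j c j).
Proof.
apply/matrixP => i j; rewrite summxE !mxE; under eq_bigr do rewrite mxE.
by case: i j => [[|[|//]] ?] [[|[|//]] ?] //=; rewrite big1.
Qed.

End UpperTriangular2.

Section AffineHecke.
Variables (R : comNzRingType) (G : groupType) (I : groupClosed G).
Variables (n : 'I_2 -> G) (Z : {pred G}) (D : affine_datum R I n Z).
Implicit Types (p T : hecke R I) (s : 'I_2) (z : G).
Local Notation wd := (wd n).

Lemma hfun_biinv p : biinv I (hfun p).
Proof. by move=> u x uI; rewrite hfunIl ?hfunIr. Qed.

Lemma aff_IV z u : z \in Z -> u \in I -> (z^-1 * u * z)%g \in I.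
Proof. by move=> zZ uI; have := aff_I D (aff_V D zZ) uI; gsimp. Qed.

Lemma aff_nVZ s z : z \in Z -> ((n s)^-1 * z * n s)%g \in Z.
Proof.
move=> zZ; have nn := aff_nn D s.
by have := aff_nZ D s (aff_M D (aff_V D nn) (aff_M D zZ nn)); gsimp.
Qed.

Lemma wd_Z s l z : z \in Z -> ((wd s l)^-1 * z * wd s l)%g \in Z.
Proof.
elim: l s z => [|l IHl] s z zZ /=; first by gsimp.
by have := IHl (rev_ord s) _ (aff_nVZ s zZ); gsimp.
Qed.

Lemma wd_ZV s l z : z \in Z -> (wd s l * z * (wd s l)^-1)%g \in Z.
Proof.
elim: l s z => [|l IHl] s z zZ /=; first by gsimp.
by have := aff_nZ D s (IHl (rev_ord s) _ zZ); gsimp.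
Qed.

Lemma wd_comm s l y z : y \in Z -> z \in Z ->
  exists2 z', z' \in Z & (y * (wd s l * z) = wd s l * z')%g.
Proof.
move=> yZ zZ; exists ((wd s l)^-1 * y * wd s l * z)%g; last by gsimp.
by apply: (aff_M D) => //; apply: wd_Z.
Qed.

Lemma heckeT_n_ex s : exists T : hecke R I, is_heckeT (n s) T /\
  forall f x, T f x = \sum_j (f ((n s)^-1 * aff_U D s j * x)%g : R).
Proof.
apply: heckeT_ex (aff_reps D s) _ => u uI.
exact: (aff_I D (aff_nn D s) uI).
Qed.

Lemma heckeT_n s T : is_heckeT (n s) T -> forall p x,
  hfun (T * p) x = \sum_j hfun p ((n s)^-1 * aff_U D s j * x)%g.
Proof.
have [T' [T'n T'E]] := heckeT_n_ex s.
by move=> Tn p x; rewrite (heckeT_uniq Tn T'n) hfunM T'E.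
Qed.

Lemma heckeT_Z_ex z : z \in Z -> exists T : hecke R I, is_heckeT z T /\
  forall f x, T f x = f (z^-1 * x)%g.
Proof.
move=> zZ; apply: heckeT_normal => u uI; first exact: (aff_I D zZ uI).
exact: (aff_IV zZ uI).
Qed.

Lemma heckeT_Z z T : z \in Z -> is_heckeT z T -> forall p x,
  hfun (T * p) x = hfun p (z^-1 * x)%g.
Proof.
move=> zZ; have [T' [T'z T'E]] := heckeT_Z_ex zZ.
by move=> Tz p x; rewrite (heckeT_uniq Tz T'z) hfunM T'E.
Qed.

Lemma heckeT_mulZ z g T p : z \in Z -> is_heckeT z T -> is_heckeT g p ->
  is_heckeT (z * g)%g (T * p).
Proof.
move=> zZ Tz gp x; rewrite -[LHS]/(hfun (T * p) x) (heckeT_Z zZ Tz) (heckeT_hfun gp).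
congr (nat_of_bool _)%:R; apply: asbool_equiv_eq; split=> -[u [v [uI vI xE]]].
  exists (z * u * z^-1)%g, v; split=> //; first exact: (aff_I D zZ uI).
  by apply: (mulgI z^-1%g); rewrite xE; gsimp.
exists (z^-1 * u * z)%g, v; split=> //; first exact: (aff_IV zZ uI).
by rewrite xE; gsimp.
Qed.

Lemma biinv_bruhat (f f' : G -> R) : biinv I f -> biinv I f' ->
  (forall s l z, z \in Z -> f (wd s l * z)%g = f' (wd s l * z)%g) -> f =1 f'.
Proof.
move=> fI f'I ff' g; have [s [l [z [u [v [zZ uI vI ->]]]]]] := aff_bruhat D g.
by rewrite (fI v _ vI).2 (fI u _ uI).1 (f'I v _ vI).2 (f'I u _ uI).1 ff'.
Qed.

Lemma heckeT_wdE s l z p s' l' z' : z \in Z -> z' \in Z ->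
  is_heckeT (wd s l * z)%g p ->
  hfun p (wd s' l' * z')%g =
    `[< [/\ l' = l, s' = s \/ l' = 0%N & (z^-1 * z')%g \in I] >]%:R.
Proof.
move=> zZ z'Z pw; rewrite (heckeT_hfun pw); congr (nat_of_bool _)%:R.
apply: asbool_equiv_eq; split=> [[u [v [uI vI /(aff_disjoint D)]]]|[-> ss zz]].
  by apply.
exists 1%g, (z^-1 * z')%g; rewrite gpred1; split=> //; gsimp.
by case: ss => [->|->].
Qed.

(** Both sides are biinvariant, so it is enough to compare them on words. Where [n s] lengthens the
    product vanishes; elsewhere [aff_short] returns [p] at the shortened word, and its torus terms
    vanish because [p] lives on words beginning with [rev_ord s]. *)
Lemma heckeT_wdS s l z T p : z \in Z -> is_heckeT (n s) T ->
  is_heckeT (wd (rev_ord s) l * z)%g p -> is_heckeT (wd s l.+1 * z)%g (T * p).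
Proof.
move=> zZ Tn pw.
pose f x : R := `[< exists u v, [/\ u \in I, v \in I & x = (u * (wd s l.+1 * z) * v)%g] >]%:R.
have fI : biinv I f.
  move=> w x wI; split; congr (nat_of_bool _)%:R; apply: asbool_equiv_eq.
    split=> -[u [v [uI vI xE]]].
      by exists (w^-1 * u)%g, v; rewrite memM ?memV //; split=> //; apply: (mulgI w); rewrite xE; gsimp.
    by exists (w * u)%g, v; rewrite memM //; split=> //; rewrite xE; gsimp.
  split=> -[u [v [uI vI xE]]].
    by exists u, (v * w^-1)%g; rewrite memM ?memV //; split=> //; apply: (mulIg w); rewrite xE; gsimp.
  by exists u, (v * w)%g; rewrite memM //; split=> //; rewrite xE; gsimp.
suff : hfun (T * p) =1 f by [].
apply: biinv_bruhat fI _ => [|s' l' z' z'Z]; first exact: hfun_biinv.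
have fE : f (wd s' l' * z')%g =
    `[< [/\ l' = l.+1, s' = s \/ l' = 0%N & (z^-1 * z')%g \in I] >]%:R.
  congr (nat_of_bool _)%:R; apply: asbool_equiv_eq.
  split=> [[u [v [uI vI /(aff_disjoint D)]]]|[-> ss zz]]; first by apply.
  exists 1%g, (z^-1 * z')%g; rewrite gpred1; split=> //.
  by case: ss => [->|//]; gsimp.
rewrite fE (heckeT_n Tn).
have [s'E|s'E] := rev_ordP s s'; last first.
  rewrite s'E (aff_long D _ _ (hfun_biinv p)) //; case: asboolP => //.
  by case=> -> [/rev_ord_neq|].
rewrite s'E; case: l' {fE} => [|l'].
  rewrite (aff_long D s 0 (hfun_biinv p) z'Z); case: asboolP => //.
  by case.
rewrite (aff_short D _ _ (hfun_biinv p)) // [X in _ + X]big1 ?addr0 => [|t _].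
  rewrite (heckeT_wdE _ _ zZ z'Z pw) //; congr (nat_of_bool _)%:R; apply: asbool_equiv_eq.
  by split=> -[ll _ zz]; split=> //; [rewrite ll | left | case: ll | left].
have [z'' z''Z ->] := wd_comm s l'.+1 (aff_V D (aff_tZ t)) z'Z.
rewrite (heckeT_wdE _ _ zZ _ pw) //.
by case: asboolP => // -[_ [/esym/rev_ord_neq|]].
Qed.

(** Every double coset is that of some [wd s l * z], and its operator is a product of generators by
    [heckeT_wdS]; the finite support of [p] is then exhausted. *)
Lemma hecke_gen (P : hecke R I -> Prop) :
  P 1 -> (forall (a : R) p p', P p -> P p' -> P (a *: p + p')) ->
  (forall z T p, z \in Z -> is_heckeT z T -> P p -> P (T * p)) ->
  (forall s T p, is_heckeT (n s) T -> P p -> P (T * p)) ->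
  forall p, P p.
Proof.
move=> P1 PL PZ Pn.
have P0 : P 0 by have := PL (-1) 1 1 P1 P1; rewrite scaleN1r addNr.
have Pwd s l z : z \in Z -> exists2 p, is_heckeT (wd s l * z)%g p & P p.
  move=> zZ; elim: l s => [|l IHl] s.
    have [T [Tz _]] := heckeT_Z_ex zZ; exists T; first by gsimp.
    by rewrite -[T]mulr1; apply: PZ P1; eauto.
  have [T [Tn _]] := heckeT_n_ex s; have [p pw Pp] := IHl (rev_ord s).
  by exists (T * p); [apply: heckeT_wdS | apply: Pn Pp].
move=> p; have [ys] := hfun_supp p.
elim: ys p => [|y ys IHys] p pys.
  suff -> : p = 0 by [].
  by apply: hfun_inj => x; apply/eqP; apply: contraPT (erefl true) => /pys[].
have [p0|p0] := eqVneq (hfun p y) 0.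
  apply: IHys => x px; have [x' ] := pys x px.
  rewrite inE => /orP[/eqP->|x'y x'I]; last by exists x'.
  by move=> xyI; rewrite -(mulgVK y x) hfunIl ?p0 ?eqxx // in px.
have [s [l [z [u [v [zZ uI vI yE]]]]]] := aff_bruhat D y.
have [T Tw PT] := Pwd s l z zZ.
have Ty : hfun T y = 1 by rewrite (heckeT_hfun Tw) asboolT //; exists u, v.
rewrite -[p](subrK (hfun p y *: T)) addrC; apply: PL PT _; apply: IHys => x.
rewrite hfunD -scaleNr hfunZ => px.
(* The support does not grow: [p] is nonzero on the whole double coset of [y], so [T] vanishes
   wherever [p] does. *)
have {}px : hfun p x != 0 /\ (x * y^-1 \notin I)%g.
  split; last first.
    apply: contraNN px => xyI; rewrite -(mulgVK y x) !hfunIl // Ty mulr1 subrr //.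
  apply: contraNN px => /eqP px; rewrite px add0r (heckeT_hfun Tw).
  case: asboolP => [[u' [v' [u'I v'I xE]]]|_]; last by rewrite mulr0.
  case/eqP: p0; rewrite -px yE xE.
  by rewrite (hfunIr _ _ vI) (hfunIr _ _ v'I) (hfunIl _ _ uI) (hfunIl _ _ u'I).
have [x' ] := pys x px.1.
rewrite inE => /orP[/eqP->|x'y x'I]; last by exists x'.
by rewrite (negPf px.2).
Qed.

Lemma heckeT_nZ s z T T' T'' : z \in Z -> is_heckeT (n s) T ->
  is_heckeT z T' -> is_heckeT (n s * z * (n s)^-1)%g T'' -> T * T' = T'' * T.
Proof.
move=> zZ Tn Tz Tnz; apply: (@heckeT_uniq _ _ _ (n s * z)%g).
  by have := @heckeT_wdS s 0 z T T' zZ Tn; rewrite /= mulg1 mul1g; apply.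
by have := heckeT_mulZ (aff_nZ D s zZ) Tnz Tn; rewrite mulgVK.
Qed.

(** In the unitary case this is [T_s^2 = - c_s T_s]. On words where [n s] lengthens both sides
    vanish; elsewhere the shortened word contributes nothing, since [T] lives on the word [n s]. *)
Lemma heckeT_sqr s T (Tt : aff_T D s -> hecke R I) : is_heckeT (n s) T ->
  (forall t, is_heckeT (aff_t D s t) (Tt t)) ->
  T * T = (\sum_t Tt t) * T.
Proof.
move=> Tn Ttt; apply: hfun_inj.
have sumE (F : aff_T D s -> hecke R I) x :
    hfun (\sum_t F t) x = \sum_t hfun (F t) x.
  by apply: (big_morph (fun p => hfun p x)).
apply: biinv_bruhat => [||s' l z zZ]; try exact: hfun_biinv.
rewrite mulr_suml sumE (heckeT_n Tn).
under [RHS]eq_bigr => t _ do rewrite (heckeT_Z (aff_tZ _) (Ttt _)).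
have Tn' : is_heckeT (wd s 1 * 1)%g T by rewrite /= !mulg1.
have [s'E|s'E] := rev_ordP s s'; last first.
  rewrite s'E (aff_long D _ _ (hfun_biinv T)) // big1 // => t _.
  have [z' z'Z ->] := wd_comm (rev_ord s) l (aff_V D (aff_tZ t)) zZ.
  rewrite (heckeT_wdE _ _ (aff_1 D) z'Z Tn').
  by case: asboolP => // -[-> [/rev_ord_neq|]].
rewrite s'E; case: l => [|l].
  rewrite (aff_long D s 0 (hfun_biinv T) zZ) big1 // => t _.
  have [z' z'Z ->] := wd_comm s 0 (aff_V D (aff_tZ t)) zZ.
  by rewrite (heckeT_wdE _ _ (aff_1 D) z'Z Tn'); case: asboolP => // -[].
rewrite (aff_short D _ _ (hfun_biinv T)) // (heckeT_wdE _ _ (aff_1 D) zZ Tn').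
by case: asboolP => [[-> [/rev_ord_neq|]]|_] //; rewrite add0r.
Qed.

Lemma aff_rep_shift z : z \in Z -> exists2 f : aff_X D -> aff_X D, injective f &
  forall x, exists i, [/\ i \in I, i \in Z &
    (z * aff_rep D x = aff_rep D (f x) * i)%g].
Proof.
move=> zZ.
have /boolp.choice[f fP] : forall x, exists y,
    ((aff_rep D y)^-1 * (z * aff_rep D x))%g \in I.
  by move=> x; apply: aff_rep_ex; apply: (aff_M D) => //; apply: aff_repZ.
exists f => [x y xy|x].
  apply: (aff_rep_uniq (a := D)).
  by have := memM (memV (fP x)) (fP y); rewrite xy; gsimp.
exists ((aff_rep D (f x))^-1 * (z * aff_rep D x))%g; split; [exact: fP | | by gsimp].
by apply: (aff_M D); [apply: (aff_V D) | apply: (aff_M D)] => //; apply: aff_repZ.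
Qed.

(** * Representations from matrices satisfying the relations *)

Section Representation.
Variables (A : algType R) (rho : G -> A) (M : 'I_2 -> A).
Hypothesis rhoM : forall z z', z \in Z -> z' \in Z -> rho (z * z')%g = rho z * rho z'.
Hypothesis rhoI : forall z, z \in Z -> z \in I -> rho z = 1.
Hypothesis M_rho : forall s z, z \in Z ->
  M s * rho z = rho (n s * z * (n s)^-1)%g * M s.
Hypothesis M_sqr : forall s, M s * M s = (\sum_t rho (aff_t D s t)) * M s.

Fixpoint Mwd s l : A := if l is l'.+1 then M s * Mwd (rev_ord s) l' else 1.

Let rep := aff_rep D.

Let repZ x : rep x \in Z.
Proof. exact: aff_repZ. Qed.

(** The part of the image of [p] carried by the words [wd s l * z]: their operators are sent to
    [Mwd s l * rho z], and the values of [hfun p] are the coefficients of [p] in this basis. *)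
Definition hwd s l p : A :=
  \sum_x hfun p (wd s l * rep x)%g *: (Mwd s l * rho (rep x)).

Lemma Mwd_rho s l z : z \in Z ->
  Mwd s l * rho z = rho (wd s l * z * (wd s l)^-1)%g * Mwd s l.
Proof.
elim: l s z => [|l IHl] s z zZ /=; first by gsimp; rewrite mulr1 mul1r.
rewrite -mulrA IHl // mulrA M_rho; last exact: wd_ZV.
by rewrite mulrA; gsimp.
Qed.

Lemma hwd_Z s l z T p : z \in Z -> is_heckeT z T ->
  hwd s l (T * p) = rho z * hwd s l p.
Proof.
move=> zZ Tz; pose z' := ((wd s l)^-1 * z^-1 * wd s l)%g.
have z'Z : z' \in Z by apply/wd_Z/(aff_V D).
have [f f_inj fP] := aff_rep_shift z'Z; rewrite -/rep in fP.
rewrite /hwd [in RHS](reindex_inj f_inj) mulr_sumr; apply: eq_bigr => x _.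
rewrite (heckeT_Z zZ Tz) -scalerAr; have [i [iI iZ repE]] := fP x.
have -> : (z^-1 * (wd s l * rep x) = wd s l * rep (f x) * i)%g.
  by rewrite -mulgA -repE /z'; gsimp.
rewrite hfunIr //; congr (_ *: _).
have <- : rho (z' * rep x)%g = rho (rep (f x)) by rewrite repE rhoM // (rhoI iZ iI) mulr1.
have zE : rho z * (Mwd s l * rho z') = Mwd s l.
  rewrite Mwd_rho // mulrA /z'; have zVZ := aff_V D zZ; gsimp.
  by rewrite -rhoM // mulgV rhoI ?mul1r ?gpred1 // (aff_1 D).
by rewrite rhoM // [Mwd s l * (_ * _)]mulrA mulrA zE.
Qed.

(** Of the two terms of [aff_short], the shortened word gives [M s * hwd (rev_ord s) l p]; the torus
    sum multiplies by [(\sum_t rho t) * M s], which the quadratic relation turns into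
    [M s * M s]. *)
Lemma hwd_nS s l T p : is_heckeT (n s) T ->
  hwd s l.+1 (T * p) = M s * (hwd (rev_ord s) l p + hwd s l.+1 p).
Proof.
move=> Tn.
have /boolp.choice[Tt Ttt] : forall t, exists T', is_heckeT (aff_t D s t) T'.
  by move=> t; have [T' []] := heckeT_Z_ex (aff_tZ (a := D) t); exists T'.
have -> : hwd s l.+1 (T * p) =
    M s * hwd (rev_ord s) l p + \sum_t hwd s l.+1 (Tt t * p).
  rewrite /hwd mulr_sumr exchange_big -big_split; apply: eq_bigr => x _.
  rewrite -scaler_suml -scalerAr mulrA -[M s * _]/(Mwd s l.+1) -[RHS]scalerDl; congr (_ *: _).
  rewrite (heckeT_n Tn) (aff_short D _ _ (hfun_biinv p)) ?repZ //.
  by congr (_ + _); apply: eq_bigr => t _; rewrite (heckeT_Z (aff_tZ _) (Ttt t)).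
rewrite mulrDr; congr (_ + _).
under eq_bigr => t _ do rewrite (hwd_Z _ _ _ (aff_tZ _) (Ttt _)).
rewrite -mulr_suml.
have -> : hwd s l.+1 p = M s *
    \sum_x hfun p (wd s l.+1 * rep x)%g *: (Mwd (rev_ord s) l * rho (rep x)).
  by rewrite mulr_sumr; apply: eq_bigr => x _; rewrite -scalerAr mulrA.
by rewrite !mulrA M_sqr.
Qed.

Lemma hwd_n0 s l T p : is_heckeT (n s) T -> hwd (rev_ord s) l (T * p) = 0.
Proof.
move=> Tn; apply: big1 => x _; rewrite (heckeT_n Tn).
by rewrite (aff_long D _ _ (hfun_biinv p)) ?scale0r ?repZ.
Qed.

Lemma hwd0E s s' p : hwd s 0 p = hwd s' 0 p.
Proof. by []. Qed.

Lemma hwdL s l (a : R) p p' : hwd s l (a *: p + p') = a *: hwd s l p + hwd s l p'.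
Proof.
rewrite /hwd scaler_sumr -big_split; apply: eq_bigr => x _.
by rewrite hfunD hfunZ scalerDl scalerA.
Qed.

Definition hbound p N := forall s l, (N <= l)%N -> hwd s l p = 0.

Lemma hbound_ex p : exists N, hbound p N.
Proof.
have [ys] := hfun_supp p => pys.
suff [N HN] : exists N, forall y s l z u v, y \in ys -> z \in Z -> u \in I -> v \in I ->
    y = (u * (wd s l * z) * v)%g -> (l < N)%N.
  exists N => s l Nl; apply: big1 => x _.
  have [->|/pys[y ys_y yI]] := eqVneq (hfun p (wd s l * rep x)%g) 0.
    by rewrite scale0r.
  suff : (l < N)%N by rewrite ltnNge Nl.
  apply: (HN y s l (rep x) (wd s l * rep x * y^-1)^-1%g 1%g ys_y (repZ x) (memV yI)).
    exact: gpred1.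
  by gsimp.
elim: {pys} ys => [|y ys [N HN]]; first by exists 0%N.
have [s' [l' [z' [u' [v' [z'Z u'I v'I yE]]]]]] := aff_bruhat D y.
exists (maxn N l'.+1) => y' s l z u v; rewrite inE => /orP[/eqP->|y'ys] zZ uI vI y'E; last first.
  by rewrite leq_max (HN _ _ _ _ _ _ y'ys zZ uI vI y'E).
have [|ll _ _] := aff_disjoint D zZ z'Z (memM (memV uI) u'I) (memM v'I (memV vI)) (s := s) (l := l) (s' := s') (l' := l').
  by have := yE; rewrite {1}y'E => e; apply: (mulgI u); apply: (mulIg v); rewrite e; gsimp.
by rewrite ll leq_max leqnn orbT.
Qed.

(** All words of length at most [N], the empty one being counted once under the arbitrary index
    [ord0]. *)
Definition hrep_upto N p : A := hwd ord0 0 p + \sum_(l < N) \sum_s hwd s l.+1 p.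

Lemma hrep_uptoE p N N' : hbound p N -> (N <= N')%N -> hrep_upto N' p = hrep_upto N p.
Proof.
move=> pN NN'; congr (_ + _); rewrite -(subnKC NN') big_split_ord /=.
rewrite [X in _ + X]big1 ?addr0 // => l _; apply: big1 => s _.
by apply: pN; rewrite leqW // leq_addr.
Qed.

(** [Phi] is a sum over the basis, cut off at a bound [N p] chosen for each [p]; any larger bound
    gives the same value, which makes [Phi] linear and lets two elements be compared. *)
Lemma aff_representation : exists Phi : hecke R I -> A,
  [/\ forall (a : R) p p', Phi (a *: p + p') = a *: Phi p + Phi p',
      Phi 1 = 1,
      forall z T p, z \in Z -> is_heckeT z T -> Phi (T * p) = rho z * Phi p &
      forall s T p, is_heckeT (n s) T -> Phi (T * p) = M s * Phi p].
Proof.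
have [N PN] := boolp.choice hbound_ex.
exists (fun p => hrep_upto (N p) p).
have PhiE p N' : hbound p N' -> hrep_upto (N p) p = hrep_upto N' p.
  by move=> pN'; rewrite -(hrep_uptoE pN' (leq_maxl _ (N p))) (hrep_uptoE (PN p)) ?leq_maxr.
have uptoL N' (a : R) p p' :
    hrep_upto N' (a *: p + p') = a *: hrep_upto N' p + hrep_upto N' p'.
  rewrite /hrep_upto hwdL scalerDr addrACA; congr (_ + _).
  rewrite scaler_sumr -big_split; apply: eq_bigr => l _; rewrite scaler_sumr -big_split; apply: eq_bigr => s _.
  by rewrite hwdL.
split=> [a p p'||z T p zZ Tz|s T p Tn].
- pose N' := maxn (N p) (N p').
  have pN : hbound p N'.
    by move=> s l Nl; apply: PN; apply: leq_trans Nl; apply: leq_maxl.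
  have p'N : hbound p' N'.
    by move=> s l Nl; apply: PN; apply: leq_trans Nl; apply: leq_maxr.
  rewrite (PhiE p N') // (PhiE p' N') // (PhiE _ N') ?uptoL // => s l Nl.
  by rewrite hwdL pN // p'N // scaler0 addr0.
- have disj1 s l x : (wd s l.+1 * rep x)%g \in I = false.
    apply/negP => xI; have I1 : 1%g \in I by apply: gpred1.
    have [] // := @aff_disjoint _ _ _ _ _ D s l.+1 (rep x) ord0 0%N 1%g
      (wd s l.+1 * rep x)%g 1%g (repZ x) (aff_1 D) xI I1.
    by rewrite /= !mulg1.
  have N1 : hbound 1 1.
    by move=> s [//|l] _; apply: big1 => x _; rewrite hfun1 disj1 scale0r.
  rewrite (PhiE _ 1%N) // /hrep_upto [X in _ + X]big1 ?addr0 => [|l _]; last first.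
    by apply: big1 => s _; apply: N1.
  have [x0 x0I] := aff_rep_ex D (aff_1 D); rewrite mulg1 in x0I.
  rewrite /hwd (bigD1 x0) //= big1 => [|x xx0]; last first.
    rewrite hfun1 mul1g; case xI: (_ \in I); last by rewrite scale0r.
    case/eqP: xx0; apply: (aff_rep_uniq (a := D)).
    by rewrite -/rep memM ?memV // -[rep x0]invgK memV.
  have {}x0I : rep x0 \in I by rewrite -[rep x0]invgK memV.
  by rewrite hfun1 mul1g x0I scale1r mul1r rhoI ?addr0.
- rewrite (PhiE _ (N p)) => [|s l Nl]; last first.
    by rewrite (hwd_Z _ _ _ zZ Tz) PN // mulr0.
  rewrite /hrep_upto (hwd_Z _ _ _ zZ Tz) mulrDr; congr (_ + _).
  rewrite mulr_sumr; apply: eq_bigr => l _; rewrite mulr_sumr; apply: eq_bigr => s _.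
  by rewrite (hwd_Z _ _ _ zZ Tz).
have wd0 : hwd ord0 0 (T * p) = 0 by rewrite (hwd0E _ (rev_ord s)) (hwd_n0 _ _ Tn).
have TpN : hbound (T * p) (N p).+1.
  move=> s' [//|l] Nl; have [->|->] := rev_ordP s s'; last exact: hwd_n0.
  by rewrite (hwd_nS _ _ Tn) !PN ?addr0 ?mulr0 // leqW.
rewrite (PhiE _ _ TpN) /hrep_upto wd0 add0r.
(* Only words beginning with [s] survive. The terms [hwd (rev_ord s) l p] start at the empty word
   and supply [hwd ord0 0 p]; the last of the terms [hwd s l.+1 p] lies beyond the bound. *)
under eq_bigr => l _ do rewrite (sum_I2 s) (hwd_n0 _ _ Tn) addr0 (hwd_nS _ _ Tn).
rewrite -mulr_sumr; congr (_ * _).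
rewrite big_split /= big_ord_recl [X in _ + X]big_ord_recr /=.
rewrite (PN p s) ?leqnn // addr0 -addrA -big_split (hwd0E _ ord0); congr (_ + _).
by apply: eq_bigr => l _; rewrite (sum_I2 s) addrC.
Qed.

End Representation.

Lemma TZ_ex : exists TZ : G -> hecke R I, forall z, z \in Z -> is_heckeT z (TZ z).
Proof.
have /boolp.choice[TZ TZP] : forall z, exists T : hecke R I, z \in Z -> is_heckeT z T.
  move=> z; case zZ: (z \in Z); last by exists 0.
  by have [T [Tz _]] := heckeT_Z_ex zZ; exists T.
by exists TZ.
Qed.

Lemma heckeT_ZM z z' T T' T'' : z \in Z -> z' \in Z -> is_heckeT z T ->
  is_heckeT z' T' -> is_heckeT (z * z')%g T'' -> T'' = T * T'.
Proof.
by move=> zZ z'Z Tz Tz' Tzz'; apply: (heckeT_uniq Tzz'); apply: heckeT_mulZ.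
Qed.

Definition is_hecke_char (xi : {lrmorphism hecke R I -> R^o}) (ch : G -> R)
    (x : 'I_2 -> R) : Prop :=
  (forall z T, z \in Z -> is_heckeT z T -> xi T = ch z) /\
  (forall s T, is_heckeT (n s) T -> xi T = x s).

Section HeckeCharacter.
Variables (xi : {lrmorphism hecke R I -> R^o}) (ch : G -> R) (x : 'I_2 -> R).
Hypothesis xiP : is_hecke_char xi ch x.
Let xiZ := xiP.1.
Let xin := xiP.2.

Lemma chE : exists2 TZ : G -> hecke R I, forall z, z \in Z -> is_heckeT z (TZ z) &
  forall z, z \in Z -> ch z = xi (TZ z).
Proof. by have [TZ TZP] := TZ_ex; exists TZ => // z zZ; rewrite (xiZ zZ (TZP z zZ)). Qed.

Lemma chM z z' : z \in Z -> z' \in Z -> ch (z * z')%g = ch z * ch z'.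
Proof.
have [TZ TZP E] := chE => zZ z'Z; have zz'Z := aff_M D zZ z'Z.
rewrite !E // -charM; congr (xi _).
exact: heckeT_ZM (TZP _ zZ) (TZP _ z'Z) (TZP _ zz'Z).
Qed.

Lemma chI z : z \in Z -> z \in I -> ch z = 1.
Proof.
have [TZ TZP E] := chE => zZ zI.
by rewrite E // (heckeT_inI zI (TZP _ zZ)) char1.
Qed.

Lemma ch_n s z : z \in Z -> x s * ch z = ch (n s * z * (n s)^-1)%g * x s.
Proof.
have [TZ TZP E] := chE => zZ; have [T [Tn _]] := heckeT_n_ex s.
have nzZ := aff_nZ D s zZ; rewrite !E // -(xin Tn) -!charM; congr (xi _).
exact: heckeT_nZ Tn (TZP _ zZ) (TZP _ nzZ).
Qed.

Lemma ch_sqr s : x s * x s = (\sum_t ch (aff_t D s t)) * x s.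
Proof.
have [TZ TZP E] := chE; have [T [Tn _]] := heckeT_n_ex s.
rewrite -(xin Tn) -charM (heckeT_sqr Tn (fun t => TZP _ (aff_tZ t))) charM.
congr (_ * _); rewrite raddf_sum; apply: eq_bigr => t _.
by rewrite E ?aff_tZ.
Qed.

End HeckeCharacter.

(** * Derivations and their values on the generators *)

Section Derivations.
Variables (xi xi' : {lrmorphism hecke R I -> R^o}) (ch ch' : G -> R) (x x' : 'I_2 -> R).
Hypothesis xiP : is_hecke_char xi ch x.
Hypothesis xi'P : is_hecke_char xi' ch' x'.

(** The two hypotheses are the upper right entries of the relations required by [aff_representation]
    for matrices with diagonals from [xi] and [xi']; the derivation is the corner of the resulting
    representation. *)
Lemma hecke_deriv_ex (a : 'I_2 -> R) :
  (forall s z, z \in Z -> a s * ch' z = ch (n s * z * (n s)^-1)%g * a s) ->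
  (forall s, (x s + x' s) * a s = (\sum_t ch (aff_t D s t)) * a s) ->
  exists d : tderiv xi xi',
    (forall z T, z \in Z -> is_heckeT z T -> d T = 0) /\
    (forall s T, is_heckeT (n s) T -> d T = a s).
Proof.
move=> aZ an.
pose rho z := utmx (ch z) 0 (ch' z); pose M s := utmx (x s) (a s) (x' s).
have [z z' zZ z'Z|z zZ zI|s z zZ|s|Phi [PhiL Phi1 PhiZ Phin]] :=
    @aff_representation _ rho M.
- by rewrite /rho utmxM (chM xiP) // (chM xi'P) //; congr utmx; ring.
- by rewrite /rho (chI xiP) // (chI xi'P) // utmx1.
- rewrite /rho /M !utmxM (ch_n xiP) // (ch_n xi'P) //; congr utmx.
  by rewrite mulr0 add0r aZ // mul0r addr0.
- rewrite /rho /M utmx_sum !utmxM (ch_sqr xiP) (ch_sqr xi'P); congr utmx.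
  by rewrite [X in _ = _ + X * _]big1 // mul0r addr0 -an; ring.
(* One induction on generators gives multiplicativity and identifies the diagonal entries; the
   corner [b] is left unspecified. *)
have PhiM p : exists b, forall q, Phi (p * q) = utmx (xi p) b (xi' p) * Phi q.
  elim/hecke_gen: p => [|c p p' [b bE] [b' b'E]|z T p zZ Tz [b bE]|s T p Tn [b bE]].
  - by exists 0 => q; rewrite !char1 utmx1 !mul1r.
  - exists (c * b + b') => q.
    rewrite mulrDl -scalerAl PhiL bE b'E !charD !charZ -utmxL mulrDl.
    by rewrite scalerAl.
  - eexists => q; rewrite -mulrA (PhiZ _ _ _ zZ Tz) bE mulrA utmxM.
    by rewrite !charM (xiP.1 _ _ zZ Tz) (xi'P.1 _ _ zZ Tz).
  - eexists => q; rewrite -mulrA (Phin _ _ _ Tn) bE mulrA utmxM.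
    by rewrite !charM (xiP.2 _ _ Tn) (xi'P.2 _ _ Tn).
pose i0 : 'I_2 := ord0; pose i1 : 'I_2 := ord_max.
pose d p := Phi p i0 i1.
have PhiE p : Phi p = utmx (xi p) (d p) (xi' p).
  have [b bE] := PhiM p; have := bE 1; rewrite mulr1 Phi1 mulr1 => PhiE.
  by rewrite /d PhiE mxE.
have dL (c : R) p p' : d (c *: p + p') = c * d p + d p'.
  by rewrite /d PhiL !mxE.
have dM p p' : d (p * p') = (xi p : R) * d p' + d p * (xi' p' : R).
  have [b bE] := PhiM p; have {}bE : Phi (p * p') = Phi p * Phi p'.
    by rewrite bE; congr (_ * _); rewrite -[p]mulr1 bE mulr1 Phi1 mulr1.
  by rewrite [LHS]/d bE !PhiE utmxM mxE.
exists (TDeriv dL dM); split=> [z T zZ Tz|s T Tn] /=; rewrite /d.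
  by rewrite -[T]mulr1 (PhiZ _ _ _ zZ Tz) Phi1 mulr1 mxE.
by rewrite -[T]mulr1 (Phin _ _ _ Tn) Phi1 mulr1 mxE.
Qed.

Lemma hecke_deriv_uniq (d d' : tderiv xi xi') :
  (forall z T, z \in Z -> is_heckeT z T -> d T = d' T) ->
  (forall s T, is_heckeT (n s) T -> d T = d' T) -> d =1 d'.
Proof.
move=> ddZ ddn; elim/hecke_gen => [|c p p' dp dp'|z T p zZ Tz dp|s T p Tn dp].
- by rewrite !dval1.
- by rewrite !dval_linear dp dp'.
- by rewrite !dvalM dp (ddZ _ _ zZ Tz).
- by rewrite !dvalM dp (ddn _ _ Tn).
Qed.

Lemma hecke_deriv_nZ (d : tderiv xi xi') :
  (forall z T, z \in Z -> is_heckeT z T -> d T = 0) ->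
  forall s z T, z \in Z -> is_heckeT (n s) T ->
    d T * ch' z = ch (n s * z * (n s)^-1)%g * d T.
Proof.
have [TZ TZP] := TZ_ex.
move=> dZ s z T zZ Tn; have nzZ := aff_nZ D s zZ.
have := heckeT_nZ zZ Tn (TZP _ zZ) (TZP _ nzZ) => /(congr1 d).
rewrite !dvalM (dZ _ _ zZ (TZP _ zZ)) (dZ _ _ nzZ (TZP _ nzZ)) mulr0 add0r mul0r addr0.
by rewrite (xi'P.1 _ _ zZ (TZP _ zZ)) (xiP.1 _ _ nzZ (TZP _ nzZ)).
Qed.

Lemma hecke_deriv_sqr (d : tderiv xi xi') :
  (forall z T, z \in Z -> is_heckeT z T -> d T = 0) ->
  forall s T, is_heckeT (n s) T ->
    (x s + x' s) * d T = (\sum_t ch (aff_t D s t)) * d T.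
Proof.
have [TZ TZP] := TZ_ex.
move=> dZ s T Tn; have := heckeT_sqr Tn (fun t => TZP _ (aff_tZ t)) => /(congr1 d).
have d0 : d (\sum_t TZ (aff_t D s t)) = 0.
  rewrite (big_morph d (dvalD d) (dval0 d)) big1 // => t _.
  exact: dZ (aff_tZ t) (TZP _ (aff_tZ t)).
rewrite !dvalM d0 mul0r addr0 (xiP.2 _ _ Tn) (xi'P.2 _ _ Tn) => E.
rewrite mulrDl [x' s * _]mulrC E; congr (_ * _); rewrite raddf_sum.
apply: eq_bigr => t _; exact: (xiP.1 _ _ (aff_tZ t) (TZP _ (aff_tZ t))).
Qed.

End Derivations.

End AffineHecke.

Section Normalise.
Variables (R : fieldType) (G : groupType) (I : groupClosed G).
Variables (n : 'I_2 -> G) (Z : {pred G}) (D : affine_datum R I n Z).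
Variables (xi xi' : {lrmorphism hecke R I -> R^o}) (ch ch' : G -> R) (x x' : 'I_2 -> R).
Hypothesis xiP : is_hecke_char n Z xi ch x.
Hypothesis xi'P : is_hecke_char n Z xi' ch' x'.
Hypothesis X_neq0 : #|aff_X D|%:R != 0 :> R.

(* [Z/(Z :&: I)] is finite of order prime to the characteristic, hence has no
   first cohomology; the coboundary is found by averaging. *)
Lemma hecke_deriv_normalise (d : tderiv xi xi') : exists m : R,
  forall z T, z \in Z -> is_heckeT z T -> d T = m * (ch z - ch' z).
Proof.
have [TZ TZP] := TZ_ex D.
have ch'0 z : z \in Z -> ch' z != 0.
  move=> zZ; have := chM D xi'P zZ (aff_V D zZ); rewrite mulgV (chI D xi'P (aff_1 D)) ?gpred1 //.
  by move/eqP; apply: contraTneq => ->; rewrite mul0r oner_eq0.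
(* Dividing by [ch'] turns [d] into a 1-cocycle with values in the character [ch / ch']. *)
pose e z := d (TZ z) / ch' z.
have eM z z' : z \in Z -> z' \in Z -> e (z * z')%g = ch z / ch' z * e z' + e z.
  move=> zZ z'Z; rewrite /e (heckeT_ZM D zZ z'Z (TZP _ zZ) (TZP _ z'Z) (TZP _ (aff_M D zZ z'Z))).
  rewrite dvalM (xiP.1 _ _ zZ (TZP _ zZ)) (xi'P.1 _ _ z'Z (TZP _ z'Z)) (chM D xi'P) //.
  by field; rewrite !ch'0.
have eI z : z \in Z -> z \in I -> e z = 0.
  by move=> zZ zI; rewrite /e (heckeT_inI zI (TZP _ zZ)) dval1 mul0r.
pose S := \sum_y e (aff_rep D y).
have SE z : z \in Z -> S = ch z / ch' z * S + #|aff_X D|%:R * e z.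
  move=> zZ; have [f f_inj fP] := aff_rep_shift D zZ.
  rewrite /S mulr_sumr mulr_natl -sumr_const -big_split [LHS](reindex_inj f_inj).
  apply: eq_bigr => y _ /=; rewrite -eM ?aff_repZ //; have [i [iI iZ ->]] := fP y.
  by rewrite eM ?aff_repZ // (eI _ iZ iI) mulr0 add0r.
exists (- S / #|aff_X D|%:R) => z T zZ Tz; rewrite (heckeT_uniq Tz (TZP _ zZ)).
have -> : d (TZ z) = e z * ch' z by rewrite /e mulfVK ?ch'0.
have -> : e z = (S - ch z / ch' z * S) / #|aff_X D|%:R.
  by rewrite {1}(SE z zZ); field; rewrite X_neq0 ch'0.
by field; rewrite X_neq0 ch'0.
Qed.

End Normalise.

(** * Unramified quadratic extensions *)

Section Valuation.
Variables (F : fieldType) (k : finFieldType) (E : local_field F k).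
Local Notation v := (lf_val E).
Local Notation vg := (val_ge (lf_val E)).
Local Notation red := (lf_red E).

Lemma lf_val1 : v 1 = 0.
Proof.
have := lf_valM E (oner_neq0 F) (oner_neq0 F).
by rewrite mulr1 => /eqP; rewrite -subr_eq subrr => /eqP.
Qed.

Lemma lf_valV x : x != 0 -> v x^-1 = - v x.
Proof.
move=> x0; have := lf_valM E x0 (invr_neq0 x0).
by rewrite mulfV // lf_val1 => /esym/eqP; rewrite addrC addr_eq0 => /eqP.
Qed.

Lemma lf_valN1 : v (-1) = 0.
Proof.
have N10 : (-1 : F) != 0 by rewrite oppr_eq0 oner_eq0.
have := lf_valM E N10 N10; rewrite mulrNN mulr1 lf_val1; lia.
Qed.

Lemma lf_valN x : v (- x) = v x.
Proof.
have [->|x0] := eqVneq x 0; first by rewrite oppr0.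
by rewrite -mulN1r lf_valM ?lf_valN1 ?add0r // oppr_eq0 oner_eq0.
Qed.

Lemma vgE m x : x != 0 -> vg m x = (m <= v x).
Proof. by move=> x0; rewrite /val_ge (negPf x0). Qed.

Lemma vgN m x : vg m (- x) = vg m x.
Proof. by rewrite /val_ge oppr_eq0 lf_valN. Qed.

Lemma vgB m x y : vg m x -> vg m y -> vg m (x - y).
Proof. by move=> mx my; apply: lf_valD; rewrite ?vgN. Qed.

Lemma vgW m n x : n <= m -> vg m x -> vg n x.
Proof. by move=> nm /orP[/eqP->|mx]; rewrite /val_ge ?eqxx // (le_trans nm) ?orbT. Qed.

Lemma vgMl m n l x y : l <= m + n -> vg m x -> vg n y -> vg l (x * y).
Proof. by move=> lmn mx ny; apply: vgW lmn (val_geM mx ny). Qed.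

Lemma vgM0 m x y : vg 0 x -> vg m y -> vg m (x * y).
Proof. by move=> mx ny; have := val_geM mx ny; rewrite add0r. Qed.

Lemma vgMr0 m x y : vg m x -> vg 0 y -> vg m (x * y).
Proof. by move=> mx ny; have := val_geM mx ny; rewrite addr0. Qed.

Lemma vgX m x : vg 0 x -> vg 0 (x ^+ m).
Proof.
by move=> x0; elim: m => [|m IHm]; rewrite ?expr0 ?exprS ?val_ge1 // vgM0.
Qed.

Lemma redN x : vg 0 x -> red (- x) = - red x.
Proof.
move=> x0; apply/eqP; rewrite -addr_eq0 addrC -lf_redD ?vgN // subrr.
by rewrite lf_red0.
Qed.

Lemma redB x y : vg 0 x -> vg 0 y -> red (x - y) = red x - red y.
Proof. by move=> x0 y0; rewrite lf_redD ?vgN // redN. Qed.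

Lemma redX x m : vg 0 x -> red (x ^+ m) = red x ^+ m.
Proof.
move=> x0; elim: m => [|m IHm]; first by rewrite !expr0 lf_red1.
by rewrite !exprS lf_redM ?vgX // IHm.
Qed.

Lemma red_eq x y : vg 0 x -> vg 0 y -> red x = red y <-> vg 1 (x - y).
Proof.
move=> x0 y0; rewrite -lf_red_ker ?vgB // redB //; split=> [->|/eqP].
  by rewrite subrr.
by rewrite subr_eq0 => /eqP.
Qed.

Lemma red_eq0 x : vg 0 x -> (red x == 0) = vg 1 x.
Proof. by move=> x0; apply/eqP/idP => /(lf_red_ker x0). Qed.

Lemma red1P x : vg 0 x -> red x = 1 <-> vg 1 (x - 1).
Proof. by move=> x0; rewrite -(lf_red1 E); apply: red_eq; rewrite ?val_ge1. Qed.

Lemma lf_unitE x : vg 0 x -> red x != 0 -> x != 0 /\ v x = 0.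
Proof.
move=> x0; rewrite red_eq0 // negb_or -ltNge => /andP[xn0].
move: x0; rewrite vgE // => h1 h2; split=> //; lia.
Qed.

Lemma red_unit x : x != 0 -> v x = 0 -> red x != 0.
Proof. by move=> x0 vx; rewrite red_eq0 ?vgE ?vx. Qed.

Lemma redV x : x != 0 -> v x = 0 -> red x^-1 = (red x)^-1.
Proof.
move=> x0 vx; have rx := red_unit x0 vx; apply: (mulfI rx).
by rewrite -lf_redM ?vgE ?invr_neq0 ?lf_valV ?vx // !divff // lf_red1.
Qed.

Lemma vg_inv m x : x != 0 -> vg m x^-1 = (v x <= - m).
Proof. by move=> x0; rewrite vgE ?invr_neq0 // lf_valV //; lia. Qed.

End Valuation.

(** * Galois conjugation on [L] and on its residue field *)

Section Unramified.
Variables (K : fieldType) (L : fieldExtType K) (k kL : finFieldType).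
Variable E : unramified_quadratic L k kL.
Local Notation vK := (val_ge (lf_val (uq_base E))).
Local Notation vg := (val_ge (lf_val (uq_ext E))).
Local Notation red := (lf_red (uq_ext E)).
Local Notation bar := (uq_bar E).
Local Notation cj := (uq_conj E).
Local Notation q := #|k|.

Lemma vg_base m (a : K) : vg m a%:A = vK m a.
Proof.
have [->|a0] := eqVneq a 0; first by rewrite scale0r !val_ge0.
have aA0 : a%:A != 0 :> L by rewrite scaler_eq0 oner_eq0 orbF.
by rewrite !vgE // uq_val.
Qed.

Lemma q_gt1 : (1 < q)%N.
Proof. exact: finNzRing_gt1. Qed.

Lemma k_char : exists r n, [/\ prime r, q = (r ^ n)%N, (0 < n)%N & r \in [pchar kL]].
Proof.
have [r r_pr rk] := finPcharP k.
have [n qE] : exists n, q = (r ^ n)%N by eexists; apply: (card_pprimeChar rk).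
exists r, n; split=> //; first by case: n qE q_gt1 => // ->.
by apply: (card_finPcharP (n := n * 2)) => //; rewrite (uq_res E) expnM -qE.
Qed.

Lemma Frob_additive (x y : kL) : (x + y) ^+ q = x ^+ q + y ^+ q.
Proof.
have [r [n [r_pr qE _ rkL]]] := k_char; apply: exprDn_pchar.
by rewrite (eq_pnat _ (pcharf_eq rkL)) qE pnatX pnat_id.
Qed.

Lemma Frob_invol (x : kL) : (x ^+ q) ^+ q = x.
Proof. by rewrite -exprM mulnn -(uq_res E) expf_card. Qed.

Lemma algB (a b : K) : (a - b)%:A = a%:A - b%:A :> L.
Proof. exact: scalerBl. Qed.

Lemma algM (a b : K) : (a * b)%:A = a%:A * b%:A :> L.
Proof. by rewrite mulr_algl scalerA. Qed.

Lemma red_base_eq (a b : K) : vK 0 a -> vK 0 b ->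
  red a%:A = red b%:A <-> lf_red (uq_base E) a = lf_red (uq_base E) b.
Proof.
move=> a0 b0; rewrite !red_eq ?vg_base // -algB vg_base.
by [].
Qed.

Lemma red_base_Frob (a : K) : vK 0 a -> red a%:A ^+ q = red a%:A.
Proof.
move=> a0; have aX : vK 0 (a ^+ q) by apply: vgX.
rewrite -redX ?vg_base // -in_algE -rmorphXn in_algE.
by apply/red_base_eq => //; rewrite redX // expf_card.
Qed.

Lemma Frob_fixed_card : (#|[set x : kL | (x ^+ q == x)%R]| <= q)%N.
Proof.
set S := [set _ | _]; pose P : {poly kL} := 'X^q - 'X.
have P0 : P != 0.
  by rewrite -size_poly_eq0 size_polyDl size_polyXn // size_polyN size_polyX ltnS q_gt1.
rewrite cardE -ltnS; have <- : size P = q.+1.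
  by rewrite size_polyDl size_polyXn // size_polyN size_polyX ltnS q_gt1.
apply: max_poly_roots P0 _ (enum_uniq _); apply/allP => x.
rewrite mem_enum inE => /eqP xq.
by rewrite /root !hornerE xq subrr.
Qed.

(** [k] is not given as a subfield of [kL]: it is embedded by lifting to [K] and reducing in [L],
    and a count shows that the image is the whole fixed set of [x |-> x^q]. *)
Lemma base_imageE : exists f : k -> kL, [/\ injective f,
  forall c, exists2 a : K, vK 0 a & red a%:A = f c &
  f @: [set: k] = [set x : kL | (x ^+ q == x)%R]].
Proof.
have /boolp.choice[l lP] : forall c : k, exists a : K, vK 0 a /\ lf_red (uq_base E) a = c.
  by move=> c; have [a a0 ac] := lf_red_surj (uq_base E) c; exists a.
pose f c := red (l c)%:A.
have f_inj : injective f.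
  move=> c d cd; rewrite -(lP c).2 -(lP d).2.
  by apply/red_base_eq => //; [apply: (lP c).1 | apply: (lP d).1].
exists f; split=> // [c|]; first by exists (l c) => //; apply: (lP c).1.
apply/eqP; rewrite eqEcard card_imset // cardsT Frob_fixed_card andbT.
by apply/subsetP => _ /imsetP[c _ ->]; rewrite inE red_base_Frob //; apply: (lP c).1.
Qed.

Lemma base_image (x : kL) : x ^+ q = x -> exists2 a : K, vK 0 a & red a%:A = x.
Proof.
have [f [_ fP fE]] := base_imageE => xq.
have : x \in f @: [set: k] by rewrite fE inE xq.
by move=> /imsetP[c _ ->]; apply: fP.
Qed.

Lemma Frob_fixed_bar (x : kL) : x ^+ q = x -> bar x = x.
Proof. by move=> /base_image[a a0 <-]; apply: uq_bar_fix. Qed.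

(** [x] and [x^q] are the roots of a quadratic polynomial with coefficients fixed by [bar]; so
    [bar x] is one of them, and it is not [x]. *)
Lemma bar_moved (x : kL) : bar x != x -> bar x = x ^+ q.
Proof.
move=> bx.
have fixD : bar (x + x ^+ q) = x + x ^+ q.
  by apply: Frob_fixed_bar; rewrite Frob_additive Frob_invol addrC.
have fixM : bar (x * x ^+ q) = x * x ^+ q.
  by apply: Frob_fixed_bar; rewrite exprMn Frob_invol mulrC.
have : (bar x - x) * (bar x - x ^+ q) = bar (x * x - (x + x ^+ q) * x + x * x ^+ q).
  by rewrite rmorphD fixM rmorphB !(rmorphM bar) fixD; ring.
have -> : x * x - (x + x ^+ q) * x + x * x ^+ q = 0 by ring.
move/eqP; rewrite rmorph0 mulf_eq0 subr_eq0 (negPf bx) subr_eq0 => /eqP //.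
Qed.

(** If [bar] fixes [x] and moves [x0], it also moves [x * x0]; comparing [bar_moved] for the two
    moved elements gives [x = x^q]. *)
Lemma barE (x : kL) : bar x = x ^+ q.
Proof.
have [bx|/bar_moved//] := eqVneq (bar x) x.
have [x0 x0b] := uq_bar_neq E.
have [->|xn0] := eqVneq x 0; first by rewrite rmorph0 expr0n; case: q q_gt1.
have xx0b : bar (x * x0) != x * x0.
  by rewrite rmorphM bx (inj_eq (mulfI xn0)).
have := bar_moved xx0b; rewrite rmorphM exprMn (bar_moved x0b) => /mulIf -> //.
by rewrite expf_neq0 //; apply: contraNneq x0b => ->; rewrite rmorph0.
Qed.

Lemma barK (x : kL) : bar (bar x) = x.
Proof. by rewrite !barE Frob_invol. Qed.

Lemma theta_ex : exists2 th : L, vg 0 th & bar (red th) != red th.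
Proof.
have [x xb] := uq_bar_neq E; have [th th0 thx] := lf_red_surj (uq_ext E) x.
by exists th; rewrite // thx.
Qed.

Lemma L_span (th : L) : vg 0 th -> bar (red th) != red th ->
  forall x : L, exists a b : K, x = a%:A + b *: th.
Proof.
move=> th0 thb x.
have th1 : th \notin <[1%R]>%VS.
  apply/negP => /vlineP[a aE]; case/eqP: thb; rewrite aE; apply: uq_bar_fix.
  by rewrite -vg_base -aE.
have fr : free [:: th; 1].
  by rewrite free_cons span_seq1 th1 seq1_free oner_eq0.
have : basis_of {:L} [:: th; 1] by rewrite basisEfree fr subvf (uq_dim E).
case/andP=> /eqP span_full _; have : x \in <<[:: th; 1%R]>>%VS by rewrite span_full memvf.
rewrite span_cons span_seq1 => /memv_addP[u /vlineP[b ->] [w /vlineP[a ->] ->]].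
by exists a, b; rewrite addrC.
Qed.

(** Were a coefficient not integral, dividing by the one of least valuation would put some
    [a' + b' th] in the maximal ideal with [a'] or [b'] equal to [1]; then [bar] would fix [red th],
    or [1] would reduce to [0]. *)
Lemma vg_span (th : L) (a b : K) : vg 0 th -> bar (red th) != red th ->
  vg 0 (a%:A + b *: th) -> vK 0 a /\ vK 0 b.
Proof.
move=> th0 thb ab0.
have red_fix (c : K) : vK 0 c -> bar (red c%:A) = red c%:A by apply: uq_bar_fix.
have bthE (c : K) : c *: th = c%:A * th by rewrite mulr_algl.
have alg0 (c : K) : vK 0 c -> vg 0 c%:A by rewrite vg_base.
have key (c a' b' : K) : c != 0 -> lf_val (uq_base E) c < 0 -> a = c * a' -> b = c * b' ->
    vK 0 a' -> vK 0 b' -> a' = 1 \/ b' = 1 -> False.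
  move=> c0 vc aE bE a'0 b'0 ab1.
  have cA0 : c%:A != 0 :> L by rewrite scaler_eq0 oner_eq0 orbF.
  have : vg 1 (a'%:A + b'%:A * th).
    have -> : a'%:A + b'%:A * th = (c%:A)^-1 * (a%:A + b *: th).
      by rewrite bthE aE bE !algM; field.
    by apply: vgMl ab0; rewrite ?addr0 // vg_inv // uq_val //; lia.
  have ba0 : vg 0 (b'%:A * th) by rewrite vgM0 ?alg0.
  rewrite -red_eq0 ?lf_valD ?alg0 // lf_redD ?alg0 // lf_redM ?alg0 // => /eqP E0.
  have [b'1|b'1] := eqVneq (red b'%:A) 0.
    case: ab1 => [a1|b1].
      by move: E0; rewrite b'1 mul0r addr0 a1 scale1r lf_red1 => /eqP; rewrite oner_eq0.
    by move/eqP: b'1; rewrite b1 scale1r lf_red1 oner_eq0.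
  case/eqP: thb; have -> : red th = - red a'%:A / red b'%:A.
    by apply: (mulfI b'1); rewrite [RHS]mulrC mulfVK //; apply/eqP; rewrite -addr_eq0 addrC E0.
  by rewrite fmorph_div rmorphN !red_fix.
have keyV (c d : K) : c != 0 -> d = c * (d / c) by move=> c0; rewrite mulrC divfK.
have vdiv (c d : K) : c != 0 -> val_ge (lf_val (uq_base E)) (lf_val (uq_base E) c) d ->
    vK 0 (d / c).
  move=> c0 cd; apply: (vgMl (n := - lf_val (uq_base E) c) _ cd); first by rewrite subrr.
  by rewrite vg_inv // opprK.
have side (c d : K) : vK 0 c -> c != 0 ->
    val_ge (lf_val (uq_base E)) (lf_val (uq_base E) c) d -> vK 0 d.
  by move=> c1 c0; apply: vgW; rewrite -vgE.
have main (c : K) : c != 0 -> c = a \/ c = b ->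
    val_ge (lf_val (uq_base E)) (lf_val (uq_base E) c) a ->
    val_ge (lf_val (uq_base E)) (lf_val (uq_base E) c) b -> vK 0 a /\ vK 0 b.
  move=> c0 cE ca cb; case c1: (vK 0 c); first by split; apply: side c1 c0 _.
  case: (key c (a / c) (b / c)) => //; try by [apply: keyV | apply: vdiv].
    by move/negbT: c1; rewrite vgE // -ltNge.
  by case: cE => <-; [left | right]; rewrite divff.
have [a0|a0] := eqVneq a 0; have [b0|b0] := eqVneq b 0.
- by rewrite a0 b0 !val_ge0.
- by apply: (main b) => //; [right | rewrite a0 val_ge0 | rewrite vgE].
- by apply: (main a) => //; [left | rewrite vgE | rewrite b0 val_ge0].
case: (leP (lf_val (uq_base E) a) (lf_val (uq_base E) b)) => ab.
  by apply: (main a) => //; [left | rewrite vgE | rewrite vgE].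
by apply: (main b) => //; [right | rewrite vgE // ltW | rewrite vgE].
Qed.

Lemma cjD x y : cj (x + y) = cj x + cj y. Proof. exact: rmorphD. Qed.
Lemma cjN x : cj (- x) = - cj x. Proof. exact: rmorphN. Qed.
Lemma cjB x y : cj (x - y) = cj x - cj y. Proof. exact: rmorphB. Qed.
Lemma cjM x y : cj (x * y) = cj x * cj y. Proof. exact: rmorphM. Qed.
Lemma cjV x : cj x^-1 = (cj x)^-1. Proof. exact: fmorphV. Qed.
Lemma cj0 : cj 0 = 0. Proof. exact: rmorph0. Qed.
Lemma cj1 : cj 1 = 1. Proof. exact: rmorph1. Qed.
Lemma cj_eq0 x : (cj x == 0) = (x == 0). Proof. exact: fmorph_eq0. Qed.
Lemma barD x y : bar (x + y) = bar x + bar y. Proof. exact: rmorphD. Qed.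
Lemma barN x : bar (- x) = - bar x. Proof. exact: rmorphN. Qed.
Lemma barB x y : bar (x - y) = bar x - bar y. Proof. exact: rmorphB. Qed.
Lemma barM x y : bar (x * y) = bar x * bar y. Proof. exact: rmorphM. Qed.
Lemma barV x : bar x^-1 = (bar x)^-1. Proof. exact: fmorphV. Qed.
Lemma bar0 : bar 0 = 0. Proof. exact: rmorph0. Qed.
Lemma bar1 : bar 1 = 1. Proof. exact: rmorph1. Qed.
Lemma bar_eq0 x : (bar x == 0) = (x == 0). Proof. exact: fmorph_eq0. Qed.

Lemma cj_alg (a : K) : cj a%:A = a%:A.
Proof. by rewrite linearZ /= rmorph1. Qed.

(* Integral elements are the [a + b theta] with [a] and [b] integral, where the
   reduction of [theta] generates [kL]. *)
Lemma theta_quadratic : exists th : L, exists t n : K,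
  [/\ vg 0 th, bar (red th) != red th, vK 0 t /\ vK 0 n,
      th * th = n%:A + t%:A * th & cj th = t%:A - th].
Proof.
have [th th0 thb] := theta_ex; have span := L_span th0 thb.
have [n [t ntE]] := span (th * th).
have [n0 t0] : vK 0 n /\ vK 0 t.
  by apply: (vg_span th0 thb); rewrite -ntE; apply: vgM0.
rewrite -[t *: th]mulr_algl in ntE; exists th, t, n; split=> //.
have : (cj th - th) * (cj th - (t%:A - th)) = cj (th * th - t%:A * th - n%:A).
  rewrite !cjB !cjM !cj_alg.
  have -> : n%:A = th * th - t%:A * th by rewrite ntE; ring.
  by ring.
have -> : th * th - t%:A * th - n%:A = 0 by rewrite ntE; ring.
move/eqP; rewrite cj0 mulf_eq0 !subr_eq0 => /orP[/eqP cth|/eqP //].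
have [y] := uq_conj_neq E; have [a [b ->]] := span y.
by rewrite -[b *: th]mulr_algl cjD cjM !cj_alg cth eqxx.
Qed.

Lemma cjK (x : L) : cj (cj x) = x.
Proof.
have [th [t [n [th0 thb _ _ cth]]]] := theta_quadratic.
have [a [b ->]] := L_span th0 thb x.
rewrite -[b *: th]mulr_algl !(cjD, cjM, cj_alg) cth cjB cj_alg cth; ring.
Qed.

(** The link between [cj] and [bar] is derived from the generator: both send [theta] to [t - theta],
    the other root of its quadratic equation, [bar] doing so after reduction. *)
Lemma cj_integral_red (x : L) : vg 0 x -> vg 0 (cj x) /\ red (cj x) = bar (red x).
Proof.
have [th [t [n [th0 thb [t0 n0] ntE cth]]]] := theta_quadratic.
have bthE (c : K) : c *: th = c%:A * th by rewrite mulr_algl.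
have bth : bar (red th) = red t%:A - red th.
  have tA : vg 0 t%:A by rewrite vg_base.
  have nA : vg 0 n%:A by rewrite vg_base.
  have E0 : red th * red th - red t%:A * red th - red n%:A = 0.
    by rewrite -!lf_redM // -!redB ?vgB ?vgM0 // ntE [X in red X](_ : _ = 0) ?lf_red0 //; ring.
  have : (bar (red th) - red th) * (bar (red th) - (red t%:A - red th)) =
      bar (red th * red th - red t%:A * red th - red n%:A).
    rewrite !barB !barM !uq_bar_fix //.
    by move/eqP: E0; rewrite subr_eq0 => /eqP <-; ring.
  by rewrite E0 bar0 => /eqP; rewrite mulf_eq0 !subr_eq0 (negPf thb) => /eqP.
have [a [b ->]] := L_span th0 thb x; move=> /(vg_span th0 thb)[a0 b0].
have tA : vg 0 t%:A by rewrite vg_base.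
have aA : vg 0 a%:A by rewrite vg_base.
have bA : vg 0 b%:A by rewrite vg_base.
have ct0 : vg 0 (t%:A - th) by rewrite vgB.
rewrite !bthE cjD cjM !cj_alg cth; split; first by rewrite lf_valD // vgM0.
rewrite !lf_redD ?vgM0 // barD !lf_redM // barM !uq_bar_fix // bth.
by rewrite redB.
Qed.

Lemma cj_integral (x : L) : vg 0 x -> vg 0 (cj x).
Proof. by case/cj_integral_red. Qed.

Lemma red_cj (x : L) : vg 0 x -> red (cj x) = bar (red x).
Proof. by case/cj_integral_red. Qed.

Lemma lf_val_cj (x : L) : lf_val (uq_ext E) (cj x) = lf_val (uq_ext E) x.
Proof.
have [->|x0] := eqVneq x 0; first by rewrite cj0.
have cx0 : cj x != 0 by rewrite cj_eq0.
have ge (y : L) : y != 0 -> 0 <= lf_val (uq_ext E) y -> 0 <= lf_val (uq_ext E) (cj y).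
  by move=> y0; rewrite -!vgE ?cj_eq0 //; apply: cj_integral.
(* [cj] inverts [y]; as it preserves integrality, neither [y] nor [y^-1] can have positive
   valuation. *)
pose y := cj x / x; have y0 : y != 0 by rewrite mulf_neq0 ?invr_neq0.
have cyE : cj y = y^-1 by rewrite /y cjM cjV cjK invf_div.
have := ge _ y0; have := ge _ (invr_neq0 y0).
rewrite cjV cyE invrK lf_valV // => h1 h2.
have : lf_val (uq_ext E) y = 0 by lia.
by rewrite lf_valM ?invr_neq0 // lf_valV //; lia.
Qed.

Lemma vg_cj m (x : L) : vg m (cj x) = vg m x.
Proof. by rewrite /val_ge cj_eq0 lf_val_cj. Qed.

Lemma vg_norm m (x : L) : vg (m + m) (x * cj x) = vg m x.
Proof.
have [->|x0] := eqVneq x 0; first by rewrite mul0r !val_ge0.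
by rewrite !vgE ?mulf_neq0 ?cj_eq0 // lf_valM ?cj_eq0 // lf_val_cj; lia.
Qed.

(** Norms have even valuation, which gains one over the odd bound [2 m - 1]. *)
Lemma vg_norm_odd m (x : L) : vg (m + m - 1) (x * cj x) -> vg m x.
Proof.
have [->|x0] := eqVneq x 0; first by rewrite val_ge0.
by rewrite !vgE ?mulf_neq0 ?cj_eq0 // lf_valM ?cj_eq0 // lf_val_cj; lia.
Qed.

Lemma trace_neq0 : exists z : kL, z + bar z != 0.
Proof.
apply/existsP; apply: contraT => /existsPn z0.
have {}z0 z : bar z = - z.
  by have := z0 z; rewrite negbK addrC addr_eq0 => /eqP.
have [x] := uq_bar_neq E; rewrite z0.
by have := z0 1; rewrite bar1 => E1; rewrite -[x]mul1r -mulNr -E1 eqxx.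
Qed.

(** An integral substitute for [1/2], which residue characteristic [2] does not offer. *)
Lemma tau_ex : exists2 tau : L, vg 0 tau & tau + cj tau = 1.
Proof.
have [z z0] := trace_neq0; have [w w0 wz] := lf_red_surj (uq_ext E) z.
have tr0 : vg 0 (w + cj w) by rewrite lf_valD // vg_cj.
have [|trn0 trv] := lf_unitE (E := uq_ext E) tr0.
  by rewrite lf_redD ?vg_cj // red_cj // wz.
exists (w / (w + cj w)).
  by rewrite vgM0 // vg_inv // trv.
rewrite cjM cjV cjD cjK [cj w + w]addrC; field; done.
Qed.

(** Lagrange resolvent: if [z + y * bar z] vanished for all [z], then [z = 1] would give [y = -1],
    and [bar] would be the identity. *)
Lemma Hilbert90 (y : kL) : y * bar y = 1 -> exists2 c, c != 0 & y = c / bar c.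
Proof.
move=> yy.
have [z z0] : exists z, z + y * bar z != 0.
  apply/existsP; apply: contraT => /existsPn z0.
  have {}z0 z : z + y * bar z = 0 by have := z0 z; rewrite negbK => /eqP.
  have := z0 1; rewrite bar1 mulr1 => /eqP; rewrite addrC addr_eq0 => /eqP yE.
  have [x] := uq_bar_neq E; have := z0 x; rewrite yE mulN1r => /eqP.
  by rewrite subr_eq0 => /eqP <-; rewrite eqxx.
exists (z + y * bar z) => //; apply: (canRL (mulfK _)); first by rewrite bar_eq0.
by rewrite barD barM barK mulrDr mulrA yy mul1r addrC.
Qed.

Lemma unit_lift (x : kL) : x != 0 -> exists w : L, [/\ w != 0, lf_val (uq_ext E) w = 0 & red w = x].
Proof.
move=> x0; have [w w0 wx] := lf_red_surj (uq_ext E) x.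
have [|w1 w2] := lf_unitE (E := uq_ext E) w0; first by rewrite wx.
by exists w.
Qed.

(** Written as [c / bar c], the element lifts to [w / cj w], which has norm exactly one for any lift
    [w] of [c]. *)
Lemma norm1_lift (y : kL) : y * bar y = 1 -> exists w : L,
  [/\ w * cj w = 1, vg 0 w & red w = y].
Proof.
move=> /Hilbert90[c c0 ->]; have [w [w0 wv wc]] := unit_lift c0.
have cw0 : cj w != 0 by rewrite cj_eq0.
have w00 : vg 0 w by rewrite vgE ?wv.
exists (w / cj w); split.
- by rewrite cjM cjV cjK; field; rewrite w0.
- by rewrite vgM0 // vg_inv // lf_val_cj wv.
by rewrite lf_redM ?vg_inv ?lf_val_cj ?wv // redV ?lf_val_cj // wc red_cj // wc.
Qed.

(* The lift of [y] is corrected by an element of trace [y + cj y + x cj x]. *)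
Lemma root_lift (x y : kL) : y + bar y + x * bar x = 0 -> exists w : L * L,
  [/\ w.2 + cj w.2 + w.1 * cj w.1 = 0, vg 0 w.1 /\ vg 0 w.2, red w.1 = x, red w.2 = y &
      x = 0 -> w.1 = 0].
Proof.
move=> xy; have [u [u0 ux ux0]] : exists u, [/\ vg 0 u, red u = x & x = 0 -> u = 0].
  have [x0|x0] := eqVneq x 0; first by exists 0; rewrite val_ge0 lf_red0 x0.
  by have [u u0 ux] := lf_red_surj (uq_ext E) x; exists u; split=> // /eqP; rewrite (negPf x0).
have [w w0 wy] := lf_red_surj (uq_ext E) y; have [tau t0 tr] := tau_ex.
pose e := w + cj w + u * cj u.
have ce : cj e = e by rewrite /e !(cjD, cjM) !cjK; ring.
have e1 : vg 1 e.
  rewrite -red_eq0; last by rewrite !lf_valD ?vgM0 ?vg_cj.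
  by rewrite !lf_redD ?lf_redM ?red_cj ?lf_valD ?vgM0 ?vg_cj // ux wy xy.
have te1 : vg 1 (e * tau) by rewrite vgMr0.
have te0 : vg 0 (e * tau) by apply: vgW te1.
exists (u, w - e * tau); split=> //=.
- rewrite cjB cjM ce; have -> : w - e * tau + (cj w - e * cj tau) + u * cj u =
    e - e * (tau + cj tau) by rewrite /e; ring.
  by rewrite tr mulr1 subrr.
- by split=> //; rewrite vgB.
rewrite redB // wy; have /eqP -> : red (e * tau) == 0 by rewrite red_eq0.
by rewrite subr0.
Qed.

Lemma uniformizer : exists w : L, [/\ w != 0, lf_val (uq_ext E) w = 1 & cj w = w].
Proof.
have [a a0 a1] := lf_val_unif (uq_base E); exists a%:A.
by rewrite scaler_eq0 oner_eq0 orbF a0 cj_alg uq_val.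
Qed.

Lemma bar_fixed_card : #|[set x : kL | bar x == x]| = q.
Proof.
have [f [f_inj _ fE]] := base_imageE.
under eq_finset => x do rewrite barE.
by rewrite -fE card_imset // cardsT.
Qed.

Lemma norm_fixed (x : kL) : bar (x * bar x) = x * bar x.
Proof. by rewrite barM barK mulrC. Qed.

Lemma norm_fibre_le (c : kL) : (#|[set x : kL | (x * bar x == c)%R]| <= q.+1)%N.
Proof.
set S := [set _ | _]; pose P : {poly kL} := 'X^(q.+1) - c%:P.
have Psize : size P = q.+2.
  by rewrite size_polyDl size_polyXn // size_polyN (leq_ltn_trans (size_polyC_leq1 _)).
have P0 : P != 0 by rewrite -size_poly_eq0 Psize.
rewrite cardE -ltnS -Psize.
apply: max_poly_roots P0 _ (enum_uniq _); apply/allP => x.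
rewrite mem_enum inE barE => /eqP xc.
by rewrite /root !hornerE exprS xc subrr.
Qed.

(** The [q^2 - 1] nonzero elements fall into at most [q - 1] fibres, each of size at most [q + 1];
    equality of the totals forces equality in every fibre. *)
Lemma norm_fibre_card (c : kL) : c != 0 -> bar c = c ->
  #|[set x : kL | x * bar x == c]| = q.+1.
Proof.
pose A := [pred d : kL | (d != 0) && (bar d == d)].
have cardA : #|A| = q.-1.
  rewrite -[q]bar_fixed_card (cardsD1 0) inE bar0 eqxx /= -[RHS]cardsE.
  by apply: eq_card => d; rewrite !inE.
have fib_le d : d \in A -> (#|[set x : kL | (x * bar x == d)%R]| <= q.+1
    ?= iff (#|[set x : kL | (x * bar x == d)%R]| == q.+1))%N.
  by move=> _; split=> //; apply: norm_fibre_le.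
have [_] := leqif_sum fib_le.
have -> : (\sum_(d in A) #|[set x : kL | (x * bar x == d)%R]|)%N = (q ^ 2).-1.
  rewrite -(uq_res E); transitivity #|[set~ (0 : kL)]|; last by rewrite cardsC1.
  rewrite -sum1_card [RHS](partition_big (fun x => x * bar x) A) => /= [|x].
    apply: eq_bigr => d /andP[d0 _]; rewrite -sum1_card; apply: eq_bigl => x.
    rewrite !inE; have [xd|_] := eqVneq (x * bar x) d; rewrite ?andbF // andbT.
    by apply/esym; apply: contraNneq d0 => x0; rewrite -xd x0 mul0r.
  by rewrite !inE norm_fixed eqxx andbT => x0; rewrite mulf_neq0 ?bar_eq0.
rewrite sum_nat_const cardA => /esym eqT c0 cb.
have E1 : ((q ^ 2).-1 == q.-1 * q.+1)%N.
  by have := q_gt1; case: (q) => // m _; apply/eqP; rewrite -mulnn /=; lia.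
rewrite E1 in eqT; have /forallP/(_ c) := eqT; rewrite inE c0 cb eqxx /=.
by move/eqP.
Qed.

Lemma norm_surj (c : kL) : c != 0 -> bar c = c -> exists2 x, x != 0 & x * bar x = c.
Proof.
move=> c0 cb; have : (0 < #|[set x : kL | (x * bar x == c)%R]|)%N by rewrite norm_fibre_card.
case/card_gt0P => x; rewrite inE => /eqP xc; exists x => //.
by apply: contraNneq c0 => x0; rewrite -xc x0 mul0r.
Qed.

Lemma trace0_card : #|[set y : kL | y + bar y == 0]| = q.
Proof.
have [x xb] := uq_bar_neq E; pose c := bar x - x.
have c0 : c != 0 by rewrite subr_eq0.
have cb : bar c = - c by rewrite /c barB barK opprB.
transitivity #|[set c * z | z in [set z : kL | bar z == z]]|; last first.
  by rewrite card_imset ?bar_fixed_card //; apply: mulfI.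
apply: eq_card => y.
apply/idP/imsetP => [|[z]]; rewrite inE; [move=> /eqP y0 | move=> /eqP bz ->]; last first.
  by rewrite inE barM bz cb mulNr subrr.
exists (y / c); last by rewrite mulrC divfK.
rewrite inE barM barV cb invrN mulrN -mulNr; apply/eqP; congr (_ / _).
by apply/eqP; rewrite eqr_oppLR -addr_eq0 addrC y0.
Qed.

(** * Counts in characteristic [p] *)

Section Counting.
Variables (R : fieldType) (p : nat).
Hypotheses (char_k : p \in [pchar k]) (char_R : p \in [pchar R]).

Lemma q_eq0 : q%:R = 0 :> R.
Proof.
have [n qE] : exists n, q = (p ^ n)%N by eexists; apply: (card_pprimeChar char_k).
have : (0 < n)%N by case: n qE q_gt1 => // ->.
by case: n qE => // n -> _; rewrite expnS natrM (pcharf0 char_R) mul0r.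
Qed.

(** Over [y] of trace zero only [x = 0] occurs; over any other [y] there are [q + 1] values of [x],
    a number equal to [1] in [R]. *)
Lemma sum_roots (g : kL -> R) :
  \sum_(w : kL * kL | w.2 + bar w.2 + w.1 * bar w.1 == 0) g w.2 = \sum_y g y.
Proof.
rewrite (partition_big snd predT) //=; apply: eq_bigr => y _.
transitivity (\sum_(x | x * bar x == - (y + bar y)) g y).
  rewrite (reindex_onto (fun x : kL => (x, y)) fst) /= => [|w /andP[_ /eqP <-]].
    by apply: eq_bigl => x; rewrite !eqxx !andbT -addr_eq0 addrC.
  by case: w.
rewrite sumr_const -cardsE; have [y0|y0] := eqVneq (y + bar y) 0.
  rewrite y0 oppr0; have -> : [set x : kL | x * bar x == 0] = [set 0].
    by apply/setP => x; rewrite !inE mulf_eq0 bar_eq0 orbb.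
  by rewrite cards1.
by rewrite norm_fibre_card ?oppr_eq0 // ?barN ?barD ?barK 1?addrC // mulrSr -mulr_natl q_eq0 mul0r add0r.
Qed.

Lemma sum_roots_const (c : R) :
  \sum_(w : kL * kL | w.2 + bar w.2 + w.1 * bar w.1 == 0) c = 0.
Proof.
rewrite (sum_roots (fun=> c)) sumr_const (uq_res E) -mulr_natl natrX q_eq0.
by rewrite expr0n mul0r.
Qed.

Lemma sum_trace0_const (c : R) : \sum_(y : kL | y + bar y == 0) c = 0.
Proof. by rewrite sumr_const -cardsE trace0_card -mulr_natl q_eq0 mul0r. Qed.

Lemma card_torus :
  #|[pred w : kL * kL | (w.1 != 0) && (w.2 * bar w.2 == 1)]|%:R != 0 :> R.
Proof.
have -> : #|[pred w : kL * kL | (w.1 != 0) && (w.2 * bar w.2 == 1)]| =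
    ((q ^ 2).-1 * q.+1)%N.
  rewrite -(uq_res E) -(cardsC1 (0 : kL)) -(norm_fibre_card (oner_neq0 _) bar1).
  rewrite -cardsX -[RHS]cardsE; apply: eq_card => w; rewrite !inE //.
have q2 : (0 < q ^ 2)%N by rewrite expn_gt0 (ltnW q_gt1).
rewrite natrM mulrSr q_eq0 add0r mulr1 -subn1 natrB // natrX q_eq0 expr0n sub0r.
by rewrite oppr_eq0 oner_eq0.
Qed.

End Counting.
End Unramified.

(** * Coordinates on the unitary group *)

Notation o0 := (@Ordinal 3 0 isT).
Notation o1 := (@Ordinal 3 1 isT).
Notation o2 := (@Ordinal 3 2 isT).

Section Matrix3.
Variable R : nzRingType.

Definition mx3 (a b c d e f g h i : R) : 'M[R]_3 :=
  \matrix_(r, s) nth 0 (nth [::] [:: [:: a; b; c]; [:: d; e; f]; [:: g; h; i]] r) s.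

Lemma ord3P (P : 'I_3 -> Prop) : P o0 -> P o1 -> P o2 -> forall i, P i.
Proof.
move=> P0 P1 P2 [[|[|[|//]]] i3]; first by rewrite (_ : Ordinal i3 = o0) //; apply: val_inj.
  by rewrite (_ : Ordinal i3 = o1) //; apply: val_inj.
by rewrite (_ : Ordinal i3 = o2) //; apply: val_inj.
Qed.

Lemma mx3E (A : 'M[R]_3) : A = mx3 (A o0 o0) (A o0 o1) (A o0 o2)
  (A o1 o0) (A o1 o1) (A o1 o2) (A o2 o0) (A o2 o1) (A o2 o2).
Proof.
by apply/matrixP; elim/ord3P; elim/ord3P; rewrite mxE.
Qed.

Lemma sum_ord3 (F : 'I_3 -> R) : \sum_i F i = F o0 + F o1 + F o2.
Proof.
rewrite (bigD1 o0) //= (bigD1 o1) //= (bigD1 o2) //= big1 ?addr0 ?addrA //.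
by elim/ord3P.
Qed.

Lemma mx3M a b c d e f g h i a' b' c' d' e' f' g' h' i' :
  mx3 a b c d e f g h i *m mx3 a' b' c' d' e' f' g' h' i' =
  mx3 (a * a' + b * d' + c * g') (a * b' + b * e' + c * h') (a * c' + b * f' + c * i')
      (d * a' + e * d' + f * g') (d * b' + e * e' + f * h') (d * c' + e * f' + f * i')
      (g * a' + h * d' + i * g') (g * b' + h * e' + i * h') (g * c' + h * f' + i * i').
Proof.
by apply/matrixP; elim/ord3P; elim/ord3P; rewrite !mxE sum_ord3 !mxE.
Qed.

Lemma mx3_1 : mx3 1 0 0 0 1 0 0 0 1 = 1%:M.
Proof. by apply/matrixP; elim/ord3P; elim/ord3P; rewrite !mxE. Qed.

Lemma trmx3 a b c d e f g h i :
  (mx3 a b c d e f g h i)^T = mx3 a d g b e h c f i.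
Proof. by apply/matrixP; elim/ord3P; elim/ord3P; rewrite !mxE. Qed.

End Matrix3.

Lemma map_mx3 (R S : nzRingType) (phi : {rmorphism R -> S}) a b c d e f g h i :
  map_mx phi (mx3 a b c d e f g h i) =
  mx3 (phi a) (phi b) (phi c) (phi d) (phi e) (phi f) (phi g) (phi h) (phi i).
Proof. by apply/matrixP; elim/ord3P; elim/ord3P; rewrite !mxE. Qed.

Lemma det_mx3 (R : comNzRingType) (a b c d e f h i j : R) : \det (mx3 a b c d e f h i j) =
  a * (e * j - f * i) - b * (d * j - f * h) + c * (d * i - e * h).
Proof.
rewrite (expand_det_row _ o0) sum_ord3 /cofactor !(expand_det_row _ ord0).
rewrite !big_ord_recl !big_ord0 /cofactor !det_mx11 !mxE /=.
rewrite !expr0 !expr1; ring.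
Qed.

Section Coordinates.
Variables (K : fieldType) (L : fieldExtType K) (k kL : finFieldType).
Variable E : unramified_quadratic L k kL.
Variables (V : hermitian_space E) (C : chamber V).
Local Notation v := (lf_val (uq_ext E)).
Local Notation vg := (val_ge (lf_val (uq_ext E))).
Local Notation red := (lf_red (uq_ext E)).
Local Notation bar := (uq_bar E).
Local Notation cj := (uq_conj E).
Local Notation q := #|k|.
Local Notation I := (proIwahori C).
Local Notation cm := (coordmx C).
Implicit Types (g h : unitary V) (A : 'M[L]_3).

Definition antidiag : 'M[L]_3 := mx3 0 0 1 0 1 0 1 0 0.

Definition isom A : Prop := adjmx E A *m antidiag *m A = antidiag.

Lemma adjmx3 (a b c d e f g h i : L) : adjmx E (mx3 a b c d e f g h i) =
  mx3 (cj a) (cj d) (cj g) (cj b) (cj e) (cj h) (cj c) (cj f) (cj i).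
Proof. by rewrite /adjmx map_mx3 trmx3. Qed.

Lemma frame_gramE : adjmx E (frame C) *m gram V *m frame C = frame_scale C *: antidiag.
Proof.
rewrite frame_gram; congr (_ *: _).
by apply/matrixP; elim/ord3P; elim/ord3P; rewrite !mxE.
Qed.

Lemma adjmx_inv A : A \in unitmx -> adjmx E (invmx A) = invmx (adjmx E A).
Proof. by move=> _; rewrite /adjmx map_invmx trmx_inv. Qed.

Lemma isometry_isom (g : 'M[L]_3) :
  is_isometry V g <-> isom (invmx (frame C) *m g *m frame C).
Proof.
have FU := frame_unit C; set F := frame C in FU *.
have aFU : adjmx E F \in unitmx by rewrite unitmx_tr map_unitmx.
have e0 := frame_scale_neq0 C.
pose M := invmx (adjmx E F) *m antidiag *m invmx F.
have HE : gram V = frame_scale C *: M.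
  rewrite /M scalemxAl scalemxAr -frame_gramE -/F !mulmxA mulVmx // mul1mx.
  by rewrite mulmxK.
have gE : adjmx E (invmx F *m g *m F) *m antidiag *m (invmx F *m g *m F) =
    adjmx E F *m (adjmx E g *m M *m g) *m F.
  by rewrite !adjmxM adjmx_inv // /M !mulmxA.
have ME : adjmx E F *m M *m F = antidiag.
  by rewrite /M !mulmxA mulmxV // mul1mx mulmxKV.
rewrite /is_isometry /isom gE HE -scalemxAr -scalemxAl -ME; split=> [/eqP|] gI.
  by rewrite (scalerI e0 gI).
apply/eqP; congr (_ *: _).
apply: (can_inj (mulKmx aFU)); apply: (can_inj (mulmxK FU)).
by rewrite gI.
Qed.

Lemma coordmx_isom g : isom (cm g).
Proof. by have /isometry_isom := uvalP g. Qed.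

(** A matrix that is no isometry of the antidiagonal form gets the default value [1]. *)
Definition ofmx A : unitary V := insubd (1%g : unitary V) (frame C *m A *m invmx (frame C)).

Lemma ofmxK A : isom A -> cm (ofmx A) = A.
Proof.
move=> AI; have FU := frame_unit C.
have FA : invmx (frame C) *m (frame C *m A *m invmx (frame C)) *m frame C = A.
  by rewrite !mulmxA mulVmx // mul1mx mulmxKV.
rewrite /coordmx /ofmx insubdK ?FA //.
by apply/isometry_isom; rewrite FA.
Qed.

Lemma coordmx_inj : injective cm.
Proof.
have FU := frame_unit C; have FVU : invmx (frame C) \in unitmx by rewrite unitmx_inv.
move=> g h gh; apply: val_inj; apply: (can_inj (mulKmx FVU)).
exact: (can_inj (mulmxK FU)).
Qed.

Lemma coordmxV g : cm g^-1%g = antidiag *m adjmx E (cm g) *m antidiag.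
Proof.
have JJ : antidiag *m antidiag = 1%:M :> 'M[L]_3.
  by rewrite mx3M -mx3_1; congr mx3; ring.
have : antidiag *m adjmx E (cm g) *m antidiag *m cm g = 1%:M.
  by have := coordmx_isom g; rewrite /isom -!mulmxA => ->; rewrite JJ.
move/(congr1 (fun B => B *m cm g^-1%g)).
by rewrite -mulmxA -coordmxM mulgV coordmx1 mulmx1 mul1mx => <-.
Qed.

(** The monomial isometries; [b] tells whether the reflection of the finite Weyl group occurs. *)
Definition mN (b : bool) (a c : L) : 'M[L]_3 :=
  if b then mx3 0 0 a 0 c 0 (cj a)^-1 0 0 else mx3 a 0 0 0 c 0 0 0 (cj a)^-1.

(** Elements of the two opposite unipotent radicals, once [y + cj y + x * cj x = 0]. *)
Definition uU (x y : L) : 'M[L]_3 := mx3 1 x y 0 1 (- cj x) 0 0 1.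
Definition uL (x y : L) : 'M[L]_3 := mx3 1 0 0 x 1 0 y (- cj x) 1.

Lemma mN_isom b a c : a != 0 -> c * cj c = 1 -> isom (mN b a c).
Proof.
move=> a0 cc; have ca0 : cj a != 0 by rewrite cj_eq0.
rewrite /isom /mN; case: b; rewrite adjmx3 !mx3M !cj0 cjV cjK; congr mx3;
  rewrite ?(mulr0, mul0r, add0r, addr0, mulr1, mul1r) ?mulVf ?mulfV //;
  by rewrite mulrC.
Qed.

Lemma uU_isom x y : y + cj y + x * cj x = 0 -> isom (uU x y).
Proof.
move=> xy; rewrite /isom adjmx3 !mx3M !cj0 !cj1 cjN cjK; congr mx3;
  rewrite ?(mulr0, mul0r, add0r, addr0, mulr1, mul1r) ?subrr ?addNr //.
by rewrite -[RHS]xy; ring.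
Qed.

Lemma uL_isom x y : y + cj y + x * cj x = 0 -> isom (uL x y).
Proof.
move=> xy; rewrite /isom adjmx3 !mx3M !cj0 !cj1 cjN cjK; congr mx3;
  rewrite ?(mulr0, mul0r, add0r, addr0, mulr1, mul1r) ?subrr ?addNr //.
by rewrite -[RHS]xy; ring.
Qed.

Lemma mN_mul b a c b' a' c' : a != 0 -> a' != 0 ->
  mN b a c *m mN b' a' c' =
  mN (b (+) b') (a * (if b then (cj a')^-1 else a')) (c * c').
Proof.
move=> a0 a'0; have ca0 : cj a != 0 by rewrite cj_eq0.
have ca'0 : cj a' != 0 by rewrite cj_eq0.
rewrite /mN; case: b b' => -[] /=; rewrite !mx3M !cjM ?cjV ?cjK; congr mx3; field;
  by rewrite ?ca0 ?ca'0 ?a0 ?a'0.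
Qed.

(** The rank one identity behind both the Bruhat decomposition and the quadratic relation at [s1]:
    for [y != 0] an upper unipotent lies in the big cell of the opposite Borel subgroup. *)
Lemma uU_factor x y : y != 0 -> y + cj y + x * cj x = 0 ->
  uU x y = uL (- cj x / y) y^-1 *m mN true y (- cj y / y) *m uL (- cj x / cj y) y^-1.
Proof.
move=> y0 xy; have cy0 : cj y != 0 by rewrite cj_eq0.
rewrite /uU /uL /mN !mx3M !(cjN, cjM, cjV, cjK); congr mx3; try by field; rewrite ?y0 ?cy0.
  apply/eqP; rewrite -subr_eq0; apply/eqP.
  by transitivity ((y + cj y + x * cj x) / y); [field; rewrite ?y0 ?cy0 | rewrite xy mul0r].
apply/eqP; rewrite eq_sym -subr_eq0 subr0; apply/eqP.
transitivity ((y + cj y + x * cj x) / (y * cj y)); last by rewrite xy mul0r.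
by field; rewrite y0 cy0.
Qed.

Definition eU x y := ofmx (uU x y).
Definition eL x y := ofmx (uL x y).
Definition eN b a c := ofmx (mN b a c).

Lemma eUE x y : y + cj y + x * cj x = 0 -> cm (eU x y) = uU x y.
Proof. by move=> xy; rewrite ofmxK //; apply: uU_isom. Qed.

Lemma eLE x y : y + cj y + x * cj x = 0 -> cm (eL x y) = uL x y.
Proof. by move=> xy; rewrite ofmxK //; apply: uL_isom. Qed.

Lemma eNE b a c : a != 0 -> c * cj c = 1 -> cm (eN b a c) = mN b a c.
Proof. by move=> a0 cc; rewrite ofmxK //; apply: mN_isom. Qed.

Lemma coordmxVE g i j : cm g^-1%g i j = cj (cm g (rev_ord j) (rev_ord i)).
Proof.
rewrite coordmxV; move: (cm g) => A; rewrite {1}[A]mx3E adjmx3 !mx3M.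
by elim/ord3P: i; elim/ord3P: j; rewrite !mxE /= ?(mulr0, mul0r, add0r, addr0, mulr1, mul1r);
  congr (cj (A _ _)); apply: val_inj.
Qed.

Lemma parahoric1P g : reflect (forall i j, vg 0 (cm g i j)) (g \in parahoric C s1).
Proof.
apply: (iffP andP) => [[/forallP g1 _] i j|g0].
  by have /forallP/(_ j) := g1 i.
split; apply/forallP => i; apply/forallP => j; first exact: g0.
by rewrite coordmxVE vg_cj; apply: g0.
Qed.

Definition inI (A : 'M[L]_3) : bool :=
  [&& vg 1 (A o0 o0 - 1), vg 0 (A o0 o1), vg 0 (A o0 o2),
      vg 1 (A o1 o0), vg 1 (A o1 o1 - 1), vg 0 (A o1 o2),
      vg 1 (A o2 o0), vg 1 (A o2 o1) & vg 1 (A o2 o2 - 1)].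

Lemma vg1_unit x : vg 1 (x - 1) -> [/\ x != 0, v x = 0, vg 0 x & red x = 1].
Proof.
move=> x1; have x0 : vg 0 x.
  by rewrite -(subrK 1 x) lf_valD ?val_ge1 //; apply: vgW x1.
have rx : red x = 1 by apply/red1P.
by have [|] := lf_unitE x0; rewrite ?rx ?oner_eq0.
Qed.

Lemma mem_proI g : (g \in I) = inI (cm g).
Proof.
apply/proIwahoriP/idP => [[/parahoric1P g0 gU]|/and5P[a0 b0 c0 d0 /and5P[e0 f0 h0 i0 j0]]].
  have r1 i : vg 1 (cm g i i - 1).
    by apply/red1P => //; have := gU i i (leqnn _); rewrite redmxE eqxx.
  have r0 (i j : 'I_3) : (j < i)%N -> vg 1 (cm g i j).
    move=> ji; rewrite -red_eq0 // -redmxE gU 1?ltnW //.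
    by rewrite -(inj_eq val_inj) gtn_eqF.
  by rewrite /inI !r1 !r0 // !g0.
have g0 : forall i j, vg 0 (cm g i j).
  have [_ _ a1 _] := vg1_unit a0; have [_ _ e1 _] := vg1_unit e0; have [_ _ j1 _] := vg1_unit j0.
  by elim/ord3P; elim/ord3P => //; apply: (vgW (m := 1)).
split; first exact/parahoric1P.
have [_ _ _ a1] := vg1_unit a0; have [_ _ _ e1] := vg1_unit e0; have [_ _ _ j1] := vg1_unit j0.
by elim/ord3P; elim/ord3P => // _; rewrite redmxE //=; apply/eqP; rewrite red_eq0.
Qed.

(** The pair [(b, m)] is the class of [g] in [N/Z_0], an infinite dihedral group with the law of
    [isNM]. *)
Definition isN (b : bool) (m : int) g : Prop := exists a c,
  [/\ a != 0, v a = m, c * cj c = 1 & cm g = mN b a c].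

Lemma norm1_val c : c * cj c = 1 -> [/\ c != 0, v c = 0 & vg 0 c].
Proof.
move=> cc; have c0 : c != 0 by apply: contraTneq isT => c0; move: cc; rewrite c0 mul0r => /eqP; rewrite eq_sym oner_eq0.
have := congr1 v cc; rewrite lf_valM ?cj_eq0 // lf_val_cj lf_val1 => vc.
have {}vc : v c = 0 by lia.
by rewrite vgE ?vc.
Qed.

Lemma norm1V c : c * cj c = 1 -> c^-1 = cj c.
Proof.
by move=> cc; have [c0 _ _] := norm1_val cc; apply: (mulfI c0); rewrite mulfV.
Qed.

Lemma isN1 : isN false 0 1%g.
Proof.
exists 1, 1; rewrite oner_neq0 lf_val1 cj1 mulr1; split=> //.
by rewrite coordmx1 -mx3_1 /mN cj1 invr1.
Qed.

Lemma isNM b m g b' m' h : isN b m g -> isN b' m' h ->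
  isN (b (+) b') (m + (if b then - m' else m')) (g * h)%g.
Proof.
move=> [a [c [a0 va cc gE]]] [a' [c' [a'0 va' cc' hE]]].
have ca'0 : cj a' != 0 by rewrite cj_eq0.
exists (a * (if b then (cj a')^-1 else a')), (c * c').
rewrite coordmxM gE hE mN_mul //; split=> //.
- by rewrite mulf_neq0 //; case: b {gE} => //; rewrite invr_neq0.
- case: b {gE}; rewrite lf_valM ?invr_neq0 // ?lf_valV // ?lf_val_cj va va' //.
by rewrite cjM mulrACA cc cc' mulr1.
Qed.

Lemma coordmxV_N b a c g : a != 0 -> c * cj c = 1 -> cm g = mN b a c ->
  cm g^-1%g = mN b (if b then cj a else a^-1) (cj c).
Proof.
move=> a0 cc gE; rewrite coordmxV gE /mN; case: b {gE};
  rewrite adjmx3 !mx3M !cj0 cjV cjK ?cjV;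
  by congr mx3; rewrite ?(mulr0, mul0r, add0r, addr0, mulr1, mul1r) // ?cjK ?invrK.
Qed.

Lemma isNV b m g : isN b m g -> isN b (if b then m else - m) g^-1%g.
Proof.
move=> [a [c [a0 va cc gE]]]; have ca0 : cj a != 0 by rewrite cj_eq0.
exists (if b then cj a else a^-1), (cj c); split.
- by case: b {gE}; rewrite ?invr_neq0.
- by case: b {gE}; rewrite ?lf_val_cj ?lf_valV // va.
- by rewrite cjK mulrC.
exact: coordmxV_N.
Qed.

Lemma vg1V x : x != 0 -> vg 1 (x - 1) -> vg 1 (x^-1 - 1).
Proof.
move=> x0 /[dup] x1 /vg1_unit[_ vx _ _].
have -> : x^-1 - 1 = - ((x - 1) * x^-1) by field.
by rewrite vgN; apply: vgMr0 => //; rewrite vg_inv // vx.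
Qed.

Lemma vg1VE x : x != 0 -> vg 1 (x^-1 - 1) = vg 1 (x - 1).
Proof.
by move=> x0; apply/idP/idP => [/vg1V|/vg1V]; rewrite ?invrK ?invr_neq0 //; apply.
Qed.

Lemma vg1cj x : vg 1 (cj x - 1) = vg 1 (x - 1).
Proof. by rewrite -[RHS]vg_cj cjB cj1. Qed.

Lemma mem_proI_N a c a' c' w w' b : a != 0 -> a' != 0 -> c * cj c = 1 -> c' * cj c' = 1 ->
  cm w = mN b a c -> cm w' = mN b a' c' ->
  (w^-1 * w' \in I)%g = vg 1 (a' / a - 1) && vg 1 (c' / c - 1).
Proof.
move=> a0 a'0 cc cc' wE w'E.
have ca0 : cj a != 0 by rewrite cj_eq0.
have ca'0 : cj a' != 0 by rewrite cj_eq0.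
have [c0 _ _] := norm1_val cc.
have aca0 : a' / a != 0 by rewrite mulf_neq0 ?invr_neq0.
rewrite mem_proI coordmxM (coordmxV_N a0 cc wE) w'E mN_mul //; last by case: (b); rewrite ?invr_neq0.
rewrite addbb /inI /mN !mxE /= !val_ge0 /= -(norm1V cc) [c^-1 * c']mulrC.
case: b {wE w'E}.
  have -> : cj a * (cj a')^-1 = (cj (a' / a))^-1 by rewrite cjM cjV invf_div.
  by rewrite cjV cjK invrK vg1VE ?cj_eq0 // vg1cj andbCA andbb andbC.
by rewrite [a^-1 * a']mulrC vg1VE ?cj_eq0 // vg1cj andbCA andbb andbC.
Qed.

Lemma unit_ratio u w x x' : vg 1 (u - 1) -> vg 1 (w - 1) -> x != 0 -> x' != 0 ->
  u * x' = x * w -> v x = v x' /\ vg 1 (x' / x - 1).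
Proof.
move=> /[dup] u1 /vg1_unit[u0 vu _ _] /[dup] w1 /vg1_unit[w0 vw _ _] x0 x'0 E0; split.
  have := congr1 v E0; rewrite !lf_valM // vu vw; lia.
have -> : x' / x = w / u by apply: (mulfI u0); rewrite mulrA E0; field; rewrite u0.
have -> : w / u - 1 = (w - u) * u^-1 by field.
apply: vgMr0; last by rewrite vg_inv // vu.
by have -> : w - u = (w - 1) - (u - 1) by [ring]; apply: vgB.
Qed.

Lemma unit_absorb m u w x x' : vg 1 (u - 1) -> vg m w -> x != 0 -> x' != 0 ->
  u * x' = x * w -> v x + m <= v x'.
Proof.
move=> /vg1_unit[u0 vu _ _] wm x0 x'0 E0.
have w0 : w != 0.
  by apply: contraTneq (mulf_neq0 u0 x'0) => w0; rewrite E0 w0 mulr0 eqxx.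
have := congr1 v E0; rewrite !lf_valM // vu; move: wm; rewrite vgE //; lia.
Qed.

(* Comparing entries on both sides of [u w' = w u'] recovers the valuations
   and the reductions of the monomial matrix [w]. *)
Lemma isN_uniq b m w b' m' w' u u' : isN b m w -> isN b' m' w' ->
  u \in I -> u' \in I -> (u * w' = w * u')%g -> [/\ b = b', m = m' & (w^-1 * w')%g \in I].
Proof.
move=> [a [c [a0 va cc wE]]] [a' [c' [a'0 va' cc' w'E]]].
move=> uI u'I /(congr1 cm); rewrite mem_proI in uI; rewrite mem_proI in u'I.
rewrite !coordmxM.
move: (cm u) (cm u') uI u'I => A B AI BI; rewrite wE w'E [A]mx3E [B]mx3E => E0.
have ca0 : (cj a)^-1 != 0 by rewrite invr_neq0 ?cj_eq0.
have ca'0 : (cj a')^-1 != 0 by rewrite invr_neq0 ?cj_eq0.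
have vca : v (cj a)^-1 = - v a by rewrite lf_valV ?cj_eq0 // lf_val_cj.
have vca' : v (cj a')^-1 = - v a' by rewrite lf_valV ?cj_eq0 // lf_val_cj.
have [c0 vc _] := norm1_val cc; have [c'0 vc' _] := norm1_val cc'.
move: AI BI; move=> /and5P[u00 u01 u02 u10 /and5P[u11 u12 u20 u21 u22]].
move=> /and5P[w00 w01 w02 w10 /and5P[w11 w12 w20 w21 w22]].
have entry i j := congr1 (fun A : 'M[L]_3 => A i j) E0; move: entry.
have simp := (mulr0, mul0r, add0r, addr0).
rewrite /mN; case: b wE {E0} => wE; case: b' w'E => w'E; rewrite !mx3M => entry.
- have := entry o0 o2; have := entry o1 o1; rewrite !mxE /= !simp.
  move=> /(unit_ratio u11 w11 c0 c'0)[_ c1] /(unit_ratio u00 w22 a0 a'0)[vaa a1].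
  by rewrite -va -va' vaa (mem_proI_N a0 a'0 cc cc' wE w'E) a1 c1.
(* For different [b], an antidiagonal entry of [u'] above the diagonal is integral and the opposite
   one lies in the maximal ideal: the resulting bounds on [v a] and [v a'] conflict. *)
- have := entry o0 o0; have := entry o2 o2; rewrite !mxE /= !simp.
  move=> /(unit_absorb u22 w02 ca0 ca'0); rewrite vca vca' => h1.
  by move=> /(unit_absorb u00 w20 a0 a'0) h2; exfalso; move: h1 h2; clear; lia.
- have := entry o0 o2; have := entry o2 o0; rewrite !mxE /= !simp.
  move=> /(unit_absorb u22 w20 ca0 ca'0); rewrite vca vca' => h1.
  by move=> /(unit_absorb u00 w02 a0 a'0) h2; exfalso; move: h1 h2; clear; lia.
have := entry o0 o0; have := entry o1 o1; rewrite !mxE /= !simp.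
move=> /(unit_ratio u11 w11 c0 c'0)[_ c1] /(unit_ratio u00 w00 a0 a'0)[vaa a1].
by rewrite -va -va' vaa (mem_proI_N a0 a'0 cc cc' wE w'E) a1 c1.
Qed.

End Coordinates.

(** * The Bruhat decomposition *)

Section Decomposition.
Variables (K : fieldType) (L : fieldExtType K) (k kL : finFieldType).
Variable E : unramified_quadratic L k kL.
Variables (V : hermitian_space E) (C : chamber V).
Local Notation v := (lf_val (uq_ext E)).
Local Notation vg := (val_ge (lf_val (uq_ext E))).
Local Notation red := (lf_red (uq_ext E)).
Local Notation bar := (uq_bar E).
Local Notation cj := (uq_conj E).
Local Notation I := (proIwahori C).
Local Notation cm := (coordmx C).
Implicit Types (g h : unitary V) (A : 'M[L]_3).
Local Notation eU := (eU C).
Local Notation eL := (eL C).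
Local Notation eN := (eN C).
Local Notation isN := (isN C).
Local Notation rel x y := (y + cj y + x * cj x = 0).

(** The relation bounds the norm of [x] by [y], so that unipotent elements are placed in [I] by
    looking at [y] alone. *)
Lemma rel_vg_even x y m : rel x y -> vg (m + m) y -> vg m x.
Proof.
move=> xy ym; rewrite -vg_norm; have -> : x * cj x = - (y + cj y).
  by rewrite -[RHS]addr0 -xy; ring.
by rewrite vgN lf_valD ?vg_cj.
Qed.

Lemma rel_vg_odd x y m : rel x y -> vg (m + m - 1) y -> vg m x.
Proof.
move=> xy ym; apply: vg_norm_odd; have -> : x * cj x = - (y + cj y).
  by rewrite -[RHS]addr0 -xy; ring.
by rewrite vgN lf_valD ?vg_cj.
Qed.

Lemma eU_proI x y : rel x y -> vg 0 y -> eU x y \in I.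
Proof.
move=> xy y0; have x0 : vg 0 x by apply: (rel_vg_even (y := y)); rewrite ?addr0.
by rewrite mem_proI eUE // /inI !mxE /= subrr !val_ge0 vgN vg_cj x0 y0.
Qed.

Lemma eL_proI x y : rel x y -> vg 1 y -> eL x y \in I.
Proof.
move=> xy y1; have x1 : vg 1 x by apply: (rel_vg_odd (y := y)); rewrite ?addrK.
by rewrite mem_proI eLE // /inI !mxE /= subrr !val_ge0 vgN vg_cj x1 y1.
Qed.

Lemma rel_scale x y s : rel x y -> rel (x * s) (y * (s * cj s)).
Proof.
by move=> xy; rewrite !cjM cjK -[RHS](mul0r (s * cj s)) -xy; ring.
Qed.

Lemma rel_flip x y s : rel x y -> rel (- cj x * s) (y * (s * cj s)).
Proof.
by move=> xy; rewrite !(cjM, cjN, cjK) -[RHS](mul0r (s * cj s)) -xy; ring.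
Qed.

Lemma conj_eq w g g' : (g * w = w * g')%g -> (w^-1 * g * w)%g = g'.
Proof. by move=> gw; rewrite -mulgA gw mulKg. Qed.

Lemma vg_scale m y s : s != 0 -> vg m (y * (s * cj s)) = vg (m - v s - v s) y.
Proof.
move=> s0; have [->|y0] := eqVneq y 0; first by rewrite mul0r !val_ge0.
have cs0 : cj s != 0 by rewrite cj_eq0.
by rewrite !vgE ?mulf_neq0 // !lf_valM ?mulf_neq0 // lf_val_cj; lia.
Qed.

(** Conjugation multiplies [y] by a norm of valuation [- 2 m]; for [b] true it also turns upper
    unipotents into lower ones, for which [I] requires one more unit of valuation. *)
Lemma conjU_proI b m w x y : isN b m w -> rel x y ->
  vg (m + m + (b : nat)%:R) y -> (w^-1 * eU x y * w)%g \in I.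
Proof.
move=> [a [c [a0 va cc wE]]] xy ym.
have ca0 : cj a != 0 by rewrite cj_eq0.
have [c0 vc _] := norm1_val cc; have ccE : cj c = c^-1 by rewrite (norm1V cc).
case: b ym wE => ym wE.
  pose s := c^-1 / cj a; have s0 : s != 0 by rewrite mulf_neq0 ?invr_neq0.
  have vs : v s = - m by rewrite lf_valM ?invr_neq0 // !lf_valV // lf_val_cj vc va; lia.
  have xy' := rel_flip s xy.
  have -> : (w^-1 * eU x y * w)%g = eL (- cj x * s) (y * (s * cj s)).
    apply: conj_eq; apply: (@coordmx_inj _ _ _ _ _ _ C).
    rewrite !coordmxM wE (eUE _ xy) (eLE _ xy') /mN /uU /uL !mx3M.
    rewrite /s !(cjM, cjN, cjV, cjK) ccE.
    by congr mx3; field; rewrite ?a0 ?c0 ?ca0 ?oner_neq0.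
  by apply: (eL_proI xy'); rewrite vg_scale // vs; apply: vgW ym; lia.
pose s := c / a; have s0 : s != 0 by rewrite mulf_neq0 ?invr_neq0.
have vs : v s = - m by rewrite lf_valM ?invr_neq0 // !lf_valV // vc va; lia.
have xy' := rel_scale s xy.
have -> : (w^-1 * eU x y * w)%g = eU (x * s) (y * (s * cj s)).
  apply: conj_eq; apply: (@coordmx_inj _ _ _ _ _ _ C).
  rewrite !coordmxM wE (eUE _ xy) (eUE _ xy') /mN /uU /uL !mx3M.
  rewrite /s !(cjM, cjN, cjV, cjK) ccE.
  by congr mx3; field; rewrite ?a0 ?c0 ?ca0 ?oner_neq0.
by apply: (eU_proI xy'); rewrite vg_scale // vs; apply: vgW ym; rewrite /=; lia.
Qed.

Lemma conjL_proI b m w x y : isN b m w -> rel x y ->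
  vg ((~~ b : nat)%:R - m - m) y -> (w^-1 * eL x y * w)%g \in I.
Proof.
move=> [a [c [a0 va cc wE]]] xy ym.
have ca0 : cj a != 0 by rewrite cj_eq0.
have [c0 vc _] := norm1_val cc; have ccE : cj c = c^-1 by rewrite (norm1V cc).
case: b ym wE => ym wE.
  pose s := cj a * c; have s0 : s != 0 by rewrite mulf_neq0.
  have vs : v s = m by rewrite lf_valM // lf_val_cj vc va; lia.
  have xy' := rel_flip s xy.
  have -> : (w^-1 * eL x y * w)%g = eU (- cj x * s) (y * (s * cj s)).
    apply: conj_eq; apply: (@coordmx_inj _ _ _ _ _ _ C).
    rewrite !coordmxM wE (eLE _ xy) (eUE _ xy') /mN /uU /uL !mx3M.
    rewrite /s !(cjM, cjN, cjV, cjK) ccE.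
    by congr mx3; field; rewrite ?a0 ?c0 ?ca0 ?oner_neq0.
  by apply: (eU_proI xy'); rewrite vg_scale // vs; apply: vgW ym; rewrite /=; lia.
pose s := a / c; have s0 : s != 0 by rewrite mulf_neq0 ?invr_neq0.
have vs : v s = m by rewrite lf_valM ?invr_neq0 // !lf_valV // vc va; lia.
have xy' := rel_scale s xy.
have -> : (w^-1 * eL x y * w)%g = eL (x * s) (y * (s * cj s)).
  apply: conj_eq; apply: (@coordmx_inj _ _ _ _ _ _ C).
  rewrite !coordmxM wE (eLE _ xy) (eLE _ xy') /mN /uU /uL !mx3M.
  rewrite /s !(cjM, cjN, cjV, cjK) ccE.
  by congr mx3; field; rewrite ?a0 ?c0 ?ca0 ?oner_neq0.
by apply: (eL_proI xy'); rewrite vg_scale // vs; apply: vgW ym; rewrite /=; lia.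
Qed.

Lemma rel_inv x y : y != 0 -> rel x y -> rel (- cj x / y) y^-1 /\ rel (- cj x / cj y) y^-1.
Proof.
move=> y0 xy; have cy0 : cj y != 0 by rewrite cj_eq0.
by split; rewrite !(cjM, cjN, cjV, cjK) -(mul0r (y * cj y)^-1) -xy; field; rewrite y0 cy0.
Qed.

Lemma norm1_opp y : y != 0 -> (- cj y / y) * cj (- cj y / y) = 1.
Proof.
move=> y0; have cy0 : cj y != 0 by rewrite cj_eq0.
by rewrite !(cjM, cjN, cjV, cjK); field; rewrite y0 cy0.
Qed.

Lemma eU_factor x y : y != 0 -> rel x y ->
  eU x y = (eL (- cj x / y) y^-1 * eN true y (- cj y / y) * eL (- cj x / cj y) y^-1)%g.
Proof.
move=> y0 xy; have [xy1 xy2] := rel_inv y0 xy; apply: (@coordmx_inj _ _ _ _ _ _ C).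
rewrite !coordmxM (eUE _ xy) (eLE _ xy1) (eLE _ xy2) eNE ?norm1_opp //.
exact: uU_factor.
Qed.

Lemma isom_entries (a b c d e f g h i : L) : isom E (mx3 a b c d e f g h i) ->
  [/\ cj a * g + cj d * d + cj g * a = 0,
      cj a * h + cj d * e + cj g * b = 0 &
      cj a * i + cj d * f + cj g * c = 1] /\
  [/\ cj b * h + cj e * e + cj h * b = 1,
      cj b * i + cj e * f + cj h * c = 0 &
      cj c * i + cj f * f + cj i * c = 0].
Proof.
rewrite /isom adjmx3 !mx3M => E0.
have entry r s := congr1 (fun A : 'M[L]_3 => A r s) E0.
have simp := (mulr0, mul0r, add0r, addr0, mulr1, mul1r).
have := entry o0 o0; have := entry o0 o1; have := entry o0 o2.
have := entry o1 o1; have := entry o1 o2; have := entry o2 o2.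
rewrite !mxE /= !simp => E22 E12 E11 E02 E01 E00.
split; split.
- by rewrite -[RHS]E00; ring.
- by rewrite -[RHS]E01; ring.
- by rewrite -[RHS]E02; ring.
- by rewrite -[RHS]E11; ring.
- by rewrite -[RHS]E12; ring.
by rewrite -[RHS]E22; ring.
Qed.

(** [g] stabilises the isotropic line of [e_1], hence lies in a Borel subgroup; the isometry
    equations give the remaining entries. *)
Lemma upper_unitary g : cm g o1 o0 = 0 -> cm g o2 o0 = 0 ->
  exists a c x y, [/\ a != 0, c * cj c = 1, rel x y & g = (eN false a c * eU x y)%g].
Proof.
have AI := coordmx_isom C g; rewrite [cm g]mx3E in AI.
move=> d0 h0; have := mx3E (cm g); move/isom_entries: AI; move: d0 h0.
move: (cm g o0 o0) (cm g o0 o1) (cm g o0 o2) (cm g o1 o0) (cm g o1 o1) (cm g o1 o2)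
  (cm g o2 o0) (cm g o2 o1) (cm g o2 o2) => a b c d e f h i j.
move=> d0 h0 [[_ E01 E02] [E11 E12 E22]] gE.
have a0 : a != 0.
  apply: contraTneq isT => a0; move: E02.
  by rewrite a0 d0 h0 cj0 !mul0r !addr0 => /eqP; rewrite eq_sym oner_eq0.
have ca0 : cj a != 0 by rewrite cj_eq0.
have jE : j = (cj a)^-1.
  by apply: (mulfI ca0); rewrite divff // -E02 d0 h0 cj0 !mul0r !addr0.
have i0 : i = 0.
  by apply: (mulfI ca0); rewrite mulr0 -E01 d0 h0 cj0 !mul0r !addr0.
have ee : e * cj e = 1.
  by rewrite mulrC -E11 i0 cj0 mul0r mulr0 add0r addr0.
have [e0 _ _] := norm1_val ee; have ceE := norm1V ee.
have fE : f = - cj b * e / cj a.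
  apply: (mulfI (x := cj e)); first by rewrite cj_eq0.
  move: E12; rewrite i0 cj0 mul0r addr0 jE -ceE => E12.
  apply/eqP; rewrite -subr_eq0; apply/eqP; rewrite -E12; field.
  by rewrite e0 ca0.
have xy : rel (b / a) (c / a).
  have cjE : cj e = e^-1 by rewrite ceE.
  rewrite -(mulr0 (1 : L)) -E22 jE fE !(cjM, cjN, cjV, cjK) cjE; field.
  by rewrite e0 a0 ca0.
exists a, e, (b / a), (c / a); split=> //.
apply: (@coordmx_inj _ _ _ _ _ _ C); rewrite coordmxM eNE // eUE // gE d0 h0 i0 jE fE.
rewrite /mN /uU !mx3M !(cjM, cjV); congr mx3; field; rewrite ?a0 ?ca0 //.
Qed.

Lemma isN_eN b m a c : a != 0 -> v a = m -> c * cj c = 1 -> isN b m (eN b a c).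
Proof. by move=> a0 va cc; exists a, c; split; rewrite // eNE. Qed.

Lemma one_norm1 : (1 : L) * cj 1 = 1.
Proof. by rewrite cj1 mulr1. Qed.

(* The first column [(a, b, c)] of [g] is isotropic, so that the valuation of
   [b] is at least half the sum of those of [a] and [c], and [I] contains the
   unipotent elements which clear it with the pivot [a] or [c]. *)
Lemma clear_column g : exists2 u, u \in I &
  cm (u * g)%g o1 o0 = 0 /\ (cm (u * g)%g o2 o0 = 0 \/ cm (u * g)%g o0 o0 = 0).
Proof.
have AI := coordmx_isom C g; rewrite [cm g]mx3E in AI.
have := mx3E (cm g); move/isom_entries: AI.
move: (cm g o0 o0) (cm g o0 o1) (cm g o0 o2) (cm g o1 o0) (cm g o1 o1) (cm g o1 o2)
  (cm g o2 o0) (cm g o2 o1) (cm g o2 o2) => a a1 a2 b b1 b2 c c1 c2.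
move=> [[E0 _ E1] _] gE.
have [/andP[c0 ca]|ca] := boolP ((c != 0) && vg (v c) a).
  have cc0 : cj c != 0 by rewrite cj_eq0.
  have r : rel (cj b / cj c) (cj a / cj c).
    rewrite !(cjM, cjV, cjK) -(mul0r (c * cj c)^-1) -E0; field.
    by rewrite c0 cc0.
  exists (eU (cj b / cj c) (cj a / cj c)).
    apply: eU_proI => //; apply: (vgMl (m := v c) (n := - v c)); rewrite ?subrr ?vg_cj //.
    by rewrite vg_inv // lf_val_cj; lia.
  rewrite coordmxM (eUE _ r) gE mx3M !mxE /= !(cjM, cjV, cjK).
  split; first by field; rewrite ?c0.
  right; rewrite -(mul0r (cj c)^-1) -E0; field.
  by rewrite cc0.
have a0 : a != 0.
  apply: contraTneq isT => a0; move: ca E0; rewrite a0 val_ge0 andbT negbK => /eqP c0.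
  rewrite c0 cj0 !mul0r addr0 add0r => /eqP; rewrite mulf_eq0 cj_eq0 orbb => /eqP b0.
  by move: E1; rewrite a0 b0 c0 cj0 !mul0r !addr0 => /eqP; rewrite eq_sym oner_eq0.
have ca0 : cj a != 0 by rewrite cj_eq0.
have vac : vg (v a + 1) c.
  have [->|c0] := eqVneq c 0; first by rewrite val_ge0.
  by move: ca; rewrite c0 !vgE //=; lia.
have r : rel (- b / a) (cj c / cj a).
  rewrite !(cjM, cjN, cjV, cjK) -(mul0r (a * cj a)^-1) -E0; field.
  by rewrite a0 ca0.
exists (eL (- b / a) (cj c / cj a)).
  apply: eL_proI => //; apply: (vgMl (m := v a + 1) (n := - v a)); rewrite ?vg_cj //.
    by rewrite addrAC subrr.
  by rewrite vg_inv // lf_val_cj; lia.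
rewrite coordmxM (eLE _ r) gE mx3M !mxE /= !(cjM, cjN, cjV, cjK).
split; first by field; rewrite ?a0.
left; rewrite -(mul0r (cj a)^-1) -E0; field.
by rewrite ca0.
Qed.

Lemma antidiag_mulE A : (antidiag L *m A) o1 o0 = A o1 o0 /\ (antidiag L *m A) o2 o0 = A o0 o0.
Proof. by rewrite !mxE !sum_ord3 !mxE /= !mul0r !mul1r !add0r !addr0. Qed.

Lemma iwasawa g : exists u w b m x y,
  [/\ u \in I, isN b m w, rel x y & g = (u * w * eU x y)%g].
Proof.
have [u uI [h1 h2]] := clear_column g.
pose J := eN true 1 1.
have J0 : isN true 0 J by apply: isN_eN; rewrite ?oner_neq0 ?lf_val1 ?one_norm1.
case: h2 => h2.
  have [a [c [x [y [a0 cc xy gE]]]]] := upper_unitary h1 h2.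
  exists u^-1%g, (eN false a c), false, (v a), x, y.
  split; [exact: memV | exact: isN_eN | exact: xy |].
  by apply: (mulgI u); rewrite gE; gsimp.
have JE : cm (J * (u * g))%g = antidiag L *m cm (u * g)%g.
  rewrite coordmxM eNE ?oner_neq0 ?one_norm1 //.
  by rewrite /mN cj1 invr1.
have [||a [c [x [y [a0 cc xy gE]]]]] := @upper_unitary (J * (u * g))%g.
- by rewrite JE (antidiag_mulE _).1.
- by rewrite JE (antidiag_mulE _).2.
have wN := isNM (isNV J0) (isN_eN false a0 (erefl _) cc).
exists u^-1%g, (J^-1 * eN false a c)%g, true, (0 - v a), x, y.
split; [exact: memV | exact: wN | exact: xy |].
by apply: (mulgI u); apply: (mulgI J); rewrite gE; gsimp.
Qed.

(** The unipotent factor of the Iwasawa decomposition is absorbed on the left if [y] is small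
    enough, on the right if it is integral. If both tests fail, [y^-1] is so small that the two
    lower factors of the rank one identity are absorbed, one on each side. *)
Lemma bruhat g : exists u w b m u', [/\ u \in I, u' \in I, isN b m w & g = (u * w * u')%g].
Proof.
have [u [w [b [m [x [y [uI wN xy ->]]]]]]] := iwasawa g.
have wVN := isNV wN; pose m' := if b then m else - m; rewrite -/m' in wVN.
have [y1|y1] := boolP (vg (m' + m' + (b : nat)%:R) y).
  have hI := conjU_proI wVN xy y1; rewrite invgK in hI.
  exists (u * (w * eU x y * w^-1))%g, w, b, m, 1%g.
  by split; [exact: (memM uI hI) | exact: gpred1 | exact: wN | gsimp].
have y0 : y != 0 by apply: contraNneq y1 => ->; rewrite val_ge0.
have [r1 r2] := rel_inv y0 xy; have nn := norm1_opp y0.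
rewrite vgE // -ltNge in y1.
have y2 : vg ((~~ b : nat)%:R - m' - m') y^-1.
  by rewrite vg_inv //; move: y1; rewrite /m'; case: (b) => /=; lia.
have hI := conjL_proI wVN r1 y2; rewrite invgK in hI.
have [y3|y3] := boolP (vg 0 y).
  by exists u, w, b, m, (eU x y); split; [exact: uI | exact: eU_proI | exact: wN |].
rewrite vgE // -ltNge in y3.
exists (u * (w * eL (- cj x / y) y^-1 * w^-1))%g, (w * eN true y (- cj y / y))%g,
  (b (+) true), (m + (if b then - v y else v y)), (eL (- cj x / cj y) y^-1).
split; first exact: (memM uI hI).
- by apply: (eL_proI r2); rewrite vg_inv //; lia.
- exact: isNM wN (isN_eN true y0 (erefl _) nn).
by rewrite (eU_factor y0 xy); gsimp.
Qed.

End Decomposition.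

(** * Admissible lifts *)

Section AdmissibleLifts.
Variables (K : fieldType) (L : fieldExtType K) (k kL : finFieldType).
Variable E : unramified_quadratic L k kL.
Variables (V : hermitian_space E) (C : chamber V).
Local Notation v := (lf_val (uq_ext E)).
Local Notation vg := (val_ge (lf_val (uq_ext E))).
Local Notation red := (lf_red (uq_ext E)).
Local Notation bar := (uq_bar E).
Local Notation cj := (uq_conj E).
Local Notation I := (proIwahori C).
Local Notation cm := (coordmx C).
Implicit Types (g : unitary V) (A : 'M[L]_3).
Local Notation eU := (eU C).
Local Notation eL := (eL C).
Local Notation eN := (eN C).
Local Notation isN := (isN C).
Local Notation rel x y := (y + cj y + x * cj x = 0).

Lemma split_torusP t : split_torus C t <->
  exists2 a : K, a != 0 & cm t = mx3 a%:A 0 0 0 1 0 0 0 (a%:A)^-1.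
Proof.
have dE (a : K) : a != 0 -> diag_mx (\row_(j < 3) [:: a%:A; 1; (a^-1)%:A]`_j) =
    mx3 a%:A 0 0 0 1 0 0 0 (a%:A)^-1 :> 'M[L]_3.
  move=> a0; apply/matrixP; elim/ord3P; elim/ord3P; rewrite !mxE /= ?mulr1n //.
  by rewrite -!in_algE fmorphV.
by split=> -[a a0 tE]; exists a; rewrite // tE dE.
Qed.

Lemma diag_centraliser g a e i : cm g = mx3 a 0 0 0 e 0 0 0 i -> torus_centraliser C g.
Proof.
move=> gE t /split_torusP[b b0 tE]; apply: (@coordmx_inj _ _ _ _ _ _ C).
by rewrite !coordmxM gE tE !mx3M; congr mx3; ring.
Qed.

Lemma coordmx_entries g : exists a b c d e f h i j,
  cm g = mx3 a b c d e f h i j /\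
  [/\ cj a * h + cj d * d + cj h * a = 0,
      cj a * i + cj d * e + cj h * b = 0 &
      cj a * j + cj d * f + cj h * c = 1] /\
  [/\ cj b * i + cj e * e + cj i * b = 1,
      cj b * j + cj e * f + cj i * c = 0 &
      cj c * j + cj f * f + cj j * c = 0].
Proof.
have AI := coordmx_isom C g; rewrite [cm g]mx3E in AI.
by do 9!eexists; split; [apply: mx3E | apply: isom_entries AI].
Qed.

(** The test element [t] has eigenvalues [w], [1], [w^-1] for a uniformiser [w], distinct in every
    characteristic, so [g] permutes the coordinate lines; not centralising, it swaps the two
    isotropic ones. *)
Lemma normaliser_antidiag g : torus_normaliser C g -> ~ torus_centraliser C g ->
  exists x c, [/\ x != 0, c * cj c = 1 & cm g = mN E true x c].
Proof.
move=> gN gC.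
have [w w0 vw] := lf_val_unif (uq_base E).
have A0 : w%:A != 0 :> L by rewrite scaler_eq0 oner_eq0 orbF.
have vA : v w%:A = 1 by rewrite uq_val.
have cA : cj w%:A = w%:A by apply: cj_alg.
have tI : isom E (mx3 w%:A 0 0 0 1 0 0 0 (w%:A)^-1).
  by have := mN_isom (E := E) false A0 (one_norm1 E); rewrite /mN cA.
have tE := ofmxK C tI; set t := ofmx C _ in tE.
have /gN/split_torusP[b b0 bE] : split_torus C t by apply/split_torusP; exists w.
have B0 : b%:A != 0 :> L by rewrite scaler_eq0 oner_eq0 orbF.
move: (w%:A) (b%:A) A0 vA cA tE bE B0 => al be A0 vA cA tE bE B0.
have al1 : al != 1 by apply: contraTneq isT => al1; move: vA; rewrite al1 lf_val1.
have al2 : al * al != 1.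
  apply: contraTneq isT => al2; have := congr1 v al2; rewrite lf_valM // vA lf_val1; lia.
have : (g * t = (g * t * g^-1) * g)%g by gsimp.
move/(congr1 cm); rewrite coordmxM [in RHS]coordmxM bE tE.
have [a1 [b1 [c1 [d [e [f [h [i [j [gE [[E00 E01 E02] [E11 E12 E22]]]]]]]]]]]] :=
  coordmx_entries g.
rewrite gE => E0.
have entry r s := congr1 (fun A : 'M[L]_3 => A r s) E0.
have simp := (mulr0, mul0r, add0r, addr0, mulr1, mul1r).
have := entry o0 o0; have := entry o0 o1; have := entry o0 o2.
have := entry o1 o0; have := entry o1 o2.
have := entry o2 o0; have := entry o2 o1; have := entry o2 o2.
rewrite !mx3M !mxE /= !simp => F22 F21 F20 F12 F10 F02 F01 F00 {entry E0}.
(* In [g t = t' g] with [t] and [t'] diagonal, an entry of [g] vanishes unless the two eigenvalues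
   it links agree. *)
have zero (s x y : L) : s * x = y * s -> x != y -> s = 0.
  move=> sxy xy; apply/eqP; move/eqP: sxy; rewrite mulrC -subr_eq0 -mulrBl mulf_eq0.
  by rewrite subr_eq0 (negPf xy).
have alV1 : al^-1 != 1 by rewrite invr_eq1.
have alV : al^-1 != al by apply: contraNneq al2 => alE; rewrite -{1}alE mulVf.
have d0 : d = 0 by apply: (zero _ al 1); rewrite ?mul1r.
have f0 : f = 0 by apply: (zero _ al^-1 1); rewrite ?mul1r.
have [be_al|be_al] := eqVneq be al.
  case: gC; apply: (@diag_centraliser _ a1 e j).
  have b0' : b1 = 0 by apply: (zero _ 1 be); rewrite ?mulr1 // be_al eq_sym.
  have c0 : c1 = 0 by apply: (zero _ al^-1 be) => //; rewrite be_al.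
  have h0 : h = 0 by apply: (zero _ al be^-1) => //; rewrite be_al eq_sym.
  have i0 : i = 0 by apply: (zero _ 1 be^-1); rewrite ?mulr1 // be_al eq_sym.
  by rewrite gE b0' c0 d0 f0 h0 i0.
have a0 : a1 = 0 by apply: (zero _ al be) => //; rewrite eq_sym.
have hc : cj h * c1 = 1 by rewrite -E02 a0 d0 cj0 !mul0r !add0r.
have h0 : h != 0.
  by apply: contraTneq isT => h0; move: hc; rewrite h0 cj0 mul0r => /eqP; rewrite eq_sym oner_eq0.
have ch0 : cj h != 0 by rewrite cj_eq0.
have beE : be = al^-1.
  have : al == be^-1 by apply: contraNT h0 => /(zero _ _ _ F20) ->.
  by move=> /eqP ->; rewrite invrK.
have b10 : b1 = 0 by apply: (zero _ 1 be); rewrite ?mulr1 // beE eq_sym.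
have i0 : i = 0 by apply: (zero _ 1 be^-1); rewrite ?mulr1 // beE invrK eq_sym.
have j0 : j = 0 by apply: (zero _ al^-1 be^-1) => //; rewrite beE invrK.
exists c1, e; split.
- by apply: contraTneq isT => c0; move: hc; rewrite c0 mulr0 => /eqP; rewrite eq_sym oner_eq0.
- by rewrite mulrC -E11 b10 i0 cj0 !mul0r add0r addr0.
rewrite a0 b10 d0 f0 i0 j0 /mN; congr mx3.
have c1E : c1 = (cj h)^-1 by apply: (mulfI ch0); rewrite hc mulfV.
by rewrite c1E cjV cjK invrK.
Qed.

Lemma vg1M x y : vg 1 (x - 1) -> vg 1 (y - 1) -> vg 1 (x * y - 1).
Proof.
move=> x1 y1; have [_ _ y0 _] := vg1_unit y1.
have -> : x * y - 1 = (x - 1) * y + (y - 1) by ring.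
by apply: lf_valD => //; apply: vgMr0.
Qed.

Lemma det_proI g : g \in I -> vg 1 (\det (cm g) - 1).
Proof.
rewrite mem_proI; move: (cm g) => A.
move=> /and5P[a1 b0 c0 d1 /and5P[e1 f0 h1 i1 j1]]; rewrite [A]mx3E det_mx3.
have [_ _ e0 _] := vg1_unit e1; have [_ _ a0 _] := vg1_unit a1.
have [_ _ j0 _] := vg1_unit j1.
have D : vg 1 (A o0 o0 * (A o1 o1 * A o2 o2) - 1) by apply: vg1M => //; apply: vg1M.
set r := (X in vg 1 X); have -> : r = (A o0 o0 * (A o1 o1 * A o2 o2) - 1)
   - A o0 o0 * (A o1 o2 * A o2 o1) - A o0 o1 * (A o1 o0 * A o2 o2 - A o1 o2 * A o2 o0)
   + A o0 o2 * (A o1 o0 * A o2 o1 - A o1 o1 * A o2 o0) by rewrite /r; ring.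
apply: lf_valD; first apply: vgB; first apply: vgB => //.
- by do 2!apply: vgM0 => //.
- by apply: vgM0 => //; apply: vgB; [apply: vgMr0 | apply: vgM0].
apply: vgM0 => //; apply: vgB; last exact: vgM0.
by apply: vgMr0 => //; apply: vgW i1.
Qed.

Lemma parahoricE s g i j : g \in parahoric C s ->
  vg (vertex_exp s i - vertex_exp s j) (cm g i j).
Proof. by move=> /andP[/forallP/(_ i)/forallP/(_ j)]. Qed.

(** The lattice alone gives weaker bounds for the entries [(1, 0)] and [(1, 2)]; the sharp ones come
    from [g^-1], that is from the dual lattice. *)
Lemma parahoric_middle g : g \in parahoric C s2 ->
  [/\ vg 1 (cm g o1 o0), vg 0 (cm g o0 o1), vg 0 (cm g o1 o2) & vg 1 (cm g o2 o1)] /\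
  vg 0 (cm g o1 o1).
Proof.
move=> gP; have gVP := parahoricV gP.
have entryV i j : cm g i j = cj (cm g^-1%g (rev_ord j) (rev_ord i)).
  by rewrite coordmxVE cjK !rev_ordK.
split; last exact: (parahoricE o1 o1 gP).
split; last exact: (parahoricE o2 o1 gP).
- by rewrite entryV vg_cj; have := parahoricE (rev_ord o0) (rev_ord o1) gVP.
- exact: (parahoricE o0 o1 gP).
- by rewrite entryV vg_cj; have := parahoricE (rev_ord o2) (rev_ord o1) gVP.
Qed.

Lemma proI_parahoric s g : g \in I -> g \in parahoric C s.
Proof.
have half h : h \in I -> stab_lattice E (vertex_exp s) (cm h).
  rewrite mem_proI; move: (cm h) => A.
  move=> /and5P[a1 b0 c0 d1 /and5P[e1 f0 h1 i1 j1]].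
  have [_ _ e0 _] := vg1_unit e1; have [_ _ a0 _] := vg1_unit a1.
  have [_ _ j0 _] := vg1_unit j1.
  apply/forallP => i; apply/forallP => j; move: i j.
  by rewrite /vertex_exp; case: eqP => _; elim/ord3P; elim/ord3P => //=;
    apply: vgW; try eassumption.
by move=> gI; apply/andP; split; [exact: half gI | exact: (half _ (memV gI))].
Qed.

(** A concrete subgroup to which the last condition of [admissible_lift] is applied: reductions have
    determinant one and, for [s2], trivial component in [U(1)]. *)
Definition special s : {pred unitary V} := fun g =>
  [&& g \in parahoric C s, vg 1 (\det (cm g) - 1) & (s == s2) ==> vg 1 (cm g o1 o1 - 1)].

Fact special1 s : 1%g \in special s.
Proof.
apply/and3P; rewrite parahoric1 coordmx1 det1 subrr val_ge0; split=> //.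
by rewrite mxE eqxx subrr val_ge0 implybT.
Qed.

Fact specialM s : mulg_closed (special s).
Proof.
move=> g h /and3P[gP g1 gm] /and3P[hP h1 hm]; apply/and3P; split.
- exact: parahoricM.
- by rewrite coordmxM det_mulmx vg1M.
apply/implyP => /eqP sE; rewrite sE eqxx /= in gP hP gm hm.
have [[g10 _ g12 _] _] := parahoric_middle gP.
have [[_ h01 _ h21] _] := parahoric_middle hP.
rewrite coordmxM mxE sum_ord3.
move: (cm g o1 o0) (cm h o0 o1) (cm g o1 o1) (cm h o1 o1) (cm g o1 o2) (cm h o2 o1)
  g10 h01 gm hm g12 h21 => a a' b b' c c' a1 a'0 b1 b'1 c0 c'1.
have -> : a * a' + b * b' + c * c' - 1 = (b * b' - 1) + (a * a' + c * c') by ring.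
apply: lf_valD; first exact: vg1M.
by apply: lf_valD; [apply: vgMr0 | apply: vgM0].
Qed.

Fact specialV s : invg_closed (special s).
Proof.
move=> g /and3P[gP g1 gm]; apply/and3P; split; first exact: parahoricV.
  have [d0 _ _ _] := vg1_unit g1.
  have : \det (cm g^-1%g) * \det (cm g) = 1 by rewrite -det_mulmx -coordmxM mulVg coordmx1 det1.
  by move/(canRL (mulfK d0)) => ->; rewrite mul1r vg1V.
apply/implyP => sE; rewrite sE in gm; rewrite coordmxVE vg1cj.
by have -> : rev_ord o1 = o1 by apply: val_inj.
Qed.

HB.instance Definition _ s := isInvClosed.Build (unitary V) (special s) (@specialV s).
HB.instance Definition _ s := isMulClosed.Build (unitary V) (special s) (@specialM s).
HB.instance Definition _ s := isMul1Closed.Build (unitary V) (special s) (special1 s).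

(** Forced by [vertex_exp]: at [s2] the entry [x] has valuation at least [-1] and [(cj x)^-1] at
    least [1]. *)
Definition lift_val (s : 'I_2) : int := if s == s2 then -1 else 0.

Lemma admissible_liftP s g : admissible_lift C s g -> exists x c,
  [/\ x != 0, v x = lift_val s, c * cj c = 1 & cm g = mN E true x c] /\
  vg 1 (- (x * c / cj x) - 1) /\ (s = s2 -> vg 1 (c - 1)).
Proof.
move=> [gN gC gP gS]; have [x [c [x0 cc gE]]] := normaliser_antidiag gN gC.
have [c0 _ _] := norm1_val cc; have cx0 : cj x != 0 by rewrite cj_eq0.
have detg : \det (cm g) = - (x * c / cj x).
  by rewrite gE det_mx3; ring.
have gSP : g \in special s.
  apply: gS => u uI; have uS : u \in special s.
    apply/and3P; split; [exact: proI_parahoric | exact: det_proI |].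
    by move: uI; rewrite mem_proI => /and5P[_ _ _ _ /and5P[-> _ _ _ _]]; rewrite implybT.
  split=> //; have /and3P[uP u1 u2] := uS; apply/and3P; split.
  - by apply: parahoricM; [apply: parahoricM | apply: parahoricV].
  - rewrite !coordmxM !det_mulmx mulrAC -!det_mulmx -coordmxM mulgV coordmx1 mul1mx.
    exact: u1.
  apply/implyP => sE; rewrite sE /= in u2.
  rewrite !coordmxM (coordmxV_N x0 cc gE) gE [cm u]mx3E /mN !mx3M mxE /=.
  set y := cm u o1 o1 in u2 *; set r := (X in vg 1 (X - 1)).
  have -> : r = y * (c * cj c) by rewrite /r; ring.
  by rewrite cc mulr1.
have /and3P[_ d1 m1] := gSP; exists x, c; split; last first.
  split; first by rewrite -detg.
  by move=> sE; move: m1; rewrite sE /= gE mxE.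
split=> //; have := parahoricE o0 o2 gP; have := parahoricE o2 o0 gP.
rewrite gE !mxE /= vg_inv ?cj_eq0 // lf_val_cj vgE // /vertex_exp /lift_val /=.
by case: (s == s2) => /=; lia.
Qed.

(* The last condition of [admissible_lift] only enters through the reductions
   of the entries of [n s]. *)
Lemma admissible_s1 g : admissible_lift C s1 g -> exists x c,
  [/\ x != 0, v x = 0, c * cj c = 1, cm g = mN E true x c &
      red c = - bar (red x) / red x].
Proof.
move=> /admissible_liftP[x [c [[x0 vx cc gE] [d1 _]]]]; exists x, c; split=> //.
have [c0 vc cI] := norm1_val cc; have cx0 : cj x != 0 by rewrite cj_eq0.
have xI : vg 0 x by rewrite vgE ?vx.
have cxI : vg 0 (cj x)^-1 by rewrite vg_inv // lf_val_cj vx.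
have rx0 := red_unit x0 vx.
have [_ _ _] := vg1_unit d1; rewrite redN ?lf_redM ?vgM0 // redV ?lf_val_cj // red_cj //.
move=> r1; have bx0 : bar (red x) != 0 by rewrite bar_eq0.
apply: (mulfI rx0); apply: (mulIf (invr_neq0 bx0)); apply: oppr_inj; rewrite r1.
by field; rewrite rx0 bx0.
Qed.

(** Once [c] reduces to [1], the determinant condition makes [x / cj x] congruent to [-1]; scaled by
    a fixed uniformiser, [x] becomes a unit whose reduction has trace zero. *)
Lemma admissible_s2 g : admissible_lift C s2 g -> exists x c,
  [/\ x != 0, v x = -1, c * cj c = 1, cm g = mN E true x c & red c = 1] /\
  forall w, w != 0 -> v w = 1 -> cj w = w -> bar (red (x * w)) = - red (x * w).
Proof.
move=> /admissible_liftP[x [c [[x0 vx cc gE] [d1 /(_ erefl) c1]]]]; exists x, c.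
have [c0 vc cI rc] := vg1_unit c1; split=> // w w0 vw cw.
have cx0 : cj x != 0 by rewrite cj_eq0.
have xw0 : x * w != 0 by rewrite mulf_neq0.
have vxw : v (x * w) = 0 by rewrite lf_valM // vx vw.
have xwI : vg 0 (x * w) by rewrite vgE ?vxw.
rewrite -red_cj // -redN //; apply/red_eq; rewrite ?vgN ?vg_cj //.
have -> : cj (x * w) - - (x * w) =
    cj (x * w) * (- (c^-1 - 1) - c^-1 * (- (x * c / cj x) - 1)).
  by rewrite cjM cw; field; rewrite cx0 c0.
apply: vgM0; first by rewrite vg_cj.
apply: vgB; first by rewrite vgN; apply: vg1V.
by apply: vgM0 => //; rewrite vg_inv // vc.
Qed.

End AdmissibleLifts.

(** * Words in the admissible lifts *)

Section Monomial.
Variables (K : fieldType) (L : fieldExtType K) (k kL : finFieldType).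
Variable E : unramified_quadratic L k kL.
Variables (V : hermitian_space E) (C : chamber V).
Local Notation v := (lf_val (uq_ext E)).
Local Notation vg := (val_ge (lf_val (uq_ext E))).
Local Notation red := (lf_red (uq_ext E)).
Local Notation bar := (uq_bar E).
Local Notation cj := (uq_conj E).
Local Notation I := (proIwahori C).
Local Notation cm := (coordmx C).
Implicit Types (g : unitary V) (A : 'M[L]_3).
Local Notation eU := (eU C).
Local Notation eL := (eL C).
Local Notation eN := (eN C).
Local Notation isN := (isN C).
Local Notation rel x y := (y + cj y + x * cj x = 0).

Lemma ratio_red a b : a != 0 -> b != 0 -> v a = 0 -> v b = 0 ->
  vg 1 (a / b - 1) <-> red a = red b.
Proof.
move=> a0 b0 va vb; have aI : vg 0 a by rewrite vgE ?va.
have bI : vg 0 b by rewrite vgE ?vb.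
rewrite red_eq //.
have -> : a / b - 1 = (a - b) / b by field.
split=> [h|h]; last by apply: vgMr0 => //; rewrite vg_inv // vb.
have -> : a - b = (a - b) / b * b by rewrite divfK.
by apply: vgMr0 => //; rewrite vgE ?vb.
Qed.

Definition torus0 : {pred unitary V} := fun g => `[< isN false 0 g >].

Lemma torus0P g : reflect (isN false 0 g) (g \in torus0).
Proof. exact: asboolP. Qed.

Lemma isN_torus0 b m g z : isN b m g -> z \in torus0 -> isN b m (g * z)%g.
Proof.
move=> gN /torus0P zN; have := isNM gN zN; rewrite addbF.
by case: b {gN}; rewrite ?oppr0 addr0.
Qed.

Lemma torus0_proI z u : z \in torus0 -> u \in I -> (z * u * z^-1)%g \in I.
Proof.
move=> /torus0P[a [c [a0 va cc zE]]]; rewrite !mem_proI !coordmxM (coordmxV_N a0 cc zE) zE.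
move: (cm u) => A; move=> /and5P[a1 b0 c0 d1 /and5P[e1 f0 h1 i1 j1]].
have ca0 : cj a != 0 by rewrite cj_eq0.
have [cn0 vc cI] := norm1_val cc; have ccE : cj c = c^-1 by rewrite (norm1V cc).
have aI : vg 0 a by rewrite vgE ?va.
have aVI : vg 0 a^-1 by rewrite vg_inv ?va.
have caI : vg 0 (cj a) by rewrite vg_cj.
have caVI : vg 0 (cj a)^-1 by rewrite -cjV vg_cj.
have cVI : vg 0 c^-1 by rewrite -ccE vg_cj.
rewrite [A]mx3E /mN !mx3M cjV invrK ccE /inI !mxE /=.
have simp := (mulr0, mul0r, add0r, addr0).
have conj_unit (x y t : L) : x * y = 1 -> x * t * y = t by move=> xy; rewrite mulrAC xy mul1r.
rewrite !simp; apply/and5P; split; last (apply/and5P; split);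
  try by apply: vgMr0 => //; apply: vgM0.
- by rewrite conj_unit // mulfV.
- by rewrite conj_unit // mulfV.
by rewrite conj_unit // mulVf.
Qed.

Lemma torus0_1 : 1%g \in torus0.
Proof. by apply/torus0P; apply: isN1. Qed.

Lemma torus0_M z z' : z \in torus0 -> z' \in torus0 -> (z * z')%g \in torus0.
Proof. by move=> /torus0P zN z'Z; apply/torus0P/isN_torus0. Qed.

Lemma torus0_V z : z \in torus0 -> z^-1%g \in torus0.
Proof. by move=> /torus0P/isNV zN; apply/torus0P; rewrite oppr0 in zN. Qed.

(** Obtained from [isNM], the lifts having classes [(true, 0)] and [(true, -1)]. With the parity of
    the length it identifies words with pairs [(b, m)]: [s1] starts those with [m >= 0], [s2] those
    with [m <= 0]. *)
Definition wval (s : 'I_2) (l : nat) : int :=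
  if s == s1 then (l./2)%:Z else - (uphalf l)%:Z.

Lemma wval_surj b m : exists s l, odd l = b /\ wval s l = m.
Proof.
case: (leP 0 m) => m0; [exists s1, (b + `|m|.*2)%N | exists s2, (`|m|.*2 - b)%N].
  by rewrite /wval /= oddD odd_double addbF half_bit_double; case: b; split=> //; lia.
rewrite /wval /=; have -> : `|m|%N = `|m|.-1.+1 by lia.
by case: b; rewrite doubleS /= ?subn0 /= ?odd_double ?uphalf_double ?doubleK; split=> //; lia.
Qed.

Lemma wval_inj s l s' l' : odd l = odd l' -> wval s l = wval s' l' ->
  l = l' /\ (s = s' \/ l = 0%N).
Proof.
have uh m : uphalf m = (odd m + m./2)%N by rewrite uphalf_half.
have := odd_double_half l; have := odd_double_half l'; rewrite /wval !uh.
have [->|->] := rev_ordP s1 s; have [->|->] := rev_ordP s1 s' => /=.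
- by move=> h h' e1 e2; split; [lia | left].
- by move=> h h' e1 e2; have l0 : l = 0%N /\ l' = 0%N by [lia]; case: l0 => -> ->; split; [|right].
- by move=> h h' e1 e2; have l0 : l = 0%N /\ l' = 0%N by [lia]; case: l0 => -> ->; split; [|right].
by move=> h h' e1 e2; split; [lia | left].
Qed.

Section Lifts.
Variable n : 'I_2 -> unitary V.
Hypothesis n_adm : forall s, admissible_lift C s (n s).

Lemma n_isN s : isN true (lift_val s) (n s).
Proof.
by have [x [c [[x0 vx cc nE] _]]] := admissible_liftP (n_adm s); exists x, c.
Qed.

Lemma wd_isN s l : isN (odd l) (wval s l) (wd n s l).
Proof.
elim: l s => [|l IHl] s; first by have := isN1 C; rewrite /wval; case: ifP.
have := isNM (n_isN s) (IHl (rev_ord s)); rewrite addTb /= /lift_val /wval.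
by have [->|->] := rev_ordP s1 s; rewrite /= ?opprK ?add0r //; congr (isN _ _ _); lia.
Qed.

Lemma wd_torus0_isN s l z : z \in torus0 -> isN (odd l) (wval s l) (wd n s l * z)%g.
Proof. exact: isN_torus0 (wd_isN s l). Qed.

Lemma isN_same b m g h : isN b m g -> isN b m h -> (g^-1 * h)%g \in torus0.
Proof.
move=> gN hN; apply/torus0P; have := isNM (isNV gN) hN; rewrite addbb.
by case: b {gN hN}; rewrite ?subrr ?addNr.
Qed.

Lemma torus0_nZ s z : z \in torus0 -> (n s * z * (n s)^-1)%g \in torus0.
Proof.
move=> zZ; have := isN_same (isNV (n_isN s)) (isNV (isN_torus0 (n_isN s) zZ)).
by move/torus0_V; gsimp.
Qed.

Lemma torus0_nn s : (n s * n s)%g \in torus0.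
Proof. by apply/torus0P; have := isNM (n_isN s) (n_isN s); rewrite subrr. Qed.

Lemma bruhat_words g : exists s l z u u',
  [/\ z \in torus0, u \in I, u' \in I & g = (u * (wd n s l * z) * u')%g].
Proof.
have [u [w [b [m [u' [uI u'I wN ->]]]]]] := bruhat C g.
have [s [l [lb lm]]] := wval_surj b m; exists s, l, ((wd n s l)^-1 * w)%g, u, u'.
split=> //; last by gsimp.
by have wdN := wd_isN s l; rewrite lb lm in wdN; apply: isN_same wdN wN.
Qed.

Lemma words_disjoint s l z s' l' z' u u' : z \in torus0 -> z' \in torus0 ->
  u \in I -> u' \in I -> (wd n s l * z = u * (wd n s' l' * z') * u')%g ->
  [/\ l = l', s = s' \/ l = 0%N & (z'^-1 * z)%g \in I].
Proof.
move=> zZ z'Z uI u'I E0.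
have [|ll ss] := isN_uniq (wd_torus0_isN s l zZ) (wd_torus0_isN s' l' z'Z) uI (memV u'I).
  by rewrite E0; gsimp.
have {ll ss}[lE sE] := wval_inj ll ss; move=> wI; split; [exact: lE | exact: sE |].
have wE : wd n s l = wd n s' l' by case: sE => [->|l0]; rewrite -lE ?l0.
by rewrite -wE in wI; have := memV wI; gsimp.
Qed.

End Lifts.

End Monomial.

(** * The action of the generators *)

Section HeckeDatum.
Variables (K : fieldType) (L : fieldExtType K) (k kL : finFieldType).
Variable E : unramified_quadratic L k kL.
Variables (V : hermitian_space E) (C : chamber V).
Local Notation v := (lf_val (uq_ext E)).
Local Notation vg := (val_ge (lf_val (uq_ext E))).
Local Notation red := (lf_red (uq_ext E)).
Local Notation bar := (uq_bar E).
Local Notation cj := (uq_conj E).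
Local Notation I := (proIwahori C).
Local Notation cm := (coordmx C).
Implicit Types (g : unitary V) (A : 'M[L]_3).
Local Notation eU := (eU C).
Local Notation eL := (eL C).
Local Notation eN := (eN C).
Local Notation isN := (isN C).
Local Notation rel x y := (y + cj y + x * cj x = 0).
Local Notation torus0 := (torus0 C).

Lemma s12P (s : 'I_2) : s = s1 \/ s = s2.
Proof. by case: s => [[|[|//]] ?]; [left | right]; apply: val_inj. Qed.

(** The elements of [I] that conjugation by [(n s)^-1] keeps in [I]: those with trivial image in the
    unipotent radical attached to [s]. *)
Definition conj_lower s g : bool :=
  if s == s1 then [&& vg 1 (cm g o0 o1), vg 1 (cm g o0 o2) & vg 1 (cm g o1 o2)]
  else vg 2 (cm g o2 o0).

Lemma conj_proI s g h x c : x != 0 -> v x = lift_val s -> c * cj c = 1 -> cm h = mN E true x c ->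
  g \in I -> ((h^-1 * g * h)%g \in I) = conj_lower s g.
Proof.
move=> x0 vx cc hE; rewrite !mem_proI !coordmxM (coordmxV_N x0 cc hE) hE /conj_lower.
move: (cm g) => A /and5P[a1 b0 c0 d1 /and5P[e1 f0 h1 i1 j1]].
have cx0 : cj x != 0 by rewrite cj_eq0.
have [cn0 vc cI] := norm1_val cc; have ccE : cj c = c^-1 by rewrite (norm1V cc).
have vgunit (y t w : L) m : y != 0 -> w != 0 -> vg m (y * t * w) = vg (m - v y - v w) t.
  move=> y0 w0; have [->|t0] := eqVneq t 0; first by rewrite mulr0 mul0r !val_ge0.
  by rewrite !vgE ?mulf_neq0 // !lf_valM ?mulf_neq0 // -lerBlDr -lerBlDl addrAC.
have vcV : v c^-1 = 0 by rewrite lf_valV // vc.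
rewrite [A]mx3E /mN !mx3M cjK ccE /inI !mxE /=.
have simp := (mulr0, mul0r, add0r, addr0).
rewrite !simp.
have -> : cj x * A o2 o2 / cj x = A o2 o2 by field.
have -> : c^-1 * A o1 o1 * c = A o1 o1 by field.
have -> : x^-1 * A o0 o0 * x = A o0 o0 by field.
rewrite !vgunit ?invr_neq0 // vcV !lf_valV // lf_val_cj vc vx a1 e1 j1 /= andbT.
rewrite /lift_val; have [->|->] := s12P s; rewrite /= !(subr0, opprK, sub0r, addrK, add0r).
  rewrite (vgW _ h1) // (vgW _ d1) // (vgW _ i1) //=; case: (vg 1 (A o1 o2)) => //=.
    by rewrite !andbT andbC.
  by rewrite !andbF.
rewrite i1 d1 /=.
by rewrite !subrr f0 b0 (vgW _ c0) //= !andbT.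
Qed.

Lemma eUV x y : rel x y -> (eU x y)^-1%g = eU (- x) (cj y).
Proof.
move=> xy; have xy' : rel (- x) (cj y) by rewrite cjK cjN mulrNN [cj y + y]addrC.
have -> : eU (- x) (cj y) = ((eU x y)^-1 * (eU x y * eU (- x) (cj y)))%g by gsimp.
suff -> : (eU x y * eU (- x) (cj y))%g = 1%g by rewrite mulg1.
apply: (@coordmx_inj _ _ _ _ _ _ C).
rewrite coordmxM (eUE _ xy) (eUE _ xy') coordmx1 -mx3_1 /uU mx3M cjN; congr mx3; try ring.
by rewrite -xy; ring.
Qed.

Lemma eLV y : rel 0 y -> (eL 0 y)^-1%g = eL 0 (- y).
Proof.
move=> xy; have xy' : rel 0 (- y).
  by move: xy; rewrite !mul0r !addr0 cjN -opprD => ->; rewrite oppr0.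
have -> : eL 0 (- y) = ((eL 0 y)^-1 * (eL 0 y * eL 0 (- y)))%g by gsimp.
suff -> : (eL 0 y * eL 0 (- y))%g = 1%g by rewrite mulg1.
apply: (@coordmx_inj _ _ _ _ _ _ C).
by rewrite coordmxM (eLE _ xy) (eLE _ xy') coordmx1 -mx3_1 /uL mx3M cj0; congr mx3; ring.
Qed.

Lemma proI_red_rel g : g \in I ->
  [/\ red (cm g o1 o2) = - bar (red (cm g o0 o1)) &
      red (cm g o0 o2) + bar (red (cm g o0 o2)) +
        red (cm g o0 o1) * bar (red (cm g o0 o1)) = 0].
Proof.
rewrite mem_proI.
have [a [b [c [d [e [f [h [i [j [gE [_ [_ E12 E22]]]]]]]]]]]] := coordmx_entries C g.
rewrite gE /inI !mxE /= => /and5P[a1 b0 c0 d1 /and5P[e1 f0 h1 i1 j1]].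
have [_ _ e0 re] := vg1_unit e1; have [_ _ j0 rj] := vg1_unit j1.
have i0 : vg 0 i by apply: vgW i1.
have ri : red i = 0 by apply/eqP; rewrite red_eq0.
have rf : red f = - bar (red b).
  have := congr1 red E12; rewrite lf_red0 !lf_redD ?lf_redM ?red_cj ?lf_valD ?vgM0 ?vg_cj //.
  by rewrite re rj ri bar1 bar0 mulr1 mul1r mul0r addr0 => /eqP; rewrite addrC addr_eq0 => /eqP.
split=> //; have := congr1 red E22.
rewrite lf_red0 !lf_redD ?lf_redM ?red_cj ?lf_valD ?vgM0 ?vg_cj //.
by rewrite rf rj bar1 barN barK mulrNN mulr1 mul1r => <-; ring.
Qed.

Lemma conj_lower_U g x y : g \in I -> rel x y -> vg 0 x -> vg 0 y ->
  conj_lower s1 (g * (eU x y)^-1)%g =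
  (red x == red (cm g o0 o1)) && (red y == red (cm g o0 o2)).
Proof.
move=> gI xy x0 y0; have [] := proI_red_rel gI.
have xy' : rel (- x) (cj y) by rewrite cjK cjN mulrNN [cj y + y]addrC.
rewrite /conj_lower /= eUV // coordmxM (eUE _ xy') /uU.
move: gI; rewrite mem_proI; move: (cm g) => A.
move=> /and5P[a1 b0 c0 d1 /and5P[e1 f0 h1 i1 j1]].
have [_ _ e0 re] := vg1_unit e1; have [_ _ a0 ra] := vg1_unit a1.
rewrite [A]mx3E mx3M !mxE /= !(mulr0, addr0, mulr1) cjN opprK.
have d0 : vg 0 (A o1 o0) by apply: vgW d1.
have rd : red (A o1 o0) = 0 by apply/eqP; rewrite red_eq0.
rewrite -!red_eq0 ?lf_valD ?vgM0 ?vgN ?vg_cj //.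
rewrite !lf_redD ?lf_redM ?redN ?red_cj ?lf_valD ?vgM0 ?vgN ?vg_cj // ra re rd.
have ryrel : red y + bar (red y) + red x * bar (red x) = 0.
  have := congr1 red xy; rewrite lf_red0.
  by rewrite !lf_redD ?lf_redM ?red_cj ?lf_valD ?vgM0 ?vg_cj.
move=> -> rel_g; rewrite !mul1r mul0r add0r.
have [xE|xN] := eqVneq (red x) (red (A o0 o1)); last first.
  by rewrite addrC subr_eq0 eq_sym (negPf xN).
rewrite xE addNr eqxx subrr eqxx andbT /=.
rewrite xE in ryrel; rewrite [RHS]eq_sym -[RHS]subr_eq0; congr (_ == 0).
by rewrite -[RHS]addr0 -ryrel; ring.
Qed.

Lemma rel_trace0 w y : cj w = w -> y + cj y = 0 -> rel 0 (w * y).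
Proof. by move=> cw yy; rewrite mul0r addr0 cjM cw -mulrDr yy mulr0. Qed.

Lemma proI_red_trace g w : w != 0 -> v w = 1 -> cj w = w -> g \in I ->
  [/\ vg 0 (cm g o2 o0 / w) & red (cm g o2 o0 / w) + bar (red (cm g o2 o0 / w)) = 0].
Proof.
move=> w0 vw cw; rewrite mem_proI.
have [a [b [c [d [e [f [h [i [j [gE [[E00 _ _] _]]]]]]]]]]] := coordmx_entries C g.
rewrite gE /inI !mxE /= => /and5P[a1 b0 c0 d1 /and5P[e1 f0 h1 i1 j1]].
have [_ _ a0 ra] := vg1_unit a1.
have vwV m t : vg (m + 1) t -> vg m (t / w).
  by move=> mt; apply: (vgMl _ mt (n := -1)); rewrite ?addrK // vg_inv // vw.
have h0 : vg 0 (h / w) by apply: vwV.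
have dw : vg 1 (cj d * d / w) by apply: vwV; apply: (vgMl (m := 1) (n := 1)); rewrite ?vg_cj.
split=> //; have : cj a * (h / w) + cj d * d / w + cj (h / w) * a = 0.
  by rewrite cjM cjV cw -[RHS](mul0r w^-1) -E00; ring.
move: (cj d * d / w) (h / w) dw h0 => t y t1 y0 /(congr1 red); rewrite lf_red0.
have t0 : vg 0 t by apply: vgW t1.
have rdw : red t = 0 by apply/eqP; rewrite red_eq0.
rewrite !lf_redD ?lf_redM ?red_cj ?lf_valD ?vgM0 ?vgMr0 ?vg_cj //.
by rewrite ra bar1 mulr1 mul1r rdw addr0.
Qed.

Lemma conj_lower_L g w y : w != 0 -> v w = 1 -> cj w = w -> g \in I ->
  y + cj y = 0 -> vg 0 y ->
  conj_lower s2 (g * (eL 0 (w * y))^-1)%g = (red y == red (cm g o2 o0 / w)).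
Proof.
move=> w0 vw cw gI yy y0; have [h0 _] := proI_red_trace w0 vw cw gI.
have xy := rel_trace0 cw yy.
have xy' : rel 0 (- (w * y)).
  by move: xy; rewrite !mul0r !addr0 cjN -opprD => ->; rewrite oppr0.
rewrite /conj_lower /= eLV // coordmxM (eLE _ xy') /uL cj0 oppr0.
move: gI h0; rewrite mem_proI; move: (cm g) => A.
move=> /and5P[a1 b0 c0 d1 /and5P[e1 f0 h1 i1 j1]] h0.
have [_ _ j0 rj] := vg1_unit j1.
rewrite {1}[A]mx3E mx3M !mxE /= !(mulr0, addr0, mulr1).
have -> : A o2 o0 + A o2 o2 * - (w * y) = w * (A o2 o0 / w - A o2 o2 * y) by field.
have -> : vg 2 (w * (A o2 o0 / w - A o2 o2 * y)) = vg 1 (A o2 o0 / w - A o2 o2 * y).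
  have [->|t0] := eqVneq (A o2 o0 / w - A o2 o2 * y) 0; first by rewrite mulr0 !val_ge0.
  by rewrite !vgE ?mulf_neq0 // lf_valM // vw -[2 in LHS]/(1 + 1 : int) lerD2l.
rewrite -red_eq0; last by apply: vgB => //; apply: vgM0.
by rewrite (redB h0 (vgM0 j0 y0)) (lf_redM j0 y0) rj mul1r subr_eq0 eq_sym.
Qed.

Section Datum.
Variables (R : fieldType) (p : nat).
Hypotheses (char_k : p \in [pchar k]) (char_R : p \in [pchar R]).
Variable n : 'I_2 -> unitary V.
Hypothesis n_adm : forall s, admissible_lift C s (n s).
Variables (rl : kL * kL -> L * L) (ul nl : kL -> L) (w : L).
Hypothesis rlP : forall x : kL * kL, x.2 + bar x.2 + x.1 * bar x.1 = 0 ->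
  [/\ (rl x).2 + cj (rl x).2 + (rl x).1 * cj (rl x).1 = 0, vg 0 (rl x).1 /\ vg 0 (rl x).2,
      red (rl x).1 = x.1, red (rl x).2 = x.2 & x.1 = 0 -> (rl x).1 = 0].
Hypothesis ulP : forall x, x != 0 -> [/\ ul x != 0, v (ul x) = 0 & red (ul x) = x].
Hypothesis nlP : forall y, y * bar y = 1 -> [/\ nl y * cj (nl y) = 1, vg 0 (nl y) & red (nl y) = y].
Hypothesis wP : [/\ w != 0, v w = 1 & cj w = w].

(** Residual parameters: [Z_k] through its first and middle diagonal entries, then the unipotent
    radicals, then [Z_{k,s}]. For [s2] the radical consists of trace zero elements, stored with
    first coordinate [0] so that both [s] share one type. *)
Definition inX : {pred kL * kL} := [pred x | (x.1 != 0) && (x.2 * bar x.2 == 1)].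
Definition inJ (s : 'I_2) : {pred kL * kL} :=
  [pred x | (x.2 + bar x.2 + x.1 * bar x.1 == 0) && ((s == s1) || (x.1 == 0))].
Definition inT (s : 'I_2) : {pred kL} := [pred t | (t != 0) && ((s == s1) || (bar t == t))].

Definition elX (x : kL * kL) := eN false (ul x.1) (nl x.2).
Definition elJ (s : 'I_2) (x : kL * kL) :=
  if s == s1 then eU (rl x).1 (rl x).2 else eL 0 (w * (rl x).2).
(** The middle entry makes the determinant [1], as befits the first factor of [Z_k]. *)
Definition elT (t : kL) := eN false (ul t) (cj (ul t) / ul t).

Lemma inJ2 x : x \in inJ s2 -> [/\ x.1 = 0, (rl x).1 = 0, (rl x).2 + cj (rl x).2 = 0,
  vg 0 (rl x).2 & red (rl x).2 = x.2].
Proof.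
move=> /andP[/eqP /rlP[xy [_ y0] _ yr] x0 /eqP /[dup] xE /x0 rE].
by split=> //; rewrite -[RHS]xy rE mul0r addr0.
Qed.

Lemma elJ_reps s : coset_reps I (n s) (fun j : {x in inJ s} => elJ s (val j)).
Proof.
have [w0 vw cw] := wP.
have [x [c [[x0 vx cc nE] _]]] := admissible_liftP (n_adm s).
have uI j : j \in inJ s -> elJ s j \in I.
  rewrite /elJ; have [->|->] := s12P s => /=.
    by move=> /andP[/eqP /rlP[xy [_ y0] _ _ _] _]; apply: (eU_proI C xy y0).
  move=> /inJ2[_ _ yy y0 _]; apply: (eL_proI C (rel_trace0 cw yy)).
  by apply: (vgMr0 _ y0); rewrite vgE ?vw.
(* The coset of [g], read off the reduction; for [s2] the entry lies in the maximal ideal and is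
   first divided by the uniformiser. *)
pose key g : kL * kL := if s == s1 then (red (cm g o0 o1), red (cm g o0 o2))
  else (0, red (cm g o2 o0 / w)).
have keyP g : g \in I -> key g \in inJ s.
  rewrite /key /inJ inE; have [->|->] := s12P s => /=.
    by move=> /proI_red_rel[_ ->]; rewrite eqxx.
  by move=> /(proI_red_trace w0 vw cw)[_]; rewrite bar0 mulr0 addr0 => ->; rewrite !eqxx.
have conjE g j : g \in I -> j \in inJ s ->
    ((n s)^-1 * (g * (elJ s j)^-1) * n s \in I)%g = (j == key g).
  move=> gI jJ; rewrite (conj_proI x0 vx cc nE); last by apply: memM => //; apply: memV; apply: uI.
  move: jJ; rewrite /elJ /key; have [->|->] := s12P s => /=.
    move=> /andP[/eqP /rlP[xy [y1 y0] xr yr _] _].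
    by rewrite conj_lower_U // xr yr [RHS]/eq_op.
  move=> /inJ2[x10 _ yy y0 yr].
  rewrite conj_lower_L // yr -[RHS]/((_ == _) && (_ == _)) x10 eqxx //.
split=> [j|h hI|i j].
- exact: (uI _ (valP j)).
- by exists (Sub (key h) (keyP _ hI)); rewrite conjE ?SubK ?eqxx //; apply: keyP.
have iI := uI _ (valP i); have jI := uI _ (valP j).
rewrite (conjE _ _ iI (valP j)) => /eqP jE; apply: val_inj.
have : val i == key (elJ s (val i)).
  by rewrite -(conjE _ _ iI (valP i)) mulgV mulg1 mulVg gpred1.
by move=> /eqP ->; rewrite jE.
Qed.

Lemma elX_isN x : x \in inX -> [/\ ul x.1 != 0, v (ul x.1) = 0, nl x.2 * cj (nl x.2) = 1 &
  cm (elX x) = mN E false (ul x.1) (nl x.2)].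
Proof.
by move=> /andP[/ulP[u0 vu _] /eqP /nlP[nn _ _]]; split=> //; rewrite eNE.
Qed.

Lemma elT_isN t : t != 0 -> [/\ ul t != 0, v (ul t) = 0,
  (cj (ul t) / ul t) * cj (cj (ul t) / ul t) = 1 &
  cm (elT t) = mN E false (ul t) (cj (ul t) / ul t)].
Proof.
move=> /ulP[u0 vu _]; have cu0 : cj (ul t) != 0 by rewrite cj_eq0.
have nn : (cj (ul t) / ul t) * cj (cj (ul t) / ul t) = 1.
  by rewrite cjM cjV cjK; field; rewrite u0 cu0.
by split=> //; rewrite eNE.
Qed.

Lemma torus_eq_red g h a c a' c' : a != 0 -> a' != 0 -> v a = 0 -> v a' = 0 ->
  c * cj c = 1 -> c' * cj c' = 1 -> cm g = mN E false a c -> cm h = mN E false a' c' ->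
  (g^-1 * h \in I)%g = (red a == red a') && (red c == red c').
Proof.
move=> a0 a'0 va va' cc cc' gE hE.
have [c0 vc _] := norm1_val cc; have [c'0 vc' _] := norm1_val cc'.
rewrite (mem_proI_N a0 a'0 cc cc' gE hE) [red a == _]eq_sym [red c == _]eq_sym.
by congr (_ && _); apply/idP/eqP => /(ratio_red _ _ _ _); apply.
Qed.

Lemma elX_ex z : z \in torus0 ->
  exists x : {x in inX}, ((elX (val x))^-1 * z)%g \in I.
Proof.
move=> /torus0P[a [c [a0 va cc zE]]]; have [c0 vc cI] := norm1_val cc.
have xX : (red a, red c) \in inX.
  rewrite inE /= (red_unit a0 va) -red_cj // -lf_redM ?vg_cj // cc lf_red1 eqxx //.
exists (Sub (red a, red c) xX); rewrite SubK.
have [u0 vu nn xE] := elX_isN xX.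
rewrite (torus_eq_red u0 a0 vu va nn cc xE zE).
have /andP[/ulP[_ _ ->] /eqP/nlP[_ _ ->]] := xX.
by rewrite !eqxx.
Qed.

Lemma elX_uniq x y : x \in inX -> y \in inX -> ((elX x)^-1 * elX y)%g \in I -> x = y.
Proof.
move=> xX yX; have [u0 vu nn xE] := elX_isN xX; have [u'0 vu' nn' yE] := elX_isN yX.
rewrite (torus_eq_red u0 u'0 vu vu' nn nn' xE yE).
have /andP[/ulP[_ _ ->] /eqP/nlP[_ _ ->]] := xX.
have /andP[/ulP[_ _ ->] /eqP/nlP[_ _ ->]] := yX.
by case: x y {xX yX xE yE u0 vu nn u'0 vu' nn'} => [x1 x2] [y1 y2] /= /andP[/eqP-> /eqP->].
Qed.

Lemma sum_inJ s (F : kL * kL -> R) :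
  \sum_(j : {x in inJ s}) F (val j) = \sum_(x in inJ s) F x.
Proof. by rewrite [RHS]big_sub. Qed.

Lemma sum_inJ1 (F : kL -> R) : \sum_(x in inJ s1) F x.2 = \sum_y F y.
Proof.
rewrite -(sum_roots E char_k char_R); apply: eq_bigl => x.
by rewrite inE andbT.
Qed.

Lemma sum_inJ2 (F : kL -> R) :
  \sum_(x in inJ s2) F x.2 = \sum_(y | y + bar y == 0) F y.
Proof.
rewrite (reindex_onto (fun y : kL => (0, y)) snd) /= => [|x /andP[_ /eqP x0]].
  by apply: eq_bigl => y; rewrite inE /= bar0 mulr0 addr0 !eqxx !andbT.
by case: x x0 => x1 x2 /= ->.
Qed.

(** * Sums over the cosets in [I n_s I] *)

Section Biinvariant.
Variable f : unitary V -> R.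
Hypothesis fI : biinv I f.

Lemma biinv_l u g : u \in I -> f (u * g)%g = f g.
Proof. by move=> uI; have [] := fI g uI. Qed.

Lemma biinv_r u g : u \in I -> f (g * u)%g = f g.
Proof. by move=> uI; have [] := fI g uI. Qed.

(** In terms of the class [(b, m)]: [n s] increases the length. These inequalities are also what
    [conjU_proI] and [conjL_proI] need to bring [elJ s] into [I]. *)
Definition lengthens s (b : bool) (m : int) : bool :=
  if s == s1 then (if b then m < 0 else m <= 0) else 0 <= m.

(** Every representative is absorbed by [I] on the right, so all terms are equal; their number,
    [q^3] or [q], is zero in [R]. *)
Lemma sum_lengthens s b m g : isN b m g -> lengthens s b m ->
  \sum_(j : {x in inJ s}) f ((n s)^-1 * elJ s (val j) * g)%g = 0.
Proof.
have [w0 vw cw] := wP.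
move=> gN gs; transitivity (\sum_(j : {x in inJ s}) f ((n s)^-1 * g)%g).
  apply: eq_bigr => -[j jJ] _ /=.
  have -> : ((n s)^-1 * elJ s j * g = (n s)^-1 * g * (g^-1 * elJ s j * g))%g by gsimp.
  apply: biinv_r; move: jJ gs; rewrite /elJ /lengthens; have [->|->] := s12P s => /=.
    move=> /andP[/eqP /rlP[xy [_ y0] _ _ _] _] gs; apply: (conjU_proI gN xy).
    by apply: vgW y0; case: b gs {gN} => /=; lia.
  move=> /inJ2[_ _ yy y0 _] gs; apply: (conjL_proI gN (rel_trace0 cw yy)).
  have y1 : vg 1 (w * (rl j).2) by apply: (vgMr0 _ y0); rewrite vgE ?vw.
  by apply: vgW y1; case: b gs {gN} => /=; lia.
rewrite (sum_inJ s (fun=> f ((n s)^-1 * g)%g)).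
have [->|->] := s12P s.
  by rewrite (sum_inJ1 (fun=> _)) -(sum_roots E char_k char_R) (sum_roots_const E char_k char_R).
by rewrite (sum_inJ2 (fun=> _)) (sum_trace0_const E char_k char_R).
Qed.

Lemma biinv_torus z z' g : z \in torus0 -> z' \in torus0 -> (z'^-1 * z)%g \in I ->
  f (z * g)%g = f (z' * g)%g.
Proof.
move=> zZ z'Z zz; have -> : (z * g = (z' * (z'^-1 * z) * z'^-1) * (z' * g))%g by gsimp.
by apply: biinv_l; apply: torus0_proI.
Qed.

Lemma elT_torus t : t != 0 -> elT t \in torus0.
Proof.
by move=> /elT_isN[u0 vu nn tE]; apply/torus0P; exists (ul t), (cj (ul t) / ul t).
Qed.

Lemma elT_absorb t z a c g : t != 0 -> a != 0 -> v a = 0 -> c * cj c = 1 ->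
  cm z = mN E false a c -> red a = t^-1 -> red c = t / bar t ->
  f (z * g)%g = f ((elT t)^-1 * g)%g.
Proof.
move=> t0 a0 va cc zE ra rc; have [u0 vu nn tE] := elT_isN t0.
have [_ _ ut] := ulP t0.
have zZ : z \in torus0 by apply/torus0P; exists a, c.
apply: biinv_torus zZ (torus0_V (elT_torus t0)) _.
have cu0 : cj (ul t) != 0 by rewrite cj_eq0.
have nn' : cj (cj (ul t) / ul t) * cj (cj (cj (ul t) / ul t)) = 1 by rewrite [cj (cj (_ / _))]cjK mulrC.
rewrite (torus_eq_red (invr_neq0 u0) a0 _ va nn' cc (coordmxV_N u0 nn tE) zE); last first.
  by rewrite lf_valV // vu.
rewrite redV // ut ra eqxx rc cjM cjV cjK lf_redM ?redV ?lf_val_cj // ?red_cj ?ut ?eqxx //.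
- by rewrite vgE ?vu.
- by rewrite vgE ?vu.
by rewrite vg_inv // lf_val_cj vu.
Qed.

(** The trivial coset gives the shortened element. For the others the rank one identity applies: [I]
    absorbs the left factor after conjugation by [n s] and the right one after conjugation by [g],
    leaving a torus element. *)
Lemma sum_shortens1 b m g : isN b m g -> ~~ lengthens s1 b m ->
  \sum_(j : {x in inJ s1}) f ((n s1)^-1 * elJ s1 (val j) * g)%g =
  f ((n s1)^-1 * g)%g + \sum_(t : {t in inT s1}) f ((elT (val t))^-1 * g)%g.
Proof.
move=> gN gs; have [x [c [x0 vx cc nE rc]]] := admissible_s1 (n_adm s1).
have cx0 : cj x != 0 by rewrite cj_eq0.
have r0 := red_unit x0 vx; set r := red x in rc r0.
have br0 : bar r != 0 by rewrite bar_eq0.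
have nN : isN true 0 (n s1) by exists x, c.
(* The value depends on [y] alone, so [sum_inJ1] can collapse the pairs with the same [y]; the torus
   parameter is [bar y / bar r]. *)
pose G y := if y == 0 then f ((n s1)^-1 * g)%g else f ((elT (bar y / bar r)%R)^-1 * g)%g.
rewrite (sum_inJ s1 (fun y => f ((n s1)^-1 * elJ s1 y * g)%g)).
rewrite (eq_bigr (fun y => G y.2)) => [|y yJ].
  rewrite sum_inJ1 (bigD1 0) //= {1}/G eqxx; congr (_ + _).
  rewrite -[RHS](big_sub (inT s1) (fun t => f ((elT t)^-1 * g)%g)).
  rewrite [RHS](reindex_onto (fun y => bar y / bar r) (fun t => bar t * r)) => [|t _]; last first.
    by rewrite barM barK mulfK.
  apply: eq_big => [y|y y0]; last by rewrite /G (negPf y0).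
  rewrite inE /= andbT mulf_eq0 bar_eq0 invr_eq0 (negPf br0) orbF.
  by rewrite barM barV !barK divfK // eqxx andbT.
have /andP[/eqP /[dup] xy0 /rlP[xy [l1 l2] xr yr _] _] := yJ.
rewrite /elJ /= /G; have [y0|y0] := eqVneq y.2 0.
  have y10 : y.1 = 0.
    move: xy0; rewrite y0 bar0 !add0r => /eqP; rewrite mulf_eq0 bar_eq0 orbb.
    by move/eqP.
  have -> : ((n s1)^-1 * eU (rl y).1 (rl y).2 * g =
     ((n s1)^-1 * eU (rl y).1 (rl y).2 * n s1) * ((n s1)^-1 * g))%g by gsimp.
  apply: biinv_l; rewrite (conj_proI (s := s1) x0 vx cc nE); last exact: (eU_proI C xy l2).
  rewrite /conj_lower /= (eUE C xy) !mxE /= vgN vg_cj -!red_eq0 // xr yr y0 y10 eqxx //.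
have [Y0 vY] : (rl y).2 != 0 /\ v (rl y).2 = 0 by apply: lf_unitE; rewrite ?yr.
have [rel1 rel2] := rel_inv Y0 xy; have cY0 : cj (rl y).2 != 0 by rewrite cj_eq0.
set p1 := - cj _ / _ in rel1; set p2 := - cj _ / cj _ in rel2.
set Y := (rl y).2 in Y0 vY rel1 rel2 cY0 *.
have YV : vg 0 Y^-1 by rewrite vg_inv // vY.
have -> : ((n s1)^-1 * eU (rl y).1 Y * g =
    ((n s1)^-1 * eL p1 Y^-1 * n s1) * ((n s1)^-1 * eN true Y (- cj Y / Y) * g) *
    (g^-1 * eL p2 Y^-1 * g))%g by rewrite (eU_factor C Y0 xy); gsimp.
rewrite biinv_r; last first.
  apply: (conjL_proI gN rel2); apply: vgW YV.
  by move: gs; rewrite /lengthens /=; clear; case: b => /=; lia.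
rewrite biinv_l; last by apply: (conjL_proI nN rel1); apply: vgW YV.
have nnY := norm1_opp E Y0; have ncc : cj c * cj (cj c) = 1 by rewrite cjK mulrC.
have cY : vg 0 (cj Y)^-1 by rewrite -cjV vg_cj.
have YI : vg 0 Y by rewrite vgE ?vY.
have bY0 : bar y.2 / bar r != 0 by rewrite mulf_neq0 ?invr_neq0 ?bar_eq0.
(* The determinant condition on [n s1], in the form of [rc], gives the middle entry the reduction
   required of [elT]. *)
apply: (@elT_absorb _ _ (cj x * (cj Y)^-1) (cj c * (- cj Y / Y))) => //.
- by rewrite mulf_neq0 ?invr_neq0.
- by rewrite lf_valM ?invr_neq0 // lf_valV // !lf_val_cj vx vY.
- by rewrite cjM mulrACA ncc nnY mulr1.
- by rewrite coordmxM (coordmxV_N x0 cc nE) eNE // mN_mul.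
- rewrite lf_redM // ?vg_cj ?vgE ?vx // redV ?lf_val_cj // !red_cj // ?vgE ?vx // yr invf_div.
  by rewrite mulrC.
have [_ _ cI] := norm1_val cc.
rewrite lf_redM ?lf_redM ?vg_cj ?redN ?red_cj ?vgN ?vg_cj //; last first.
  by apply: vgM0; rewrite ?vgN ?vg_cj.
rewrite rc redV // yr !(barM, barN, barV, barK); rewrite -/Y in yr; field.
by rewrite ?r0 ?br0 ?bar_eq0 ?y0.
Qed.

Lemma eL_factor Y : Y != 0 -> Y + cj Y = 0 ->
  [/\ rel 0 Y, rel 0 Y^-1 & eL 0 Y = (eU 0 Y^-1 * eN true (- Y^-1) 1 * eU 0 Y^-1)%g].
Proof.
move=> Y0 YY; have cY : cj Y = - Y by apply/eqP; rewrite -addr_eq0 addrC YY.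
have r1 : rel 0 Y by rewrite mul0r addr0.
have r2 : rel 0 Y^-1 by rewrite mul0r addr0 cjV cY invrN subrr.
split=> //; apply: (@coordmx_inj _ _ _ _ _ _ C).
rewrite !coordmxM (eLE C r1) !(eUE C r2) eNE ?oppr_eq0 ?invr_eq0 ?one_norm1 //.
rewrite /mN /uL /uU !mx3M cj0 cjN cjV cY.
by congr mx3; field; rewrite ?oppr_eq0 ?oner_eq0 ?Y0.
Qed.

(** The argument of [sum_shortens1] with upper and lower exchanged and valuations shifted by the
    uniformiser; here the [q - 1] nontrivial cosets match the torus elements one to one. *)
Lemma sum_shortens2 b m g : isN b m g -> ~~ lengthens s2 b m ->
  \sum_(j : {x in inJ s2}) f ((n s2)^-1 * elJ s2 (val j) * g)%g =
  f ((n s2)^-1 * g)%g + \sum_(t : {t in inT s2}) f ((elT (val t))^-1 * g)%g.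
Proof.
have [w0 vw cw] := wP; move=> gN gs.
have [x [c [[x0 vx cc nE rc] /(_ w w0 vw cw)]]] := admissible_s2 (n_adm s2).
have cx0 : cj x != 0 by rewrite cj_eq0.
have xw0 : x * w != 0 by rewrite mulf_neq0.
have vxw : v (x * w) = 0 by rewrite lf_valM // vx vw.
have xwI : vg 0 (x * w) by rewrite vgE ?vxw.
have r0 := red_unit xw0 vxw; set r := red (x * w) in r0 * => br.
have br0 : bar r != 0 by rewrite bar_eq0.
have nN : isN true (-1) (n s2) by exists x, c.
(* Both [r] and a trace zero [y] are negated by [bar], so the parameter [(bar r * y)^-1] is fixed by
   [bar] and lies in [Z_{k,s2}]. *)
pose G y := if y == 0 then f ((n s2)^-1 * g)%g else f ((elT (bar r * y)^-1%R)^-1 * g)%g.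
rewrite (sum_inJ s2 (fun y => f ((n s2)^-1 * elJ s2 y * g)%g)).
rewrite (eq_bigr (fun y => G y.2)) => [|y yJ].
  rewrite sum_inJ2 (bigD1 0) /=; last by rewrite bar0 addr0.
  rewrite {1}/G eqxx; congr (_ + _).
  rewrite -[RHS](big_sub (inT s2) (fun t => f ((elT t)^-1 * g)%g)).
  rewrite [RHS](reindex_onto (fun y => (bar r * y)^-1) (fun t => t^-1 / bar r)) => [|t _]; last first.
    by rewrite mulrC divfK // invrK.
  apply: eq_big => [y|y /andP[_ y0]]; last by rewrite /G (negPf y0).
  rewrite inE /= invrK [bar r * y]mulrC mulfK // eqxx andbT invr_eq0 mulf_eq0 (negPf br0) orbF.
  rewrite andbC; congr (_ && _).
  rewrite barV (inj_eq invr_inj) barM barK br mulrN -[RHS]subr_eq0 opprK.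
  by rewrite -mulrDl mulf_eq0 (negPf r0) orbF addrC.
have [y10 l10 yy y2I yr] := inJ2 yJ.
rewrite /elJ /= /G; set Y := (w * (rl y).2).
have YY : Y + cj Y = 0 by rewrite /Y cjM cw -mulrDr yy mulr0.
have relY : rel 0 Y by rewrite mul0r addr0.
have [y0|y0] := eqVneq y.2 0.
  have -> : ((n s2)^-1 * eL 0 Y * g =
     ((n s2)^-1 * eL 0 Y * n s2) * ((n s2)^-1 * g))%g by gsimp.
  have y21 : vg 1 (rl y).2 by rewrite -red_eq0 // yr y0.
  have Y2 : vg 2 Y by apply: (vgMl (m := 1) (n := 1) _ _ y21); rewrite ?vgE ?vw.
  apply: biinv_l; rewrite (conj_proI (s := s2) x0 vx cc nE).
    by rewrite /conj_lower /= (eLE C relY) !mxE.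
  by apply: (eL_proI C relY); apply: vgW Y2.
have [l0 vl] : (rl y).2 != 0 /\ v (rl y).2 = 0 by apply: lf_unitE; rewrite ?yr.
have Y0 : Y != 0 by rewrite mulf_neq0.
have vY : v Y = 1 by rewrite lf_valM // vw vl.
have [_ relV ->] := eL_factor Y0 YY.
have YV : vg (-1) Y^-1 by rewrite vg_inv // vY.
have -> : ((n s2)^-1 * (eU 0 Y^-1 * eN true (- Y^-1) 1 * eU 0 Y^-1) * g =
    ((n s2)^-1 * eU 0 Y^-1 * n s2) * ((n s2)^-1 * eN true (- Y^-1) 1 * g) *
    (g^-1 * eU 0 Y^-1 * g))%g by gsimp.
rewrite biinv_r; last first.
  apply: (conjU_proI gN relV); apply: vgW YV.
  by move: gs; rewrite /lengthens /=; clear; case: b => /=; lia.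
rewrite biinv_l; last by apply: (conjU_proI nN relV); apply: vgW YV.
have ncc : cj c * cj (cj c) = 1 by rewrite cjK mulrC.
have bY0 : (bar r * y.2)^-1 != 0 by rewrite invr_neq0 ?mulf_neq0.
have YN0 : - Y^-1 != 0 by rewrite oppr_eq0 invr_neq0.
have cY : cj Y = - Y by apply/eqP; rewrite -addr_eq0 addrC YY.
have aE : cj x * (cj (- Y^-1))^-1 = cj (x * w) * (rl y).2.
  by rewrite cjN cjV cY !invrN opprK invrK cjM cw /Y mulrA.
have [_ _ cI] := norm1_val cc.
have by2 : bar y.2 = - y.2.
  by move: yJ => /andP[/eqP + _]; rewrite y10 mul0r addr0 => /eqP; rewrite addrC addr_eq0 => /eqP.
apply: (@elT_absorb _ _ (cj x * (cj (- Y^-1))^-1) (cj c)) => //.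
- by rewrite aE mulf_neq0 ?cj_eq0.
- by rewrite aE lf_valM ?cj_eq0 // lf_val_cj vxw vl.
- rewrite coordmxM (coordmxV_N x0 cc nE) eNE ?one_norm1 // mN_mul //.
  by rewrite mulr1.
- by rewrite aE lf_redM ?vg_cj // red_cj // invrK yr.
rewrite red_cj // rc bar1 barV barM barK by2 br; field.
by rewrite ?oppr_eq0 ?oner_eq0 ?r0 ?y0.
Qed.

End Biinvariant.

Lemma wd_lengthens s l : lengthens s (odd l) (wval (rev_ord s) l).
Proof.
rewrite /lengthens /wval; have [->|->] := s12P s => /=; last by lia.
by case: odd (odd_double_half l) => /=; rewrite uphalf_half; lia.
Qed.

Lemma wd_shortens s l : ~~ lengthens s (odd l.+1) (wval s l.+1).
Proof.
rewrite /lengthens /wval; have [->|->] := s12P s => /=; last by lia.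
by have := odd_double_half l; case: odd => /=; rewrite ?uphalf_half /=; lia.
Qed.

Lemma unitary_datum : exists D : affine_datum R I n torus0,
  #|aff_X D|%:R != 0 :> R /\
  forall s (F : unitary V -> R), \sum_t F (aff_t D s t) = \sum_(t in inT s) F (elT t).
Proof.
have tor x : x \in inX -> elX x \in torus0.
  by move=> /elX_isN[a0 va cc xE]; apply/torus0P; exists (ul x.1), (nl x.2).
have long (f : unitary V -> R) s l z : biinv I f -> z \in torus0 ->
    \sum_(j : {x in inJ s}) f ((n s)^-1 * elJ s (val j) * (wd n (rev_ord s) l * z))%g = 0.
  move=> fI zZ; apply: (sum_lengthens fI (wd_torus0_isN n_adm (rev_ord s) l zZ)).
  exact: wd_lengthens.
have short (f : unitary V -> R) s l z : biinv I f -> z \in torus0 ->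
    \sum_(j : {x in inJ s}) f ((n s)^-1 * elJ s (val j) * (wd n s l.+1 * z))%g =
    f (wd n (rev_ord s) l * z)%g +
    \sum_(t : {t in inT s}) f ((elT (val t))^-1 * (wd n s l.+1 * z))%g.
  move=> fI zZ; have -> : (wd n (rev_ord s) l * z = (n s)^-1 * (wd n s l.+1 * z))%g.
    by rewrite /=; gsimp.
  have wN := wd_torus0_isN n_adm s l.+1 zZ; have := wd_shortens s l.
  have [sE|sE] := s12P s; move: wN; rewrite sE => wN ws.
    exact: (sum_shortens1 fI wN ws).
  exact: (sum_shortens2 fI wN ws).
exists (@AffineDatum R _ I n torus0 (torus0_1 C) (@torus0_M _ _ _ _ _ _ C)
  (@torus0_V _ _ _ _ _ _ C) (@torus0_proI _ _ _ _ _ _ C)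
  (torus0_nZ n_adm) (torus0_nn n_adm) _ (fun x : {x in inX} => elX (val x))
  (fun x => tor _ (valP x)) elX_ex (fun x y h => val_inj (elX_uniq (valP x) (valP y) h))
  (bruhat_words n_adm) (words_disjoint n_adm) (fun s => {x in inJ s})
  (fun s j => elJ s (val j)) elJ_reps (fun s => {t in inT s}) (fun s t => elT (val t))
  (fun s t => elT_torus (proj1 (andP (valP t)))) long short).
split=> [|s F] /=; last by rewrite [RHS]big_sub.
by rewrite card_sig; apply: (card_torus E char_k char_R).
Qed.

End Datum.

End HeckeDatum.

(** * The theorem *)

Section ExtHecke.
Variables (R : fieldType) (G : groupType) (I : groupClosed G).
Variables (n : 'I_2 -> G) (Z : {pred G}) (D : affine_datum R I n Z).
Hypothesis X_neq0 : #|aff_X D|%:R != 0 :> R.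
Variables (xi xi' : {lrmorphism hecke R I -> R^o}) (ch ch' : G -> R) (x x' : 'I_2 -> R).
Hypothesis xiP : is_hecke_char n Z xi ch x.
Hypothesis xi'P : is_hecke_char n Z xi' ch' x'.

(* The values on the [T_(n s)] of a derivation which vanishes on the [T_z]. *)
Definition deriv_values (a : 'I_2 -> R) : Prop :=
  (forall s z, z \in Z -> a s * ch' z = ch (n s * z * (n s)^-1)%g * a s) /\
  (forall s, (x s + x' s) * a s = (\sum_t ch (aff_t D s t)) * a s).

(** After averaging, the coboundaries left are the multiples [m (xi - xi')] that vanish on all
    [T_z]; the clauses on [m] divide the admissible values by them, and [c] parametrises the
    quotient. *)
Lemma hecke_Ext1_dim d (c : 'rV[R]_d -> 'I_2 -> R) :
  (forall (e : R) u w s, c (e *: u + w) s = e * c u s + c w s) ->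
  (forall w, deriv_values (c w)) ->
  (forall a, deriv_values a -> exists w m,
     (forall s, a s = c w s + m * (x s - x' s)) /\
     (forall z, z \in Z -> m * (ch z - ch' z) = 0)) ->
  (forall w m, (forall s, c w s = m * (x s - x' s)) ->
     (forall z, z \in Z -> m * (ch z - ch' z) = 0) -> w = 0) ->
  Ext1_dim (char_mod xi) (char_mod xi') d.
Proof.
move=> cL cD csurj cinj.
have /boolp.choice[Dv DvP] : forall w, exists d : tderiv xi xi',
    (forall z T, z \in Z -> is_heckeT z T -> d T = 0) /\
    (forall s T, is_heckeT (n s) T -> d T = c w s).
  by move=> w; have [h1 h2] := cD w; apply: (hecke_deriv_ex xiP xi'P h1 h2).
have /boolp.choice[Tn TnP] : forall s, exists T, is_heckeT (I := I) (R := R) (n s) T.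
  by move=> s; have [T []] := heckeT_n_ex D s; exists T.
have [TZ TZP] := TZ_ex D.
apply: (@deriv_Ext1_dim _ _ _ _ _ Dv) => [e u w|d0|w m Dw].
- apply: (hecke_deriv_uniq D (d := Dv _) (d' := tderiv_comb e (Dv u) (Dv w))).
    move=> z T zZ Tz; rewrite /= ((DvP _).1 _ _ zZ Tz) ((DvP u).1 _ _ zZ Tz).
    by rewrite ((DvP w).1 _ _ zZ Tz) mulr0 addr0.
  by move=> s T Ts; rewrite /= !((DvP _).2 _ _ Ts) cL.
- have [m0 m0P] := hecke_deriv_normalise xiP xi'P X_neq0 d0.
  (* [d0] minus the coboundary found by averaging; [m + m0] below puts it back. *)
  pose d1 := tderiv_comb (- m0) (tderiv_cob xi xi') d0.
  have d1Z z T : z \in Z -> is_heckeT z T -> d1 T = 0.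
    move=> zZ Tz; rewrite /= (m0P _ _ zZ Tz) (xiP.1 _ _ zZ Tz) (xi'P.1 _ _ zZ Tz).
    by ring.
  have [|w [m [mP mZ]]] := csurj (fun s => d1 (Tn s)).
    split=> [s z zZ|s].
      exact: (hecke_deriv_nZ D xiP xi'P d1Z zZ (TnP s)).
    exact: (hecke_deriv_sqr D xiP xi'P d1Z (TnP s)).
  have d1E : d1 =1 tderiv_comb m (tderiv_cob xi xi') (Dv w).
    apply: (hecke_deriv_uniq D) => [z T zZ Tz|s T Ts].
      rewrite (d1Z _ _ zZ Tz) /= ((DvP w).1 _ _ zZ Tz) addr0.
      by rewrite (xiP.1 _ _ zZ Tz) (xi'P.1 _ _ zZ Tz) mZ.
    rewrite (heckeT_uniq Ts (TnP s)) mP /= ((DvP w).2 _ _ (TnP s)).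
    by rewrite (xiP.2 _ _ (TnP s)) (xi'P.2 _ _ (TnP s)) addrC.
  exists w, (m + m0) => a; have := d1E a; rewrite /= => E0.
  rewrite -[d0 a](addKr (- m0 * ((xi a : R) - (xi' a : R)))) E0; ring.
apply: (cinj w m) => [s|z zZ].
  by rewrite -((DvP w).2 _ _ (TnP s)) Dw (xiP.2 _ _ (TnP s)) (xi'P.2 _ _ (TnP s)).
have Tz := TZP z zZ.
by rewrite -(xiP.1 _ _ zZ Tz) -(xi'P.1 _ _ zZ Tz) -Dw ((DvP w).1 _ _ zZ Tz).
Qed.

End ExtHecke.

Section TorusCharacters.
Variables (K : fieldType) (L : fieldExtType K) (k kL : finFieldType).
Variable E : unramified_quadratic L k kL.
Variables (V : hermitian_space E) (C : chamber V).
Local Notation v := (lf_val (uq_ext E)).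
Local Notation vg := (val_ge (lf_val (uq_ext E))).
Local Notation red := (lf_red (uq_ext E)).
Local Notation bar := (uq_bar E).
Local Notation cj := (uq_conj E).
Local Notation I := (proIwahori C).
Local Notation cm := (coordmx C).
Implicit Types (g : unitary V) (A : 'M[L]_3).
Local Notation torus0 := (torus0 C).
Local Notation q := #|k|.

Lemma torus0_parahoric z : z \in torus0 -> torus_parahoric C z.
Proof.
move=> /torus0P[a [c [a0 va cc zE]]]; split; first exact: (diag_centraliser zE).
have [c0 vc cI] := norm1_val cc.
apply/parahoric1P; rewrite zE; have aI : vg 0 a by rewrite vgE ?va.
by elim/ord3P; elim/ord3P; rewrite mxE //= ?val_ge0 // -cjV vg_cj vg_inv ?va.
Qed.

Section Char.
Variable R : closedFieldType.
Implicit Types chi : Zk_char E R.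

Lemma Zk_char_torus chi z a c : a != 0 -> v a = 0 -> cm z = mN E false a c ->
  Zk_char_eval C chi z = zeta chi (red a) * eta chi (red a * red c / bar (red a)).
Proof.
move=> a0 va zE; have aI : vg 0 a by rewrite vgE ?va.
have redE : redmx C z = mx3 (red a) 0 0 0 (red c) 0 0 0 (bar (red a))^-1.
  apply/matrixP => i j; rewrite redmxE zE; move: i j.
  elim/ord3P; elim/ord3P; rewrite !mxE //= ?lf_red0 //.
  by rewrite redV ?cj_eq0 ?lf_val_cj // red_cj.
by rewrite /Zk_char_eval redE det_mx3 mxE /=; congr (_ * eta chi _); ring.
Qed.

Lemma zetaX chi t i : t != 0 -> zeta chi (t ^+ i) = zeta chi t ^+ i.
Proof.
move=> t0; elim: i => [|i IHi]; first by rewrite !expr0 zeta1.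
by rewrite !exprS zetaM ?expf_neq0 // IHi.
Qed.

Lemma zeta_norm chi t : t != 0 -> zeta chi (t * bar t) = zeta chi t ^+ q.+1.
Proof. by move=> t0; rewrite barE -exprS zetaX. Qed.

Lemma zeta_twist chi t : t != 0 ->
  zeta chi t = zeta chi ((bar t)^-1) * zeta chi t ^+ q.+1.
Proof.
move=> t0; have bt0 : bar t != 0 by rewrite bar_eq0.
rewrite -zeta_norm // -zetaM ?invr_neq0 ?mulf_neq0 //; congr (zeta chi _).
by rewrite mulrC mulfK.
Qed.

Lemma sum_zeta_trivial chi s p (char_k : p \in [pchar k]) (char_R : p \in [pchar R]) :
  (forall t, t \in inT E s -> zeta chi t = 1) -> \sum_(t in inT E s) zeta chi t = -1.
Proof.
move=> triv; rewrite (eq_bigr (fun=> 1)) //.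
have -> : \sum_(t in inT E s) (1 : R) =
    \sum_(t | (s == s1) || (bar t == t)) 1 - 1.
  rewrite [in RHS](bigD1 0) /=; last by rewrite bar0 eqxx orbT.
  by rewrite addrAC subrr add0r; apply: eq_bigl => t; rewrite inE andbC.
rewrite sumr_const; have [->|->] := s12P s => /=.
  by rewrite (uq_res E) natrX (q_eq0 char_k char_R) expr0n sub0r.
by rewrite -cardsE bar_fixed_card (q_eq0 char_k char_R) sub0r.
Qed.

Lemma sum_zeta_nontrivial chi s t0 : t0 \in inT E s -> zeta chi t0 != 1 ->
  \sum_(t in inT E s) zeta chi t = 0.
Proof.
move=> /andP[t00 ts] nz; set S := \sum_(t in _) _.
have SE : S = zeta chi t0 * S.
  rewrite /S mulr_sumr [LHS](reindex_inj (mulfI t00)) /=.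
  apply: eq_big => [t|t /andP[]]; last first.
    by rewrite mulf_eq0 negb_or => /andP[_ t1] _; rewrite zetaM.
  rewrite !inE mulf_eq0 (negPf t00) /=; congr (_ && _).
  case: (s == s1) ts => //= /eqP bt0; rewrite barM bt0.
  by rewrite (inj_eq (mulfI t00)).
apply/eqP; move/eqP: SE; rewrite -subr_eq0 -{1}[S]mul1r -mulrBl mulf_eq0 subr_eq0.
by rewrite eq_sym (negPf nz).
Qed.

(** Conjugation by either [n s] replaces [a] by [(cj a)^-1] and keeps [c] and the reduced
    determinant, so the right side is independent of [s]. *)
Lemma Zk_char_conj chi (n : 'I_2 -> unitary V) s z a c :
  (forall s, admissible_lift C s (n s)) ->
  a != 0 -> v a = 0 -> c * cj c = 1 -> cm z = mN E false a c ->
  Zk_char_eval C chi (n s * z * (n s)^-1)%g =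
  zeta chi (bar (red a))^-1 * eta chi (red a * red c / bar (red a)).
Proof.
move=> n_adm a0 va cc zE.
have [x [d [[x0 vx dd nE] _]]] := admissible_liftP (n_adm s).
have ca0 : (cj a)^-1 != 0 by rewrite invr_neq0 ?cj_eq0.
have vca : v (cj a)^-1 = 0 by rewrite lf_valV ?cj_eq0 // lf_val_cj va.
have nzE : cm (n s * z * (n s)^-1)%g = mN E false (cj a)^-1 c.
  rewrite !coordmxM (coordmxV_N x0 dd nE) nE zE !mN_mul ?mulf_neq0 ?cj_eq0 //.
  by rewrite /= cjK mulrAC mulfV // mul1r mulrAC dd mul1r.
have aI : vg 0 a by rewrite vgE ?va.
rewrite (Zk_char_torus chi ca0 vca nzE) redV ?cj_eq0 ?lf_val_cj // red_cj //.
congr (_ * eta chi _); rewrite barV barK; have r0 := red_unit a0 va.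
by field; rewrite ?bar_eq0 ?r0 ?oner_eq0.
Qed.

Lemma hecke_setup (n : 'I_2 -> unitary V) p : p \in [pchar k] -> p \in [pchar R] ->
  (forall s, admissible_lift C s (n s)) ->
  exists D : affine_datum R I n torus0, #|aff_X D|%:R != 0 :> R /\
    forall chi s, \sum_t Zk_char_eval C chi (aff_t D s t) = \sum_(t in inT E s) zeta chi t.
Proof.
move=> char_k char_R n_adm.
have /boolp.choice[rl rlP] : forall x : kL * kL, exists y : L * L,
    x.2 + bar x.2 + x.1 * bar x.1 = 0 ->
    [/\ y.2 + cj y.2 + y.1 * cj y.1 = 0, vg 0 y.1 /\ vg 0 y.2,
        red y.1 = x.1, red y.2 = x.2 & x.1 = 0 -> y.1 = 0].
  move=> x; have [xy|xy] := pselect (x.2 + bar x.2 + x.1 * bar x.1 = 0); last by exists 0.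
  by have [y yP] := root_lift xy; exists y.
have /boolp.choice[ul ulP] : forall t : kL, exists u : L,
    t != 0 -> [/\ u != 0, v u = 0 & red u = t].
  move=> t; have [->|t0] := eqVneq t 0; first by exists 0.
  by have [u uP] := unit_lift E t0; exists u.
have /boolp.choice[nl nlP] : forall y : kL, exists u : L,
    y * bar y = 1 -> [/\ u * cj u = 1, vg 0 u & red u = y].
  move=> y; have [yy|yy] := pselect (y * bar y = 1); last by exists 0.
  by have [u uP] := norm1_lift yy; exists u.
have [w wP] := uniformizer E.
have [D [DX DT]] := unitary_datum char_k char_R n_adm rlP ulP nlP wP.
exists D; split=> // chi s; rewrite DT; apply: eq_bigr => t /andP[t0 _].
have [u0 vu nn tE] := elT_isN C ulP t0; have [_ _ ut] := ulP t t0.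
have uI : vg 0 (ul t) by rewrite vgE ?vu.
rewrite (Zk_char_torus chi u0 vu tE) ut lf_redM ?vg_cj ?vg_inv ?vu // redV // red_cj // ut.
have -> : t * (bar t / t) / bar t = 1 by field; rewrite ?bar_eq0 t0.
by rewrite eta1 mulr1.
Qed.

Definition xi_values (J : {set 'I_2}) (s : 'I_2) : R := if s \in J then -1 else 0.

Lemma is_xi_char (n : 'I_2 -> unitary V) chi J
    (xi : {lrmorphism proIwahori_hecke R C -> R^o}) : is_xi n chi J xi ->
  is_hecke_char n torus0 xi (Zk_char_eval C chi) (xi_values J).
Proof.
by move=> [xiZ xin]; split=> [z T zZ|s T]; [apply: xiZ; apply: torus0_parahoric | apply: xin].
Qed.

Lemma s1_conjugateP chi chi' (n : 'I_2 -> unitary V) :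
  (forall s, admissible_lift C s (n s)) ->
  s1_conjugate chi chi' <-> forall s z, z \in torus0 ->
    Zk_char_eval C chi' z = Zk_char_eval C chi (n s * z * (n s)^-1)%g.
Proof.
move=> n_adm; split=> [[cz ce] s z /torus0P[a [c [a0 va cc zE]]]|conjE].
  rewrite (Zk_char_conj chi s n_adm a0 va cc zE) (Zk_char_torus chi' a0 va zE).
  have r0 := red_unit a0 va; have [c0 vc cI] := norm1_val cc.
  have rc : red c * bar (red c) = 1 by rewrite -red_cj // -lf_redM ?vg_cj // cc lf_red1.
  rewrite cz //; congr (_ * _); apply: ce; rewrite !barM barV barK.
  transitivity (red c * bar (red c)) => //; field.
  by rewrite ?bar_eq0 r0.
(* Elements of determinant one isolate [zeta]; elements with first entry [1] isolate [eta]. *)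
split=> [t t0|y yy].
  have [u [u0 vu ut]] := unit_lift E t0.
  have cu0 : cj u != 0 by rewrite cj_eq0.
  have nn : (cj u / u) * cj (cj u / u) = 1 by rewrite cjM cjV cjK; field; rewrite u0 cu0.
  have uI : vg 0 u by rewrite vgE ?vu.
  have zE := eNE C false u0 nn.
  have zZ : eN C false u (cj u / u) \in torus0 by apply/torus0P; exists u, (cj u / u).
  have := conjE s1 _ zZ; rewrite (Zk_char_conj chi s1 n_adm u0 vu nn zE).
  rewrite (Zk_char_torus chi' u0 vu zE) ut lf_redM ?vg_cj ?vg_inv ?vu // redV // red_cj // ut.
  have -> : t * (bar t / t) / bar t = 1 by field; rewrite ?bar_eq0 t0.
  by rewrite !eta1 !mulr1.
have [u [nn uI uy]] := norm1_lift yy.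
have zE := eNE C false (oner_neq0 L) nn.
have v1 : v 1 = 0 by apply: lf_val1.
have zZ : eN C false 1 u \in torus0 by apply/torus0P; exists 1, u; rewrite oner_neq0.
have := conjE s1 _ zZ; rewrite (Zk_char_conj chi s1 n_adm (oner_neq0 L) v1 nn zE).
rewrite (Zk_char_torus chi' (oner_neq0 L) v1 zE) uy lf_red1 bar1 invr1 !mulr1 !mul1r.
by rewrite !zeta1 !mul1r.
Qed.

Lemma self_conjugate chi (n : 'I_2 -> unitary V) :
  (forall s, admissible_lift C s (n s)) ->
  (forall t, t != 0 -> zeta chi t ^+ q.+1 = 1) ->
  forall s z, z \in torus0 ->
    Zk_char_eval C chi z = Zk_char_eval C chi (n s * z * (n s)^-1)%g.
Proof.
move=> n_adm h; apply/s1_conjugateP => //; split=> // t t0.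
by rewrite zeta_twist // h // mulr1.
Qed.

End Char.

End TorusCharacters.

Theorem proposition4p1
    (K : fieldType) (L : fieldExtType K) (k kL : finFieldType)
    (E : unramified_quadratic L k kL)
    (V : hermitian_space E) (C : chamber V)
    (p : nat) (R : closedFieldType)
    (char_k : p \in [pchar k]) (char_R : p \in [pchar R])
    (n : 'I_2 -> unitary V) (n_adm : forall s, admissible_lift C s (n s))
    (chi : Zk_char E R) :
  (trivial_Iwahori chi ->
     forall (i j : 'I_2) (xi xi' : {lrmorphism proIwahori_hecke R C -> R^o}),
       is_xi n chi [set i] xi -> is_xi n chi [set j] xi' ->
       Ext1_dim (char_mod xi) (char_mod xi') (if i == j then 0%N else 1%N)) /\
  (hybrid chi ->
     forall (I1 I2 : {set 'I_2})
            (xi xi' : {lrmorphism proIwahori_hecke R C -> R^o}),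
       I1 \subset [set s2] -> I2 \subset [set s2] ->
       is_xi n chi I1 xi -> is_xi n chi I2 xi' ->
       Ext1_dim (char_mod xi) (char_mod xi') 1) /\
  (regular chi ->
     forall (chi' : Zk_char E R)
            (xi xi' : {lrmorphism proIwahori_hecke R C -> R^o}),
       is_xi n chi set0 xi -> is_xi n chi' set0 xi' ->
       (s1_conjugate chi chi' -> Ext1_dim (char_mod xi) (char_mod xi') 2) /\
       (~ s1_conjugate chi chi' -> Ext1_dim (char_mod xi) (char_mod xi') 0)).
Proof.
have [D [DX DT]] := hecke_setup char_k char_R n_adm.
have row0 (w : 'rV[R]_0) : w = 0 by apply/rowP => -[].
have N1 : (-1 : R) != 0 by rewrite oppr_eq0 oner_eq0.
split; [|split].
- move=> triv i j xi xi' /is_xi_char xiP /is_xi_char xi'P.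
  have sumE s : \sum_t Zk_char_eval C chi (aff_t D s t) = -1.
    by rewrite DT; apply: (sum_zeta_trivial char_k char_R) => t /andP[/triv].
  have conjE := self_conjugate (chi := chi) n_adm
    (fun t t0 => etrans (congr1 (fun u => u ^+ _) (triv t t0)) (expr1n _ _)).
  have xE s l : xi_values R [set l] s = - (s == l)%:R.
    by rewrite /xi_values inE; case: eqP; rewrite ?oppr0.
  case: eqVneq => [ij|ij].
    (* The quadratic relation reads [- 2 a = - a] at [i] and [0 = - a] at the other reflection: both
       values vanish in every characteristic. *)
    rewrite -ij in xi'P => {j ij}.
    apply: (hecke_Ext1_dim DX xiP xi'P (c := fun _ _ => 0)).
    + by move=> e u w s; rewrite mulr0 addr0.
    + by split=> *; rewrite ?mulr0 ?mul0r.
    + move=> a [_ aP]; exists 0, 0; split=> [s|z _]; rewrite mul0r ?addr0 //.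
      have := aP s; rewrite sumE xE; case: eqP => _.
        by move/eqP; rewrite mulrDl -subr_eq0 addrK mulN1r oppr_eq0 => /eqP.
      by rewrite oppr0 addr0 mul0r mulN1r => /esym/eqP; rewrite oppr_eq0 => /eqP.
    + by move=> w m _ _.
  have sj s : (s == j) = (s != i).
    by have [->|->] := rev_ordP i s; have [jE|jE] := rev_ordP i j;
      rewrite ?jE ?eqxx in ij *; move/eqP: (@rev_ord_neq i) => /negPf; rewrite // eq_sym => ->.
  (* Now [x s + x' s = -1] at both reflections, so all values are allowed. The coboundary is [-1] at
     [i] and [1] at [j]; its multiple by [a j] concentrates the values at [i], where [a i + a j]
     remains. *)
  pose c (w : 'rV[R]_1) s : R := if s == i then w 0 0 else 0.
  apply: (hecke_Ext1_dim DX xiP xi'P (c := c)).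
  + by move=> e u w s; rewrite /c !mxE; case: ifP => _; rewrite ?mulr0 ?addr0.
  + move=> w; split=> [s z zZ|s]; first by rewrite -conjE // mulrC.
    by rewrite sumE !xE sj; case: eqP => _; rewrite /= ?oppr0 ?addr0 ?add0r.
  + move=> a _; exists (const_mx (a i + a j)), (a j); split=> [s|z _]; last first.
      by rewrite subrr mulr0.
    rewrite !xE sj /c mxE; case: (eqVneq s i) => [->|si] /=; first by ring.
    have -> : s = j by apply/eqP; rewrite sj.
    by ring.
  + move=> w m cm _; apply/rowP => l; rewrite ord1 mxE.
    have ji : (j == i) = false by rewrite eq_sym (negPf ij).
    have := cm j; rewrite !xE sj /c ji /= oppr0 sub0r opprK mulr1 => /esym m0.
    by have := cm i; rewrite !xE /c eqxx m0 mul0r.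
- move=> [[t0 t00 t0z] hyb] I1 I2 xi xi' I1s I2s /is_xi_char xiP /is_xi_char xi'P.
  have conjE := self_conjugate (chi := chi) n_adm hyb.
  have x1 (J : {set 'I_2}) : J \subset [set s2] -> xi_values R J s1 = 0.
    rewrite /xi_values => /subsetP Js; case: ifP => // /Js.
    by rewrite inE.
  have sum1 : \sum_t Zk_char_eval C chi (aff_t D s1 t) = 0.
    by rewrite DT; apply: (sum_zeta_nontrivial (t0 := t0)) => //; rewrite inE t00.
  have sum2 : \sum_t Zk_char_eval C chi (aff_t D s2 t) = -1.
    rewrite DT; apply: (sum_zeta_trivial char_k char_R) => t /andP[t1 /= /eqP tb].
    (* Every element of [k^*] is a norm, and [zeta] is trivial on norms. *)
    have [u u0 <-] := norm_surj t1 tb.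
    by rewrite zeta_norm // hyb.
  (* At [s1] the characters and the sum vanish, so the value is free and no coboundary changes
     it. *)
  pose c (w : 'rV[R]_1) s : R := if s == s1 then w 0 0 else 0.
  apply: (hecke_Ext1_dim DX xiP xi'P (c := c)).
  + by move=> e u w s; rewrite /c !mxE; case: ifP => _; rewrite ?mulr0 ?addr0.
  + move=> w; split=> [s z zZ|s]; first by rewrite -conjE // mulrC.
    have [->|->] := s12P s; last by rewrite /c !mulr0.
    by rewrite sum1 !x1 // addr0.
  + move=> a [_ aP].
    (* If exactly one of [I1], [I2] contains [s2], then [e * e = 1] and the coboundary accounts for
       [a s2]; otherwise [e = 0] and the quadratic relation forces [a s2 = 0]. *)
    pose e := xi_values R I1 s2 - xi_values R I2 s2.
    exists (const_mx (a s1)), (a s2 * e); split=> [s|z _]; last by rewrite subrr mulr0.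
    have [->|->] := s12P s; rewrite /c /=.
      by rewrite mxE !x1 // subrr mulr0 addr0.
    have := aP s2; rewrite sum2 add0r -/e /e /xi_values.
    case: (s2 \in I1); case: (s2 \in I2) => aE.
    * rewrite subrr !mulr0; move/eqP: aE.
      by rewrite mulrDl -subr_eq0 addrK mulN1r oppr_eq0 => /eqP.
    * by rewrite subr0 mulrN1 mulrN1 opprK.
    * by rewrite sub0r opprK !mulr1.
    * rewrite subrr !mulr0; move/esym/eqP: aE.
      by rewrite addr0 mul0r mulN1r oppr_eq0 => /eqP.
  + move=> w m cm _; apply/rowP => l; rewrite ord1 mxE.
    by have := cm s1; rewrite /c /= !x1 // subrr mulr0.
move=> [t0 t00 t0z] chi' xi xi' /is_xi_char xiP /is_xi_char xi'P.
have sum0 s : \sum_t Zk_char_eval C chi (aff_t D s t) = 0.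
  (* A norm lies in [k^*], hence in [Z_{k,s}] for both [s], and [zeta] takes there the value
     [zeta t0] to the power [q + 1]. *)
  rewrite DT; apply: (sum_zeta_nontrivial (t0 := t0 * uq_bar E t0)).
    by rewrite inE mulf_neq0 ?bar_eq0 //= norm_fixed eqxx orbT.
  by rewrite zeta_norm.
have x0 s : xi_values R set0 s = 0 by rewrite /xi_values inE.
split=> conj.
  have conjE := (s1_conjugateP chi chi' n_adm).1 conj.
  apply: (hecke_Ext1_dim DX xiP xi'P (c := fun (w : 'rV[R]_2) s => w 0 s)).
  - by move=> e u w s; rewrite !mxE.
  - move=> w; split=> [s z zZ|s]; first by rewrite (conjE s) // mulrC.
    by rewrite sum0 !x0 addr0 mul0r.
  - move=> a _; exists (\row_s a s), 0; split=> [s|z _]; last by rewrite mul0r.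
    by rewrite mxE mul0r addr0.
  move=> w m cm _; apply/rowP => s; rewrite mxE.
  by have := cm s; rewrite !x0 subrr mulr0.
apply: (hecke_Ext1_dim DX xiP xi'P (c := fun _ _ => 0)).
- by move=> e u w s; rewrite mulr0 addr0.
- by split=> *; rewrite ?mulr0 ?mul0r.
- move=> a [aZ _]; exists 0, 0; split=> [s|z _]; rewrite mul0r ?addr0 //.
  (* A nonzero value at one [s] makes [chi'] the conjugate of [chi] by [n s], and both reflections
     act alike on [Z_k]. *)
  apply/eqP; apply: contra_notT conj => as0; apply/(s1_conjugateP chi chi' n_adm) => s' z zZ.
  apply: (mulfI as0); rewrite [RHS]mulrC (aZ s z zZ); congr (_ * _).
  have [b [c [b0 vb cc zE]]] := torus0P C z zZ.
  by rewrite !(Zk_char_conj chi _ n_adm b0 vb cc zE).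
by move=> w m _ _.
Qed.
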